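(* Let $\mathbb{K}$ be a field and let $R=\mathbb{K}[X_1,\dots,X_m,Y_1,\dots,Y_{\tilde m}]$ be $\mathbb{Z}^2$-graded by $\deg X_i=(1,0)$ and $\deg Y_i=(0,1)$. Let $H=\sum_{i,j}h_{ij}t_1^it_2^j\in\mathbb{Z}(\!(t_1,t_2)\!)$ be a formal Laurent series which is the Hilbert series of some finitely generated graded $R$-module. Let further $S=\mathbb{K}[X,Y]$ be the standard $\mathbb{Z}^2$-graded polynomial ring in two variables ($\deg X=(1,0)$, $\deg Y=(0,1)$). Then the following statements are equivalent: (a) $H$ has positive Hilbert depth (over $R$). (b) For any finitely generated torsionfree graded $S$-module $N$, $\dfrac{H\cdot H_N}{H_S}\ge 0$. (c) The inequality $\dfrac{H\cdot H_N}{H_S}\ge 0$ holds for any finitely generated torsionfree graded $S$-module $N$ of rank $1$, i.e. for every fractional monomial ideal $N\subseteq\mathbb{K}[X^{\pm1},Y^{\pm1}]$. (d) For every declining sequence $U$ in $\mathbb{Z}^2$, $$\sum_{(i,j)\in\mathcal{D}(U)}h_{ij}\ \le\ \sum_{(i,j)\in U}h_{ij}.$$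
   Context: $\mathbb{Z}(\!(t_1,t_2)\!)$ is the ring of formal series $\sum_{\mathbf{a}\in\mathbb{Z}^2}c_{\mathbf{a}}\mathbf{t}^{\mathbf{a}}$ with integer coefficients vanishing unless $\mathbf{a}\ge\mathbf{b}$ (componentwise) for some $\mathbf{b}\in\mathbb{Z}^2$. The Hilbert series of a finitely generated $\mathbb{Z}^2$-graded module $M$ is $H_M=\sum_{\mathbf{a}\in\mathbb{Z}^2}(\dim_{\mathbb{K}}M_{\mathbf{a}})\,t_1^{a_1}t_2^{a_2}$. A series $G$ satisfies $G\ge0$ if all its coefficients are nonnegative. The Hilbert depth of a series $H$ that is the Hilbert series of some finitely generated graded $R$-module is $\sup\{\operatorname{depth}(N)\mid N \text{ a finitely generated graded } R\text{-module with } H_N=H\}$, depth being taken with respect to the ideal generated by all variables. A fractional monomial ideal is a finitely generated $\mathbb{Z}^2$-graded $S$-submodule of $\mathbb{K}[X^{\pm1},Y^{\pm1}]$. A (finite) sequence $U=(\mathbf{u}^{(i)})_{i=1}^p$ in $\mathbb{Z}^2$ is declining if $u_1^{(i)}<u_1^{(i+1)}$ and $u_2^{(i)}>u_2^{(i+1)}$ for $i=1,\dots,p-1$. For a sequence $U=(\mathbf{u}^{(i)})_{i=1}^p$, $\mathcal{D}(U)=(\mathbf{u}^{(i)}\wedge\mathbf{u}^{(i+1)})_{i=1}^{p-1}$, where $\wedge$ is the componentwise minimum. (For $p=1$, $\mathcal{D}(U)$ is empty.) *)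

(* Defs.v *)
From HB Require Import structures.
From mathcomp Require Import all_boot all_order all_algebra.
From mathcomp Require Import boolp classical_sets fsbigop.
(* The notations of constructive_ereal clash with those of mpoly, so only the
   type [extended] (constructors [EFin], [EPInf], [ENInf]) and its order are
   imported. *)
From mathcomp Require constructive_ereal.
Import -(notations) constructive_ereal.
From mathcomp Require Import mpoly.

Set Implicit Arguments.
Unset Strict Implicit.
Unset Printing Implicit Defensive.
Import Order.TTheory GRing.Theory Num.Theory.
Local Open Scope classical_set_scope.
Local Open Scope ring_scope.

Section Modules.
Variables (K : fieldType) (m mt : nat).
Local Notation R := {mpoly K[m + mt]}.

(* R = K[X_1..X_m, Y_1..Y_mt]: the variables X_i are those of index
   [lshift mt i], the Y_j those of index [rshift m j]. *)
Definition mon_deg (u : 'X_{1.. m + mt}) : int * int :=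
  ((\sum_(i < m) u (lshift mt i))%N%:Z, (\sum_(j < mt) u (rshift m j))%N%:Z).

Definition poly_comp (a : int * int) : set R :=
  [set p | forall u, u \in msupp p -> mon_deg u = a].

Section OneModule.
Variable M : lmodType R.

(* M is the internal direct sum of the additive subgroups G a, and
   R_a G_b is contained in G_(a + b). *)
Record grading (G : int * int -> set M) : Prop := Grading {
  grading0 : forall a, G a 0;
  gradingB : forall a x y, G a x -> G a y -> G a (x - y);
  gradingZ : forall a b p x, poly_comp a p -> G b x -> G (a + b) (p *: x);
  grading_sum : forall x, exists (s : seq (int * int)) (f : int * int -> M),
    [/\ uniq s, forall a, G a (f a) & x = \sum_(a <- s) f a];
  grading_free : forall (s : seq (int * int)) (f : int * int -> M), uniq s ->
    (forall a, G a (f a)) -> \sum_(a <- s) f a = 0 ->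
    forall a, a \in s -> f a = 0 }.

Definition submod_span (xs : seq M) : set M :=
  [set x | exists c : 'I_(size xs) -> R, x = \sum_(i < size xs) c i *: xs`_i].

Definition fin_gen : Prop := exists xs : seq M, submod_span xs = setT.

Definition torsionfree : Prop :=
  forall (p : R) (x : M), p *: x = 0 -> p = 0 \/ x = 0.

Definition lin_indep (xs : seq M) : Prop :=
  forall c : 'I_(size xs) -> R,
    \sum_(i < size xs) c i *: xs`_i = 0 -> forall i, c i = 0.

Definition has_rank (r : nat) : Prop :=
  (exists2 xs : seq M, lin_indep xs & size xs = r) /\
  (forall xs : seq M, lin_indep xs -> (size xs <= r)%N).

(* b is a K-basis of V, where K acts on M through the constants of R. *)
Definition is_Kbasis (V : set M) (d : nat) (b : 'I_d -> M) : Prop :=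
  (V = [set x | exists c : 'I_d -> K, x = \sum_(i < d) (c i)%:MP *: b i]) /\
  (forall c : 'I_d -> K,
     \sum_(i < d) (c i)%:MP *: b i = 0 -> forall i, c i = 0).

(* K-dimension; the value 0 when V is not finite-dimensional is irrelevant, as
   the components of a finitely generated graded module all are. *)
Definition Kdim (V : set M) : nat :=
  xget 0%N [set d : nat | exists b : 'I_d -> M, is_Kbasis V b].

Definition hilbert_series (G : int * int -> set M) : int * int -> int :=
  fun a => (Kdim (G a))%:Z.

(* (xs) M, for the ideal (xs) of R generated by xs. *)
Definition ideal_mul (xs : seq R) : set M :=
  [set y | exists f : 'I_(size xs) -> M, y = \sum_(i < size xs) xs`_i *: f i].

Definition regular_seq (xs : seq R) : Prop :=
  (forall (k : nat) (y : M), (k < size xs)%N ->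
     ideal_mul (take k xs) (xs`_k *: y) -> ideal_mul (take k xs) y) /\
  ideal_mul xs <> setT.

End OneModule.

Definition all_vars : seq R := [seq 'X_i | i <- enum 'I_(m + mt)].

Definition irrelevant_ideal : set R := @ideal_mul R^o all_vars.

(* Depth with respect to I = [irrelevant_ideal]: the supremum of the lengths of
   the M-regular sequences in I, with the usual convention that it is +oo if
   I M = M. For M finitely generated and graded the latter means M = 0, so that
   the zero module has infinite depth. *)
Definition depth (M : lmodType R) : extended int :=
  if `[< @ideal_mul M all_vars = setT >] then @EPInf int
  else supremum (EFin (0 : int))
    [set EFin (size xs)%:Z | xs in
       [set xs : seq R | (forall x, x \in xs -> irrelevant_ideal x) /\
                         @regular_seq M xs]].

End Modules.

Record gmod (K : fieldType) (m mt : nat) := GMod {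
  gmod_sort :> lmodType {mpoly K[m + mt]};
  gcomp : int * int -> set gmod_sort;
  gcompP : grading gcomp }.

Definition Hilb (K : fieldType) (m mt : nat) (N : gmod K m mt) :=
  hilbert_series (@gcomp _ _ _ N).

Definition is_Hilb (K : fieldType) (m mt : nat) (H : int * int -> int) : Prop :=
  exists2 N : gmod K m mt, fin_gen N & Hilb N = H.

Definition hilbert_depth (K : fieldType) (m mt : nat)
    (H : int * int -> int) : extended int :=
  supremum (EFin (0 : int))
    [set d | exists N : gmod K m mt,
               [/\ fin_gen N, Hilb N = H & d = depth N]].

Section PolyGMod.
Variables (K : fieldType) (m mt : nat).

Lemma poly_grading : @grading K m mt ({mpoly K[m + mt]}^o) (@poly_comp K m mt).
Proof.
have hsum (I : Type) (r : seq I) (P : pred I) (F : I -> {mpoly K[m + mt]}) a :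
    (forall i, P i -> poly_comp a (F i)) -> poly_comp a (\sum_(i <- r | P i) F i).
  move=> hF; elim/big_rec: _ => [u|i x Pi hx u]; first by rewrite msupp0.
  by move/msuppD_le; rewrite mem_cat => /orP[/(hF i Pi)|/hx].
have hcoef a (p : {mpoly K[m + mt]}) u : poly_comp a p -> mon_deg u != a -> p@_u = 0.
  move=> hp; apply: contraNeq; rewrite -mcoeff_msupp => /hp ->.
  exact: eqxx.
split.
- by move=> a u; rewrite msupp0.
- move=> a x y hx hy u /msuppB_le; rewrite mem_cat.
  by case/orP=> [/hx|/hy].
- move=> a b p x hp hx u /msuppM_le /allpairsP[[v w] /= [/hp <- /hx <- ->]].
  rewrite /mon_deg; congr pair; rewrite /= -PoszD -big_split /=;
    by congr Posz; apply: eq_bigr => i _; rewrite mnmDE.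
- move=> p; exists (undup [seq mon_deg u | u <- msupp p]).
  exists (fun a => \sum_(u <- msupp p | mon_deg u == a) p@_u *: 'X_[u]).
  split; first exact: undup_uniq.
  + move=> a; apply: hsum => u /eqP <- v /msuppZ_le.
    by rewrite msuppX inE => /eqP ->.
  + rewrite [LHS]mpolyE; under [RHS]eq_bigr do rewrite big_mkcond.
    rewrite exchange_big /=; apply: eq_big_seq => u up.
    rewrite (bigD1_seq (mon_deg u)) ?undup_uniq ?mem_undup ?map_f //= eqxx.
    by rewrite big1 ?addr0 // => a; rewrite eq_sym => /negbTE ->.
- move=> s f us hf sf0 a sa; apply/mpolyP => u; rewrite mcoeff0.
  have [ua|] := eqVneq (mon_deg u) a; last exact: hcoef.
  have := congr1 (mcoeff u) sf0; rewrite mcoeff0 => <-.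
  rewrite raddf_sum /= (bigD1_seq a) //= big1_seq ?addr0 // => b /andP[ba _].
  by apply: hcoef (hf b) _; rewrite ua eq_sym.
Qed.

(* The polynomial ring as a graded module over itself. *)
Definition poly_gmod : gmod K m mt := GMod poly_grading.

End PolyGMod.

(* Elements of Z((t1,t2)) are represented by their coefficient functions. *)
Definition laurent_series (F : int * int -> int) : Prop :=
  exists b : int * int,
    forall a : int * int, ~~ ((b.1 <= a.1) && (b.2 <= a.2)) -> F a = 0.

(* The sum is finitely supported when F and G are Laurent series. *)
Definition series_mul (F G : int * int -> int) : int * int -> int :=
  fun a => \sum_(b \in [set: int * int]) F b * G (a - b).

(* Quotient in the integral domain Z((t1,t2)); it is used with G the Hilbert
   series 1/((1-t1)(1-t2)) of K[X,Y], a unit, so the quotient always exists. *)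
Definition series_div (F G : int * int -> int) : int * int -> int :=
  xget (fun=> 0 : int)
    [set Q : int * int -> int | laurent_series Q /\ series_mul Q G = F].

Definition series_ge0 (F : int * int -> int) : Prop := forall a, 0 <= F a.

(* K[X^{+-1},Y^{+-1}] is realized inside the fraction field of S = K[X,Y],
   seen as an S-module. *)
Definition fracS (K : fieldType) := {fraction {mpoly K[1 + 1]}}.
HB.instance Definition _ (K : fieldType) := GRing.Field.on (fracS K).

Section Fractional.
Variable K : fieldType.
Local Notation S := {mpoly K[1 + 1]}.

Definition fracS_scale (p : S) (x : fracS K) : fracS K := tofrac p * x.

Fact fracS_scaleA p q x :
  fracS_scale p (fracS_scale q x) = fracS_scale (p * q) x.
Proof. by rewrite /fracS_scale rmorphM mulrA. Qed.

Fact fracS_scale1 : left_id 1 fracS_scale.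
Proof. by move=> x; rewrite /fracS_scale rmorph1 mul1r. Qed.

Fact fracS_scaleDr : right_distributive fracS_scale +%R.
Proof. by move=> p x y; rewrite /fracS_scale mulrDr. Qed.

Fact fracS_scaleDl x : {morph fracS_scale^~ x : p q / p + q}.
Proof. by move=> p q; rewrite /fracS_scale rmorphD mulrDl. Qed.

HB.instance Definition _ := GRing.Zmodule_isLmodule.Build S (fracS K)
  fracS_scaleA fracS_scale1 fracS_scaleDr fracS_scaleDl.

Definition laurent_monomial (a : int * int) : fracS K :=
  tofrac ('X_(lshift 1 ord0) : S) ^ a.1 * tofrac ('X_(rshift 1 ord0) : S) ^ a.2.

Definition laurent_comp (a : int * int) : set (fracS K) :=
  [set x | exists c : K, x = c%:MP *: laurent_monomial a].

Definition laurent_poly : set (fracS K) :=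
  [set x | exists (s : seq (int * int)) (f : int * int -> fracS K),
     [/\ uniq s, forall a, laurent_comp a (f a) & x = \sum_(a <- s) f a]].

(* Finitely generated Z^2-graded S-submodules of K[X^{+-1},Y^{+-1}]. *)
Definition fractional_monomial_ideal (I : set (fracS K)) : Prop :=
  [/\ exists xs : seq (fracS K), I = submod_span xs,
      I `<=` laurent_poly &
      forall x, I x -> exists (s : seq (int * int)) (f : int * int -> fracS K),
        [/\ uniq s, forall a, (I `&` laurent_comp a) (f a)
          & x = \sum_(a <- s) f a]].

Definition Hilb_ideal (I : set (fracS K)) : int * int -> int :=
  hilbert_series (fun a => I `&` laurent_comp a).

End Fractional.

Definition declining (U : seq (int * int)) : bool :=
  sorted (fun u v : int * int => (u.1 < v.1) && (v.2 < u.2)) U.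

Definition cmeet (u v : int * int) : int * int :=
  (Num.min u.1 v.1, Num.min u.2 v.2).

Definition meet_seq (U : seq (int * int)) : seq (int * int) :=
  if U is u :: s then pairmap cmeet u s else [::].

(* Main.v *)
From HB Require Import structures.
Require Import Defs.
From mathcomp Require Import all_boot all_order all_algebra.
From mathcomp Require Import boolp classical_sets fsbigop.
From mathcomp Require constructive_ereal.
Import -(notations) constructive_ereal.
From mathcomp Require Import mpoly.
From mathcomp Require Import zify ring lra.
Set Implicit Arguments.
Unset Strict Implicit.
Unset Printing Implicit Defensive.
Import Order.TTheory GRing.Theory Num.Theory.
Local Open Scope classical_set_scope.
Local Open Scope ring_scope.

(** Write [D1] and [D2] for the multiplication of a series by [1 - t1] and
    [1 - t2].  The five conditions are linked through a splitting property of
    [H]: there are [H1, H2 >= 0] with [H = H1 + H2], [D1 H1 >= 0] and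
    [D2 H2 >= 0].

    Positive depth gives the splitting.  A module of positive depth has no
    nonzero element killed by all variables ([depth_gt0_socle]).  Filter it by
    the submodules of the elements killed by powers of the first [k] variables:
    the [k]-th variable is injective on the [k]-th factor, so the Hilbert
    function of that factor increases in the direction of that variable.  Since
    the filtration ends at [0], adding up the factors that belong to the [X_i],
    resp. to the [Y_j], yields [H1], resp. [H2] ([socle_free_split]).  This
    works over every field, as no generic linear form is involved.

    The splitting gives the inequality for every torsionfree [N].  As
    [H_S = 1 / ((1 - t1)(1 - t2))], division by [H_S] is [D1 D2], and
    [D1 D2 (H H_N) = (D1 H1)(D2 H_N) + (D2 H2)(D1 H_N)].  Both variables of [S]
    are injective on [N], so all four factors are nonnegative
    ([series_ge0_split]).

    A nonzero fractional monomial ideal is a torsionfree module of rank one, so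
    the inequality holds for it too ([fractional_ideal_ge0]).  For the ideal
    generated by the monomials of exponents [- u], [u] in a declining sequence
    [U], inclusion-exclusion along the staircase gives the numerator
    [sum_U t^(- u) - sum_D(U) t^(- w)], and the coefficient of degree [0] of the
    quotient is the difference of the two sides of the last condition
    ([staircase_ideal_criterion]).

    The last condition gives a module of positive depth.  Finding [H1] means
    solving a system of difference constraints; the closed walks that could
    obstruct it are the declining sequences, and shortest paths provide a
    solution ([staircase_potential]).  The splitting alone does not produce a
    finitely generated module, and here it matters that [H] is a Hilbert series.
    Standard monomials and the stabilisation of chains of order ideals show that
    [H] is a finite sum of series [t^c / ((1 - t1)^i (1 - t2)^j)] with [i <= m]
    and [j <= mt] ([fin_gen_hilbert_box]).  Far out in either direction such an
    [H] is already monotone, so [H1] is needed on a finite rectangle only, and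
    extending it monotonically to rows and columns writes [H] as a finite sum of
    such series with [i + j > 0] ([staircase_box_pos]).  Each summand is the
    Hilbert series of a polynomial ring in [i + j] of the variables; on the
    direct sum of these rings the sum of all variables is regular
    ([box_sum_realization]), hence the depth is positive. *)

(** * Staircases and difference constraints *)

Definition staircase_weight (H : int * int -> int) (U : seq (int * int)) : int :=
  \sum_(a <- U) H a - \sum_(a <- meet_seq U) H a.

Lemma staircase_weight_cons H v u U :
  staircase_weight H [:: v, u & U] =
  H v - H (cmeet v u) + staircase_weight H (u :: U).
Proof. rewrite /staircase_weight /= !big_cons; ring. Qed.

Lemma staircase_weight1 H u : staircase_weight H [:: u] = H u.
Proof. by rewrite /staircase_weight /= big_seq1 big_nil subr0. Qed.

(** The unknown [H1] has to satisfy difference constraints: it may not decrease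
    to the right, moving up by one may increase it by at most the increase of
    [H], and it lies between [0] and [H].  A walk that starts at a point at cost
    [H] and goes left (cost [0]) and up (cost the increase of [H]) has, by
    telescoping, the cost [staircase_weight] of the declining sequence of its
    upper corners.  These costs are nonnegative by hypothesis, so the least cost
    of a walk ending at [a] exists, and it is a solution. *)
Lemma staircase_potential (H : int * int -> int) :
    (forall U, declining U ->
       \sum_(a <- meet_seq U) H a <= \sum_(a <- U) H a) ->
  exists H1 : int * int -> int,
    [/\ forall a, 0 <= H1 a <= H a,
        forall x y, H1 (x, y) <= H1 (x + 1, y) &
        forall x y, H (x, y) - H1 (x, y) <= H (x, y + 1) - H1 (x, y + 1)].
Proof.
move=> dH; pose w := staircase_weight H.
pose isw (a : int * int) (n : nat) := exists u U,
  [/\ declining (u :: U), u.2 = a.2, a.1 <= u.1 & w (u :: U) = n%:Z].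
have wP (a : int * int) u U : declining (u :: U) -> u.2 = a.2 -> a.1 <= u.1 ->
    isw a `|w (u :: U)|%N.
  move=> dU e l; exists u, U; split=> //.
  by rewrite gez0_abs // /w /staircase_weight subr_ge0 dH.
have ex a : exists n, `[< isw a n >].
  by exists `|w [:: a]|%N; apply/asboolP/wP.
have H_ge0 a : 0 <= H a by have := dH [:: a] isT; rewrite /= big_nil big_seq1.
pose H1 a := (ex_minn (ex a))%:Z.
have H1le (a : int * int) u U : declining (u :: U) -> u.2 = a.2 -> a.1 <= u.1 ->
    H1 a <= w (u :: U).
  move=> dU e l; rewrite /H1; case: ex_minnP => n _ /(_ `|w (u :: U)|%N).
  have w0 : 0 <= w (u :: U) by rewrite /w /staircase_weight subr_ge0 dH.
  move=> /(_ (asboolT (wP _ _ _ dU e l))); lia.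
have H1ex (a : int * int) : exists u U,
    [/\ declining (u :: U), u.2 = a.2, a.1 <= u.1 & w (u :: U) = H1 a].
  by rewrite /H1; case: ex_minnP => n /asboolP.
have H1_ge0 (a : int * int) : 0 <= H1 a by [].
(* from here on only the bounds and the existence of optimal walks matter *)
clearbody H1; exists H1; split.
- move=> a; apply/andP; split=> //.
  by have := H1le a a [::] isT erefl (lexx _); rewrite /w staircase_weight1.
- move=> x y; have [u [U [dU e l <-]]] := H1ex (x + 1, y).
  by apply: H1le => //; move: l => /=; lia.
move=> x y; have [[u1 u2] [U [/= dU e l e1]]] := H1ex (x, y).
(* an optimal walk to (x, y) is prolonged by one step up: the new point is a
   new corner if the walk arrives from the right, and replaces the last
   corner if the walk arrives from below *)
rewrite {}e in dU e1; have [lt|ge] := ltP x u1.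
  have := H1le (x, y + 1) (x, y + 1) ((u1, y) :: U).
  rewrite /w staircase_weight_cons /cmeet /=.
  have -> : Num.min x u1 = x by lia.
  have -> : Num.min (y + 1) y = y by lia.
  rewrite lt (_ : y < y + 1 = true) ?dU /=; last lia.
  move=> /(_ isT erefl (lexx _)); rewrite -/(w _) e1 => h.
  move: h; move: (H1 _) (H1 _) (H _) (H _) => p q r s; lia.
have {}ge : u1 = x by lia.
subst u1; have := H1le (x, y + 1) (x, y + 1) U.
case: U dU e1 => [|[v1 v2] U] dU.
  rewrite /w !staircase_weight1 => <- /(_ isT erefl (lexx _)) h.
  by rewrite subrr subr_ge0.
move: dU; rewrite /= => /andP[/andP[xv vy] dU].
rewrite /w !staircase_weight_cons /cmeet /=.
have -> : Num.min y v2 = v2 by lia.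
have -> : Num.min (y + 1) v2 = v2 by lia.
rewrite xv (_ : v2 < y + 1 = true) ?dU /=; last lia.
move=> <- /(_ isT erefl (lexx _)) h.
move: h; move: (H1 _) (H _) (H _) (H _) (staircase_weight _ _) => p q r s t; lia.
Qed.

(** * Nonnegative combinations of Hilbert series of polynomial rings *)

(** An inductive predicate rather than explicit lists of coefficients: additive
    operators then act on such sums through [nnsum_map]. *)
Inductive nnsum (T : Type) (B : (T -> int) -> Prop) : (T -> int) -> Prop :=
| nnsum0 : nnsum B (fun=> 0)
| nnsumS f g : B f -> nnsum B g -> nnsum B (fun a => f a + g a).

Section NNSum.
Variables (T : Type) (B : (T -> int) -> Prop).

Lemma nnsumD f g : nnsum B f -> nnsum B g -> nnsum B (fun a => f a + g a).
Proof.
elim=> [|f1 f2 Bf1 _ IH] Bg.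
  by rewrite (_ : (fun a => _) = g) //; apply/funext => a; rewrite add0r.
rewrite (_ : (fun a => _) = (fun a => f1 a + (f2 a + g a))).
  exact: nnsumS Bf1 (IH Bg).
by apply/funext => a; rewrite addrA.
Qed.

Lemma nnsum_gen f : B f -> nnsum B f.
Proof.
move=> Bf; rewrite (_ : f = fun a => f a + 0); last first.
  by apply/funext => a; rewrite addr0.
exact: nnsumS Bf (nnsum0 _).
Qed.

Lemma nnsum_sum (I : Type) (s : seq I) (F : I -> T -> int) :
  (forall i, nnsum B (F i)) -> nnsum B (fun a => \sum_(i <- s) F i a).
Proof.
move=> BF; elim: s => [|i s IH].
  rewrite (_ : (fun a => _) = fun=> 0); first exact: nnsum0.
  by apply/funext => a; rewrite big_nil.
rewrite (_ : (fun a => _) = fun a => F i a + \sum_(j <- s) F j a).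
  exact: nnsumD.
by apply/funext => a; rewrite big_cons.
Qed.

Lemma nnsumZ (c : int) f : 0 <= c -> nnsum B f -> nnsum B (fun a => c * f a).
Proof.
case: c => // n _ Bf; elim: n => [|n IH].
  rewrite (_ : (fun a => _) = fun=> 0); first exact: nnsum0.
  by apply/funext => a; rewrite mul0r.
rewrite (_ : (fun a => _) = fun a => f a + n%:Z * f a); first exact: nnsumD.
by apply/funext => a; rewrite -[n.+1]addn1 PoszD mulrDl mul1r addrC.
Qed.

End NNSum.

Lemma nnsum_map (T T' : Type) (B : (T -> int) -> Prop) (B' : (T' -> int) -> Prop)
    (phi : (T -> int) -> T' -> int) :
    phi (fun=> 0) = (fun=> 0) ->
    (forall f g, phi (fun a => f a + g a) = fun a => phi f a + phi g a) ->
    (forall f, B f -> nnsum B' (phi f)) ->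
  forall f, nnsum B f -> nnsum B' (phi f).
Proof.
move=> phi0 phiD phiB f; elim=> [|f1 f2 Bf1 _ IH].
  by rewrite phi0; apply: nnsum0.
by rewrite phiD; apply: nnsumD IH; apply: phiB.
Qed.

Lemma nnsum_sub (T : Type) (B B' : (T -> int) -> Prop) :
  (forall f, B f -> B' f) -> forall f, nnsum B f -> nnsum B' f.
Proof.
move=> BB' f; apply: (@nnsum_map _ _ B B' id) => // g Bg.
exact: nnsum_gen (BB' _ Bg).
Qed.

(** The number of monomials of degree [n] in [i] variables, that is the
    coefficient of [t^n] in [1 / (1 - t)^i]. *)
Definition mcount (i : nat) (n : int) : int :=
  match n with
  | Posz k => if i is i'.+1 then 'C(k + i', i')%:Z else (k == 0)%:Z
  | Negz _ => 0
  end.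

Lemma mcount_ge0 i n : 0 <= mcount i n.
Proof. by case: n => [[|n]|n]; case: i. Qed.

Lemma mcount_neg i n : n < 0 -> mcount i n = 0.
Proof. by case: n. Qed.

(** Multiplication by [1 - t] lowers the order of the pole at [1]; the identity
    is Pascal's rule, and it determines [mcount i.+1] from [mcount i]. *)
Lemma mcount_diff i n : mcount i.+1 n - mcount i.+1 (n - 1) = mcount i n.
Proof.
case: n => [[|n]|n].
- by rewrite [mcount i.+1 (0 - 1)]mcount_neg //= subr0; case: i => [|i]; rewrite /= !binn.
- rewrite (_ : n.+1%:Z - 1 = n%:Z) /=; last by lia.
  case: i => [|i]; first by rewrite !bin0 subrr.
  by rewrite !addnS !addSn binS PoszD addrC addKr.
- by rewrite !mcount_neg ?subr0 //; lia.
Qed.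

Lemma mcount0 n : mcount 0 n = (n == 0)%:Z.
Proof. by case: n. Qed.

(** Series in one variable that are sums of terms [t^c / (1 - t)^i] with
    [l <= i <= h]. *)
Definition ray_sum (l h : nat) : (int -> int) -> Prop :=
  nnsum (fun f => exists (i : nat) (c : int),
    [/\ (l <= i <= h)%N & f = fun a : int => mcount i (a - c)]).

Lemma ray_gen l h i (c : int) : (l <= i <= h)%N -> ray_sum l h (fun a : int => mcount i (a - c)).
Proof. by move=> lih; apply: nnsum_gen; exists i, c. Qed.

Lemma ray_sum_sub l h l' h' f :
  (l' <= l)%N -> (h <= h')%N -> ray_sum l h f -> ray_sum l' h' f.
Proof.
move=> ll hh; apply: nnsum_sub => g [i [c [lih ->]]]; exists i, c; split=> //.
lia.
Qed.

Lemma ray_sum_empty f : ray_sum 1 0 f -> f = fun=> 0.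
Proof. by case=> // f1 f2 [i [c [lih _]]] _; lia. Qed.

Lemma int_zero_diff (d : int -> int) (a0 : int) :
  (forall a : int, a < a0 -> d a = 0) -> (forall a : int, d a = d (a - 1)) -> forall a, d a = 0.
Proof.
move=> d0 dS a; have [/d0//|a0a] := ltP a a0.
have -> : a = a0 + `|a - a0|%N by lia.
elim: `|a - a0|%N => [|n IH]; rewrite dS; first by apply: d0; lia.
by rewrite -[RHS]IH; congr d; lia.
Qed.

(** Division by [1 - t] sends [t^c / (1 - t)^i] to [t^c / (1 - t)^(i + 1)], and
    among the functions that vanish far to the left a function is determined by
    its differences. *)
Lemma ray_sum_integral l h f g (a0 : int) :
    ray_sum l h g -> (forall a : int, a < a0 -> f a = 0) ->
  (forall a : int, f a - f (a - 1) = g a) -> ray_sum l.+1 h.+1 f.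
Proof.
move=> rg f0 fg.
have [F [rF Fg [b0 F0]]] : exists F, [/\ ray_sum l.+1 h.+1 F,
    forall a : int, F a - F (a - 1) = g a & exists b0 : int, forall a : int, a < b0 -> F a = 0].
  elim: rg => [|_ g2 [i [c [lih ->]]] _ [F [rF Fg [b0 F0]]]].
    by exists (fun=> 0); split; [exact: nnsum0|move=> a; rewrite subrr|exists 0].
  exists (fun a => mcount i.+1 (a - c) + F a); split.
  - by apply: nnsumS rF; exists i.+1, c.
  - move=> a /=; rewrite -(mcount_diff i) -(Fg a).
    rewrite (_ : a - 1 - c = a - c - 1); last by lia.
    by ring.
  - exists (Num.min b0 c) => a; rewrite lt_min => /andP[/F0 -> ac].
    by rewrite mcount_neg //; lia.
suff -> : f = F by [].
apply/funext => a; apply/eqP; rewrite -subr_eq0; apply/eqP.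
apply: (@int_zero_diff (fun a => f a - F a) (Num.min a0 b0)) => {}a.
  by rewrite lt_min => /andP[/f0 -> /F0 ->]; rewrite subrr.
by move: (fg a) (Fg a) => /=; lra.
Qed.

(** By induction on the order of the pole, since the differences of a truncated
    function are the truncated differences plus one term at the cut.  That term
    has pole order [0] before summation and [1] after it, whence the bound on
    [l]. *)
Lemma ray_sum_trunc l h f (k : int) : (l <= 1)%N ->
  ray_sum l h f -> ray_sum l h (fun a : int => (k <= a)%R%:Z * f a).
Proof.
move=> l1; apply: (@nnsum_map _ _ _ _ (fun f (a : int) => (k <= a)%R%:Z * f a)) => {f}.
- by apply/funext => a; rewrite mulr0.
- by move=> f g; apply/funext => a; rewrite mulrDr.
move=> _ [i [c [lih ->]]]; apply: (@ray_sum_sub (0 < i) i); try lia.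
move: {l1 lih} k; elim: i => [|i IH] k.
  have [kc|ck] := leP k c.
    rewrite (_ : (fun a => _) = fun a => mcount 0 (a - c)); first exact: ray_gen.
    apply/funext => a; have [ka|ak] := leP k a; first by rewrite mul1r.
    by rewrite mul0r mcount_neg //; lia.
  rewrite (_ : (fun a => _) = fun=> 0); first exact: nnsum0.
  apply/funext => a; have [ka|ak] := leP k a; last by rewrite mul0r.
  by rewrite mcount0 (_ : a - c == 0 = false) ?mulr0 //; lia.
pose g (a : int) := ((k + 1 <= a)%R%:Z * mcount i (a - c)) +
            mcount i.+1 (k - c) * mcount 0 (a - k).
have rg : ray_sum 0 i g.
  apply: nnsumD; first by apply: ray_sum_sub (IH (k + 1)).
  by apply: nnsumZ; [exact: mcount_ge0 | apply: ray_gen].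
apply: (ray_sum_integral (a0 := k) rg) => a.
  by move=> ak; rewrite leNgt ak mul0r.
rewrite /g mcount0 -(mcount_diff i) (_ : a - 1 - c = a - c - 1); last by lia.
rewrite (_ : a - k == 0 = (a == k)); last by lia.
have [->|ak] := eqVneq a k.
  have -> : (k <= k - 1) = false by lia.
  have -> : (k + 1 <= k) = false by lia.
  by rewrite lexx !mul0r mul1r mulr1 subr0 add0r.
rewrite mulr0 addr0; have [ka|ka] := leP k a.
  have -> : (k <= a - 1) by lia.
  have -> : (k + 1 <= a) by lia.
  by rewrite !mul1r.
have -> : (k <= a - 1) = false by lia.
have -> : (k + 1 <= a) = false by lia.
by rewrite !mul0r subr0.
Qed.

(** The differences are nonnegative: finitely many nonzero ones up to [A], and
    those of [phi] beyond.  Summing them produces rays again.  For [m = 0] the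
    function vanishes beyond [A], hence everywhere by monotonicity. *)
Lemma ray_sum_monotone m f phi (A a0 : int) :
    ray_sum 1 m phi -> (forall a : int, A <= a -> f a = phi a) ->
    (forall a : int, a < a0 -> f a = 0) -> (forall a : int, a < A -> f a <= f (a + 1)) ->
  ray_sum 1 m f.
Proof.
move=> rphi fphi f0 fS.
have f_ge0 (a : int) : a <= A -> 0 <= f a.
  have [/f0->//|a0a aA] := ltP a a0.
  have gen (n : nat) : a0 - 1 + n%:Z <= A -> 0 <= f (a0 - 1 + n%:Z).
    elim: n => [|n IH] nA; first by rewrite f0 //; lia.
    apply: le_trans (IH _) _; first lia.
    have := fS (a0 - 1 + n%:Z); rewrite (_ : _ + 1 = a0 - 1 + n.+1%:Z); last by lia.
    by apply; lia.
  by rewrite (_ : a = a0 - 1 + `|(a - a0 + 1)%R|%N%:Z); [apply: gen|]; lia.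
case: m rphi => [|m] rphi.
  have phi0 (a : int) : phi a = 0.
    by rewrite (ray_sum_empty rphi).
  suff -> : f = fun=> 0 by exact: nnsum0.
  apply/funext => a; have [/fphi ->|aA] := leP A a; first exact: phi0.
  suff : f a <= 0 by move: (f_ge0 a); lia.
  have gen (n : nat) : f (A - n%:Z) <= 0.
    elim: n => [|n IH]; first by rewrite subr0 fphi ?phi0.
    apply: le_trans (fS _ _) _; first lia.
    by rewrite (_ : A - n.+1%:Z + 1 = A - n%:Z) //; lia.
  by rewrite (_ : a = A - `|(A - a)%R|%N%:Z); [apply: gen|lia].
have rD : ray_sum 0 m (fun a : int => phi a - phi (a - 1)).
  apply: (@nnsum_map _ _ _ _ (fun f (a : int) => f a - f (a - 1)) _ _ _ _ rphi).
  - by apply/funext => a; rewrite subrr.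
  - by move=> f1 f2; apply/funext => a; ring.
  move=> _ [[|i] [c [lih ->]]] //.
  rewrite (_ : (fun a => _) = fun a => mcount i (a - c)); first by apply: ray_gen; lia.
  apply/funext => a; rewrite -(mcount_diff i).
  by rewrite (_ : a - 1 - c = a - c - 1); last by lia.
pose D (a : int) := f a - f (a - 1).
pose s : seq int := [seq a0 + k%:Z | k <- iota 0 `|(Num.max 0 (A + 1 - a0))%R|%N].
pose g (a : int) := (\sum_(t <- s) Num.max 0 (D t) * mcount 0 (a - t)) +
  (A + 1 <= a)%R%:Z * (phi a - phi (a - 1)).
apply: (@ray_sum_integral 0 m f g a0) => // [|a].
  apply: nnsumD; last exact: ray_sum_trunc.
  apply: nnsum_sum => t; apply: nnsumZ; first by lia.
  exact: ray_gen.
rewrite /g; have [Aa|aA] := leP (A + 1) a.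
  rewrite big1_seq ?add0r ?mul1r; first by rewrite !fphi //; lia.
  move=> t /andP[_ /mapP[k]]; rewrite mem_iota => kb ->.
  by rewrite mcount0 (_ : (a - (a0 + k%:Z) == 0) = false) ?mulr0 //; lia.
rewrite mul0r addr0; have [aa0|a0a] := ltP a a0.
  rewrite big1_seq; first by rewrite !f0 ?subrr //; lia.
  move=> t /andP[_ /mapP[k]]; rewrite mem_iota => kb ->.
  by rewrite mcount0 (_ : (a - (a0 + k%:Z) == 0) = false) ?mulr0 //; lia.
rewrite (bigD1_seq a) /=; last 2 first.
- by apply/mapP; exists `|(a - a0)%R|%N; rewrite ?mem_iota; lia.
- by rewrite map_inj_uniq ?iota_uniq // => x y /=; lia.
rewrite subrr mcount0 eqxx mulr1 big1 => [|t ta]; last first.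
  by rewrite mcount0 (_ : (a - t == 0) = false) ?mulr0 //; lia.
rewrite addr0 /D max_r // subr_ge0.
have := fS (a - 1); rewrite subrK; apply; lia.
Qed.

(** Series in two variables that are sums of terms
    [t1^c1 t2^c2 / ((1 - t1)^i (1 - t2)^j)] with [Q i j]. *)
Definition box_sum (Q : nat -> nat -> bool) : (int * int -> int) -> Prop :=
  nnsum (fun f => exists (i j : nat) (c1 c2 : int),
    Q i j /\ f = fun a : int * int => mcount i (a.1 - c1) * mcount j (a.2 - c2)).

Lemma box_gen (Q : nat -> nat -> bool) i j (c1 c2 : int) : Q i j ->
  box_sum Q (fun a : int * int => mcount i (a.1 - c1) * mcount j (a.2 - c2)).
Proof. by move=> Qij; apply: nnsum_gen; exists i, j, c1, c2. Qed.

Lemma box_sum_sub (Q Q' : nat -> nat -> bool) f :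
  (forall i j, Q i j -> Q' i j) -> box_sum Q f -> box_sum Q' f.
Proof.
move=> QQ; apply: nnsum_sub => _ [i [j [c1 [c2 [/QQ Qij ->]]]]].
by exists i, j, c1, c2.
Qed.

Lemma box_sum_laurent Q f : box_sum Q f -> laurent_series f.
Proof.
elim=> [|_ g [i [j [c1 [c2 [_ ->]]]]] _ [[b1 b2] gb]]; first by exists (0, 0).
exists (Num.min c1 b1, Num.min c2 b2) => -[a1 a2] /= ab.
rewrite gb ?addr0 /=; last by lia.
have [a1c|ca1] := ltP a1 c1; first by rewrite mcount_neg ?mul0r //; lia.
by rewrite [X in _ * X]mcount_neg ?mulr0 //; lia.
Qed.

Lemma box_sum_prod l h l' h' f g : ray_sum l h f -> ray_sum l' h' g ->
  box_sum (fun i j => (l <= i <= h)%N && (l' <= j <= h')%N) (fun a : int * int => f a.1 * g a.2).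
Proof.
move=> rf rg; apply: (@nnsum_map _ _ _ _ (fun f (a : int * int) => f a.1 * g a.2) _ _ _ _ rf).
- by apply/funext => a; rewrite mul0r.
- by move=> f1 f2; apply/funext => a; rewrite mulrDl.
move=> _ [i [c [lih ->]]].
apply: (@nnsum_map _ _ _ _ (fun g (a : int * int) => mcount i (a.1 - c) * g a.2) _ _ _ _ rg).
- by apply/funext => a; rewrite mulr0.
- by move=> f1 f2; apply/funext => a; rewrite mulrDr.
by move=> _ [j [d [ljh ->]]]; apply: box_gen; rewrite lih.
Qed.

(** * Removing the zero-dimensional summands *)

Definition box_le (m mt i j : nat) : bool := (i <= m)%N && (j <= mt)%N.
Definition box_pos (m mt i j : nat) : bool := box_le m mt i j && (0 < i + j)%N.

Lemma box_sum_swap Q f :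
  box_sum Q f -> box_sum (fun i j => Q j i) (fun a : int * int => f (a.2, a.1)).
Proof.
apply: (@nnsum_map _ _ _ _ (fun f (a : int * int) => f (a.2, a.1))) => //.
move=> _ [i [j [c1 [c2 [Qij ->]]]]]; apply: nnsum_gen.
exists j, i, c2, c1; split=> //; apply/funext => a; exact: mulrC.
Qed.

(** Beyond the finitely many columns [c1] carrying terms with [i = 0], every row
    is a sum of rays; in particular it is nondecreasing there. *)
Lemma box_sum_right_rows (Q : nat -> nat -> bool) m H :
    (forall i j, Q i j -> (i <= m)%N) -> box_sum Q H ->
  exists (A : int) (phi : int -> int -> int),
    (forall b, ray_sum 1 m (phi b)) /\
    (forall a b : int, A <= a -> H (a, b) = phi b a).
Proof.
move=> Qm; elim=> [|_ g [i [j [c1 [c2 [Qij ->]]]]] _ [A [phi [rphi Hphi]]]].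
  by exists 0, (fun _ _ => 0); split=> // b; apply: nnsum0.
case: i Qij => [|i] Qij.
  exists (Num.max A (c1 + 1)), phi; split=> // a b aA.
  by rewrite mcount0 /= (_ : (a - c1 == 0) = false) ?mul0r ?add0r ?Hphi //; lia.
exists A, (fun b a => mcount j (b - c2) * mcount i.+1 (a - c1) + phi b a).
split=> [b|a b aA /=]; last by rewrite Hphi // mulrC.
have im : (1 <= i.+1 <= m)%N by apply: Qm Qij.
exact: nnsumD (nnsumZ (mcount_ge0 j (b - c2)) (ray_gen c1 im)) (rphi b).
Qed.

(** Far out to the right the terms with [i = 0] have disappeared, and truncating
    the others keeps their pole in the first direction. *)
Lemma box_sum_corner m mt H : box_sum (box_le m mt) H ->
  exists A0 : int, forall A B : int, A0 <= A ->
    box_sum (box_pos m mt)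
      (fun a : int * int => (A <= a.1)%R%:Z * (B <= a.2)%R%:Z * H a).
Proof.
elim=> [|_ g [i [j [c1 [c2 [/andP[im jmt] ->]]]]] _ [A0 IH]].
  exists 0 => A B _.
  by rewrite (_ : (fun a => _) = fun=> 0); [exact: nnsum0|apply/funext => a; rewrite mulr0].
exists (Num.max A0 (c1 + 1)) => A B; rewrite ge_max => /andP[A0A c1A].
pose F (a : int) : int := (A <= a)%R%:Z * mcount i (a - c1).
pose G (b : int) : int := (B <= b)%R%:Z * mcount j (b - c2).
rewrite (_ : (fun a => _) = fun a : int * int => F a.1 * G a.2 +
   (A <= a.1)%R%:Z * (B <= a.2)%R%:Z * g a); last first.
  by apply/funext => a; rewrite /F /G mulrDr; congr (_ + _); rewrite mulrACA.
apply: nnsumD; last exact: IH.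
case: i im @F => [|i] im F.
  rewrite (_ : (fun a => _) = fun=> 0); first exact: nnsum0.
  apply/funext => a; rewrite /F mcount0; case: leP => Aa; last by rewrite !mul0r.
  by rewrite (_ : (a.1 - c1 == 0) = false) ?mulr0 ?mul0r //; lia.
apply: (@box_sum_sub (fun k l => (1 <= k <= m)%N && (0 <= l <= mt)%N)).
  by rewrite /box_pos /box_le => k l; lia.
by apply: box_sum_prod; apply: ray_sum_trunc => //; apply: ray_gen.
Qed.

(** The plane is cut at a column [A] and a row [B] beyond which [H] is monotone
    in the respective direction.  Below [B], the part of [H] seen by rows is [H1]
    left of [A] and all of [H] right of it; left of [A], the part seen by
    columns is [H - H1] below [B] and all of [H] above it.  Rows and columns are
    monotone by the choice of [H1], so both consist of rays, and what remains is
    the corner. *)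
Lemma staircase_box_pos m mt H :
    laurent_series H -> box_sum (box_le m mt) H ->
    (forall U, declining U ->
       \sum_(a <- meet_seq U) H a <= \sum_(a <- U) H a) ->
  box_sum (box_pos m mt) H.
Proof.
move=> [[a0 b0] H0] bH dH.
have [H1 [H1b H1S H2S]] := staircase_potential dH.
have {}H0 (x y : int) : (x < a0) || (y < b0) -> H (x, y) = 0.
  by move=> xy; apply: H0 => /=; lia.
have H10 (x y : int) : (x < a0) || (y < b0) -> H1 (x, y) = 0.
  by move=> /H0 xy; have := H1b (x, y); rewrite xy; lia.
have [A1 [phi [rphi Hphi]]] := box_sum_right_rows (fun i j => @proj1 _ _ \o andP) bH.
have [B1 [psi [rpsi Hpsi]]] := box_sum_right_rows
  (fun j i => @proj2 _ _ \o andP) (box_sum_swap bH).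
have [A2 corner] := box_sum_corner bH.
pose A := Num.max a0 (Num.max A1 A2); pose B := Num.max b0 B1.
pose f (y x : int) : int := if A <= x then H (x, y) else H1 (x, y).
pose g (x y : int) : int := if B <= y then H (x, y) else H (x, y) - H1 (x, y).
have rf y : ray_sum 1 m (f y).
  apply: (@ray_sum_monotone m (f y) (phi y) A a0) => // x.
  - by move=> Ax; rewrite /f Ax Hphi //; lia.
  - by move=> xa; rewrite /f H0 ?H10 ?if_same ?xa.
  move=> xA; rewrite /f [A <= x]leNgt xA /=; case: ifP => [Ax|_]; last exact: H1S.
  by apply: le_trans (H1S _ _) _; have /andP[] := H1b (x + 1, y).
have rg x : ray_sum 1 mt (g x).
  apply: (@ray_sum_monotone mt (g x) (psi x) B b0) => // y.
  - by move=> By; rewrite /g By -Hpsi //; lia.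
  - by move=> yb; rewrite /g H0 ?H10 ?subrr ?if_same // yb orbT.
  move=> yB; rewrite /g [B <= y]leNgt yB /=; case: ifP => [By|_]; last exact: H2S.
  by apply: le_trans (H2S _ _) _; have /andP[h _] := H1b (x, y + 1); rewrite gerBl.
pose xs : seq int := [seq a0 + k%:Z | k <- iota 0 `|(A - a0)%R|%N].
pose ys : seq int := [seq b0 + k%:Z | k <- iota 0 `|(B - b0)%R|%N].
have mem_xs x : (x \in xs) = (a0 <= x < A).
  apply/mapP/idP => [[k]|xA]; first by rewrite mem_iota => ? ->; lia.
  by exists `|(x - a0)%R|%N; rewrite ?mem_iota; lia.
have mem_ys y : (y \in ys) = (b0 <= y < B).
  apply/mapP/idP => [[k]|yB]; first by rewrite mem_iota => ? ->; lia.
  by exists `|(y - b0)%R|%N; rewrite ?mem_iota; lia.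
have xs_uniq : uniq xs by rewrite map_inj_uniq ?iota_uniq // => x y /=; lia.
have ys_uniq : uniq ys by rewrite map_inj_uniq ?iota_uniq // => x y /=; lia.
have delta (s : seq int) (F : int -> int) z : uniq s ->
    \sum_(t <- s) F t * mcount 0 (z - t) = if z \in s then F z else 0.
  move=> us; case: ifP => zs.
    rewrite (bigD1_seq z) //= subrr mulr1 big1 ?addr0 // => t tz.
    by rewrite mcount0 (_ : (z - t == 0) = false) ?mulr0 //; lia.
  rewrite big1_seq // => t /andP[_ ts]; rewrite mcount0.
  rewrite (_ : (z - t == 0) = false) ?mulr0 //; apply/negbTE; apply: contraFN zs.
  by rewrite subr_eq0 => /eqP ->.
rewrite (_ : H = fun a : int * int =>
    (\sum_(y <- ys) f y a.1 * mcount 0 (a.2 - y) +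
     \sum_(x <- xs) mcount 0 (a.1 - x) * g x a.2) +
    (A <= a.1)%R%:Z * (B <= a.2)%R%:Z * H a).
  apply: nnsumD; last by apply: corner; rewrite !le_max lexx !orbT.
  apply: nnsumD; apply: nnsum_sum => t.
    apply: box_sum_sub (box_sum_prod (rf t) (ray_gen t (isT : 0 <= 0 <= 0)%N)).
    by rewrite /box_pos /box_le => i j; lia.
  apply: box_sum_sub (box_sum_prod (ray_gen t (isT : 0 <= 0 <= 0)%N) (rg t)).
  by rewrite /box_pos /box_le => i j; lia.
apply/funext => -[x y] /=; under [X in _ = _ + X + _]eq_bigr do rewrite mulrC.
rewrite (delta ys (fun t => f t x)) // (delta xs (fun t => g t y)) //.
rewrite mem_xs mem_ys /f /g.
have [xa|ax] := ltP x a0; first by rewrite H0 ?xa // H10 ?xa // !if_same mulr0.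
have [yb|by_] := ltP y b0.
  by rewrite H0 ?yb ?orbT // H10 ?yb ?orbT // subrr !if_same mulr0.
by case: (leP A x) => Ax; case: (leP B y) => By /=;
  rewrite ?mulr0 ?mul0r ?mulr1 ?mul1r ?addr0 ?add0r //; lra.
Qed.

(** * Convolution and division of Laurent series *)

Lemma laurent_shift F (e : int * int) :
  laurent_series F -> laurent_series (fun a => F (a - e)).
Proof.
move=> [b Fb]; exists (b + e) => a ab; apply: Fb.
by apply: contra ab => /andP[] /=; lia.
Qed.

Lemma laurentD F G :
  laurent_series F -> laurent_series G -> laurent_series (fun a => F a + G a).
Proof.
move=> [b Fb] [c Gc]; exists (Num.min b.1 c.1, Num.min b.2 c.2) => a /= ab.
by rewrite Fb ?Gc ?addr0 //; lia.
Qed.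

Lemma laurentN F : laurent_series F -> laurent_series (fun a => - F a).
Proof. by move=> [b Fb]; exists b => a /Fb ->; rewrite oppr0. Qed.

Lemma laurent_sum (I : Type) (s : seq I) (F : I -> int * int -> int) :
  (forall i, laurent_series (F i)) -> laurent_series (fun a => \sum_(i <- s) F i a).
Proof.
move=> LF; elim: s => [|i s IH].
  by exists 0 => a _; rewrite big_nil.
have [b Fb] := laurentD (LF i) IH.
by exists b => a /Fb; rewrite big_cons.
Qed.

Lemma series_mulC F G : series_mul F G = series_mul G F.
Proof.
apply/funext => a; have bij : bijective (fun b : int * int => a - b).
  by exists (fun b => a - b) => b; rewrite subKr.
rewrite /series_mul (reindex_fsbigT (fun b : int * int => a - b) _ bij).
by apply: eq_fsbigr => b _; rewrite mulrC subKr.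
Qed.

Lemma series_mul_shiftr F G e a :
  series_mul F (fun x => G (x - e)) a = series_mul F G (a - e).
Proof. by apply: eq_fsbigr => b _; rewrite addrAC. Qed.

Lemma laurent_mul F G :
  laurent_series F -> laurent_series G -> laurent_series (series_mul F G).
Proof.
move=> [b Fb] [c Gc]; exists (b + c) => a /= ab; apply: fsbig1 => x _.
have [bx|/Fb ->] := boolP ((b.1 <= x.1) && (b.2 <= x.2)); last by rewrite mul0r.
by rewrite Gc ?mulr0 //=; move: ab bx; case: x => x y /=; lia.
Qed.

Lemma series_mul_ge0 F G :
  series_ge0 F -> series_ge0 G -> series_ge0 (series_mul F G).
Proof. by move=> F0 G0 a; apply: fsumr_ge0 => b _; apply: mulr_ge0. Qed.

Lemma int_box (b c : int * int) : exists r : seq (int * int), uniq r /\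
  forall x, (b.1 <= x.1 <= c.1) && (b.2 <= x.2 <= c.2) -> x \in r.
Proof.
exists [seq (b.1 + i%:Z, b.2 + j%:Z) | i <- iota 0 (`|(c.1 - b.1)%R| + 1)%N,
                                  j <- iota 0 (`|(c.2 - b.2)%R| + 1)%N].
split=> [|[x1 x2] /= xbc].
  by apply: allpairs_uniq; rewrite ?iota_uniq // => -[i j] [k l] _ _ [] /= e1 e2; congr pair; lia.
have -> : (x1, x2) = (b.1 + `|(x1 - b.1)%R|%N%:Z, b.2 + `|(x2 - b.2)%R|%N%:Z).
  by congr pair; lia.
by apply: allpairs_f; rewrite mem_iota; lia.
Qed.

Lemma series_mul_finite F G a (r : seq (int * int)) : uniq r ->
    (forall b, b \notin r -> F b * G (a - b) = 0) ->
  series_mul F G a = \sum_(b <- r) F b * G (a - b).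
Proof.
move=> ur Fr; rewrite /series_mul (fsbigE r) // => [|b _]; last exact: Fr.
by apply: eq_bigl => b; rewrite in_setT.
Qed.

Lemma series_mulDr F G1 G2 a :
    laurent_series F -> laurent_series G1 -> laurent_series G2 ->
  series_mul F (fun x => G1 x + G2 x) a = series_mul F G1 a + series_mul F G2 a.
Proof.
move=> [b Fb] [c1 Gc1] [c2 Gc2].
have [r [ur rP]] := int_box b (a - (Num.min c1.1 c2.1, Num.min c1.2 c2.2)).
have out (x : int * int) : x \notin r -> F x = 0 \/ G1 (a - x) = 0 /\ G2 (a - x) = 0.
  move=> xr; have [bx|] := boolP ((b.1 <= x.1) && (b.2 <= x.2)); last by left; apply: Fb.
  right; split; [apply: Gc1 | apply: Gc2]; apply: contra xr => /andP[] /= h1 h2.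
    by apply: rP => /=; lia.
  by apply: rP => /=; lia.
rewrite !(series_mul_finite (r := r)) -?big_split //=; last 3 first.
- by move=> x /out[->|[_ ->]]; rewrite ?mul0r ?mulr0.
- by move=> x /out[->|[-> _]]; rewrite ?mul0r ?mulr0.
- by move=> x /out[->|[-> ->]]; rewrite ?addr0 ?mul0r ?mulr0.
by apply: eq_bigr => x _; rewrite mulrDr.
Qed.

Lemma series_mulNr F G a :
  series_mul F (fun x => - G x) a = - series_mul F G a.
Proof.
rewrite -mulN1r /series_mul mulr_fsumr; apply: eq_fsbigr => b _.
by rewrite mulrN mulN1r.
Qed.

Lemma series_mulBr F G1 G2 a :
    laurent_series F -> laurent_series G1 -> laurent_series G2 ->
  series_mul F (fun x => G1 x - G2 x) a = series_mul F G1 a - series_mul F G2 a.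
Proof.
move=> lF lG1 lG2; rewrite series_mulDr ?series_mulNr //; exact: laurentN.
Qed.

Lemma series_mul_sumr (I : Type) (s : seq I) F (G : I -> int * int -> int) a :
    laurent_series F -> (forall i, laurent_series (G i)) ->
  series_mul F (fun x => \sum_(i <- s) G i x) a = \sum_(i <- s) series_mul F (G i) a.
Proof.
move=> lF lG; elim: s => [|i s IH].
  rewrite big_nil; apply: fsbig1 => b _; by rewrite big_nil mulr0.
rewrite big_cons -IH -series_mulDr //; last exact: laurent_sum.
by congr (series_mul F _ a); apply/funext => x; rewrite big_cons.
Qed.

(** Multiplication by [1 - t^e]. *)
Definition diff (e : int * int) (F : int * int -> int) : int * int -> int :=
  fun a => F a - F (a - e).

Lemma laurent_diff e F : laurent_series F -> laurent_series (diff e F).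
Proof. by move=> lF; apply/laurentD/laurentN/laurent_shift. Qed.

Lemma diffC e e' F : diff e (diff e' F) = diff e' (diff e F).
Proof. by apply/funext => a; rewrite /diff [a - e - e']addrAC; ring. Qed.

Lemma diff_shift e F (g : int * int) :
  diff e (fun x => F (x - g)) = fun x => diff e F (x - g).
Proof. by apply/funext => x; rewrite /diff addrAC. Qed.

Lemma diff_mulr e F G : laurent_series F -> laurent_series G ->
  diff e (series_mul F G) = series_mul F (diff e G).
Proof.
move=> lF lG; apply/funext => a; rewrite /diff series_mulBr ?series_mul_shiftr //.
exact: laurent_shift.
Qed.

Lemma diff_mull e F G : laurent_series F -> laurent_series G ->
  diff e (series_mul F G) = series_mul (diff e F) G.
Proof. by move=> lF lG; rewrite series_mulC diff_mulr // series_mulC. Qed.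

Definition quadrant (g a : int * int) : int := ((g.1 <= a.1) && (g.2 <= a.2))%:Z.

Lemma laurent_quadrant g : laurent_series (quadrant g).
Proof. by exists g => a /negbTE ga; rewrite /quadrant ga. Qed.

Lemma diff_quadrant a :
  diff (1, 0) (diff (0, 1) (quadrant 0)) a = (a == 0)%:Z.
Proof.
case: a => x y; rewrite /diff /quadrant /= !subr0.
rewrite (_ : ((x, y) == 0) = (x == 0) && (y == 0)) //.
do 2![case: (ltrgt0P x) => ?]; do 2![case: (ltrgt0P y) => ?]; lia.
Qed.

Lemma series_mul1 F : series_mul F (fun a => (a == 0)%:Z) = F.
Proof.
apply/funext => a; rewrite (series_mul_finite (r := [:: a])) //.
  by rewrite big_seq1 subrr eqxx mulr1.
by move=> b; rewrite inE eq_sym -subr_eq0 => /negbTE ->; rewrite mulr0.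
Qed.

(** The series of the quadrant is inverse to [(1 - t1)(1 - t2)]. *)
Lemma series_div_quadrant F : laurent_series F ->
  series_div F (quadrant 0) = diff (1, 0) (diff (0, 1) F).
Proof.
move=> lF; have lQ := laurent_quadrant 0.
(* gives existence and, once the differences are moved across the product,
   uniqueness *)
have key G : laurent_series G -> series_mul (diff (1, 0) (diff (0, 1) G)) (quadrant 0) = G.
  move=> lG; rewrite -!diff_mull ?diff_mulr //; try exact: laurent_diff.
  rewrite (_ : diff _ _ = fun a => (a == 0)%:Z) ?series_mul1 //.
  by apply/funext => a; rewrite diff_quadrant.
apply: xget_unique => [|G [lG GF]].
  by split; [do 2!apply: laurent_diff | apply: key].
rewrite -GF -[LHS]key // -!diff_mull //; exact: laurent_diff.
Qed.

Lemma series_mul_quadrant F g a : laurent_series F ->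
  diff (1, 0) (diff (0, 1) (series_mul F (quadrant g))) a = F (a - g).
Proof.
move=> lF; rewrite (_ : series_mul F (quadrant g) =
    fun x => series_mul F (quadrant 0) (x - g)); last first.
  apply/funext => x; rewrite -series_mul_shiftr; congr (series_mul F _ x).
  by apply/funext => y; rewrite /quadrant /= !subr_ge0.
have lQ := laurent_quadrant 0.
have -> : diff (1, 0) (diff (0, 1) (fun x => series_mul F (quadrant 0) (x - g))) a =
  diff (1, 0) (diff (0, 1) (series_mul F (quadrant 0))) (a - g).
  by rewrite !diff_shift.
rewrite !diff_mulr //; last exact: laurent_diff.
rewrite (_ : diff _ _ = fun a => (a == 0)%:Z) ?series_mul1 //.
by apply/funext => x; rewrite diff_quadrant.
Qed.

Lemma diff_ge0 (F : int * int -> int) (e : int * int) :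
  (forall a, F a <= F (a + e)) -> series_ge0 (diff e F).
Proof. by move=> FS a; rewrite /diff subr_ge0 -{2}(subrK e a). Qed.

(** The two differences can be distributed over the factors of a product, so
    each summand of [H] receives the difference in the direction in which it
    grows and [N] receives the other one. *)
Lemma series_ge0_split H H1 N :
    laurent_series H -> laurent_series N -> (forall a, 0 <= H1 a <= H a) ->
    (forall a, H1 a <= H1 (a + (1, 0))) ->
    (forall a, H a - H1 a <= H (a + (0, 1)) - H1 (a + (0, 1))) ->
    (forall a, N a <= N (a + (1, 0))) -> (forall a, N a <= N (a + (0, 1))) ->
  series_ge0 (series_div (series_mul H N) (quadrant 0)).
Proof.
move=> lH lN H1b H1S H2S N1S N2S; pose H2 a := H a - H1 a.
have lH1 : laurent_series H1.
  case: lH => b Hb; exists b => a /Hb Ha.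
  by apply/eqP; rewrite eq_le -{1}Ha andbC.
have lH2 : laurent_series H2 by apply/laurentD/laurentN.
have -> : series_mul H N = fun a => series_mul H1 N a + series_mul H2 N a.
  apply/funext => a; rewrite ![series_mul _ N]series_mulC -series_mulDr //.
  by congr (series_mul N _ a); apply/funext => x; rewrite /H2 addrC subrK.
rewrite series_div_quadrant; last first.
  by apply: laurentD; apply: laurent_mul.
have diffD F G : diff (1, 0) (diff (0, 1) (fun a => F a + G a)) =
    fun a => diff (1, 0) (diff (0, 1) F) a + diff (1, 0) (diff (0, 1) G) a.
  by apply/funext => a; rewrite /diff; ring.
have e1 : diff (1, 0) (diff (0, 1) (series_mul H1 N)) =
    series_mul (diff (1, 0) H1) (diff (0, 1) N).
  by rewrite diff_mulr // -diff_mull //; apply: laurent_diff.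
have e2 : diff (1, 0) (diff (0, 1) (series_mul H2 N)) =
    series_mul (diff (0, 1) H2) (diff (1, 0) N).
  by rewrite diffC diff_mulr // -diff_mull //; apply: laurent_diff.
rewrite diffD e1 e2 => a; apply: addr_ge0; apply: series_mul_ge0; exact: diff_ge0.
Qed.

(** * Linear algebra over the constants *)

Section LinearSpan.
Variables (K : fieldType) (V : lmodType K).
Implicit Types (s t : seq V) (x y z : V).

(** Spans and freeness are defined by recursion on the list, so that one vector
    is compared with the later ones only; [lspanP] and [lfreeP] give the usual
    descriptions by coefficients. *)
Fixpoint lspan s : set V :=
  if s is x :: s' then [set y | exists c z, lspan s' z /\ y = c *: x + z]
  else [set 0].

Fixpoint lfree s : Prop := if s is x :: s' then ~ lspan s' x /\ lfree s' else True.

Definition subspace (A : set V) : Prop :=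
  A 0 /\ forall c x y, A x -> A y -> A (c *: x + y).

Lemma lspan_subspace s : subspace (lspan s).
Proof.
elim: s => [|x s [IH0 IH]]; first by split=> // c x y -> ->; rewrite scaler0 addr0.
split; first by exists 0, 0; rewrite scale0r addr0.
move=> c _ _ [a [y [sy ->]]] [b [z [sz ->]]].
exists (c * a + b), (c *: y + z); split; first exact: IH.
by rewrite scalerDr scalerA scalerDl addrACA.
Qed.

Lemma lspan_cons s x : lspan s `<=` lspan (x :: s).
Proof. by move=> y sy; exists 0, y; rewrite scale0r add0r. Qed.

Lemma lspan_head s x : lspan (x :: s) x.
Proof.
by exists 1, 0; split; [exact: (lspan_subspace s).1|rewrite scale1r addr0].
Qed.

Lemma lspan_mem s x : x \in s -> lspan s x.
Proof.
elim: s => // y s IH; rewrite inE => /orP[/eqP ->|/IH]; first exact: lspan_head.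
exact: lspan_cons.
Qed.

Lemma subspaceD A x y : subspace A -> A x -> A y -> A (x + y).
Proof. by case=> _ h Ax Ay; rewrite -[x]scale1r; apply: h. Qed.

Lemma subspaceZ A c x : subspace A -> A x -> A (c *: x).
Proof. by case=> A0 h Ax; rewrite -[_ *: _]addr0; apply: h. Qed.

Lemma subspaceB A x y : subspace A -> A x -> A y -> A (x - y).
Proof. by move=> sA Ax Ay; apply: subspaceD => //; rewrite -scaleN1r; apply: subspaceZ. Qed.

Lemma subspace_sum A (I : Type) (r : seq I) (P : pred I) (F : I -> V) :
  subspace A -> (forall i, P i -> A (F i)) -> A (\sum_(i <- r | P i) F i).
Proof.
move=> sA AF; elim/big_ind: _ => //; first by case: sA.
by move=> x y; apply: subspaceD.
Qed.

Lemma subspaceI A B : subspace A -> subspace B -> subspace (A `&` B).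
Proof. by move=> [A0 AD] [B0 BD]; split=> // c x y [? ?] [? ?]; split; auto. Qed.

Lemma lspan_min A s : subspace A -> (forall x, x \in s -> A x) -> lspan s `<=` A.
Proof.
move=> sA; elim: s => [|x s IH] sub y; first by move=> ->; case: sA.
case=> c [z [sz ->]]; apply: sA.2; first by apply: sub; rewrite mem_head.
by apply: IH sz => w ws; apply: sub; rewrite inE ws orbT.
Qed.

Lemma lspan_cat s t y :
  lspan (s ++ t) y <-> exists u v, [/\ lspan s u, lspan t v & y = u + v].
Proof.
elim: s y => [|x s IH] y /=.
  split=> [ty|[u [v [-> tv ->]]]]; last by rewrite add0r.
  by exists 0, y; rewrite add0r.
split=> [[c [z [/IH[u [v [su tv ->]]] ->]]]|[_ [v [[c [u [su ->]]] tv ->]]]].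
  by exists (c *: x + u), v; split=> //; [exists c, u|rewrite addrA].
by exists c, (u + v); split; [apply/IH; exists u, v|rewrite addrA].
Qed.

Definition lcomb s (c : 'I_(size s) -> K) : V := \sum_(i < size s) c i *: s`_i.

Lemma lspanP s y : lspan s y <-> exists c : 'I_(size s) -> K, y = lcomb c.
Proof.
split.
  elim: s y => [|x s IH] y; first by move=> ->; exists (fun=> 0); rewrite /lcomb big_ord0.
  case=> c [z [/IH[d ->] ->]].
  exists (fun i => oapp d c (unlift ord0 i)); rewrite /lcomb big_ord_recl unlift_none /=.
  by congr (_ + _); apply: eq_bigr => i _; rewrite liftK.
case=> c ->; apply: subspace_sum => [|i _]; first exact: lspan_subspace.
by apply: subspaceZ; [exact: lspan_subspace | apply/lspan_mem/mem_nth].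
Qed.

Lemma lfreeP s :
  lfree s <-> forall c : 'I_(size s) -> K, lcomb c = 0 -> forall i, c i = 0.
Proof.
elim: s => [|x s IH]; first by split=> // _ c _ [].
split=> [[xs fs] c|fs].
  rewrite /lcomb big_ord_recl /= => c0.
  have sc : lspan s (\sum_(i < size s) c (lift ord0 i) *: s`_i).
    by apply/lspanP; exists (fun i => c (lift ord0 i)).
  have c00 : c ord0 = 0.
    apply: contra_notP xs => /eqP cn0.
    have -> : x = - (c ord0)^-1 *: \sum_(i < size s) c (lift ord0 i) *: s`_i.
      move/eqP: c0; rewrite addrC addr_eq0 => /eqP ->.
      by rewrite scaleNr scalerN opprK scalerA mulVf // scale1r.
    exact: subspaceZ (lspan_subspace s) sc.
  move: c0; rewrite c00 scale0r add0r => c0.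
  move=> i; case: (unliftP ord0 i) => [j ->|-> //].
  by have /IH/(_ (fun i => c (lift ord0 i)) c0) := fs; apply.
split.
  move=> /lspanP[d xd].
  pose c (i : 'I_(size (x :: s))) := oapp d (-1) (unlift ord0 i).
  have : lcomb c = 0.
    rewrite /lcomb big_ord_recl /c unlift_none /= scaleN1r [X in - X]xd /lcomb.
    by rewrite addrC; apply/eqP; rewrite subr_eq0; apply/eqP/eq_bigr => i _; rewrite liftK.
  move=> /fs/(_ ord0)/eqP; rewrite /c unlift_none /= oppr_eq0 oner_eq0 //.
apply/IH => d d0 i.
pose c (i : 'I_(size (x :: s))) := oapp d 0 (unlift ord0 i).
have : lcomb c = 0.
  rewrite /lcomb big_ord_recl /c unlift_none /= scale0r add0r -[RHS]d0.
  by apply: eq_bigr => j _; rewrite liftK.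
by move=> /fs/(_ (lift ord0 i)); rewrite /c liftK.
Qed.

(** The matrix of coefficients of [s] over [t] would otherwise have a nonzero
    row kernel, that is a nontrivial linear relation on [s]. *)
Lemma lfree_size_le s t : lfree s -> (forall x, x \in s -> lspan t x) ->
  (size s <= size t)%N.
Proof.
move=> /lfreeP fs st; rewrite leqNgt; apply/negP => lt.
have /choice[c cE] (i : 'I_(size s)) : exists c : 'I_(size t) -> K, s`_i = lcomb c.
  by apply/lspanP/st/mem_nth.
pose A : 'M[K]_(size s, size t) := \matrix_(i, j) c i j.
have : kermx A != 0.
  by rewrite kermx_eq0 /row_free neq_ltn (leq_ltn_trans (rank_leq_col A) lt).
case/rowV0Pn => v /sub_kermxP vA vn0.
case/eqP: vn0; apply/rowP => i; rewrite mxE.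
apply: (fs (fun i => v 0 i)).
rewrite /lcomb (eq_bigr (fun i => \sum_(j < size t) (v 0 i * c i j) *: t`_j)).
  rewrite exchange_big big1 // => j _ /=; rewrite -scaler_suml.
  have /matrixP/(_ 0 j) := vA; rewrite !mxE => vA0.
  rewrite (_ : \sum_i _ = 0) ?scale0r // -[RHS]vA0.
  by apply: eq_bigr => k _; rewrite mxE.
by move=> k _; rewrite cE scaler_sumr; apply: eq_bigr => j _; rewrite scalerA.
Qed.

Lemma lbasis_size s t : lfree s -> lfree t -> lspan s = lspan t -> size s = size t.
Proof.
move=> fs ft st; apply/anti_leq; rewrite !lfree_size_le // => x xs.
  by rewrite st; apply: lspan_mem.
by rewrite -st; apply: lspan_mem.
Qed.

(** A free family of maximal size inside [A] spans [A]; the bound [n] makes the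
    extension process stop. *)
Lemma lfree_extend (A : set V) (n : nat) s : subspace A -> lfree s ->
    (forall x, x \in s -> A x) ->
    (forall t, lfree t -> (forall x, x \in t -> A x) -> (size t <= n)%N) ->
  exists t, lfree (t ++ s) /\ lspan (t ++ s) = A.
Proof.
move=> sA fs As bound.
have [k] := ubnP (n - size s); elim: k s fs As => // k IH s fs As kn.
have [[x [Ax xs]]|noext] := pselect (exists x, A x /\ ~ lspan s x).
  have fxs : lfree (x :: s) by [].
  have Axs y : y \in x :: s -> A y by rewrite inE => /orP[/eqP -> //|/As].
  have [|t] := IH _ fxs Axs; first by have := bound _ fxs Axs; move: kn => /=; lia.
  by rewrite -cat_rcons => h; exists (rcons t x).
exists [::]; split=> //; apply/seteqP; split; first exact: lspan_min.
by move=> x Ax; apply: contrapT => xs; apply: noext; exists x.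
Qed.

Lemma subspace_basis (A : set V) s : subspace A -> A `<=` lspan s ->
  exists t, lfree t /\ lspan t = A.
Proof.
move=> sA As; have [t] := @lfree_extend A (size s) [::] sA I (fun x => ltac:(by []))
  (fun t ft At => lfree_size_le ft (fun x xt => As _ (At x xt))).
by rewrite cats0; exists t.
Qed.

(** Keeping a vector only if it is not a combination of the later ones leaves a
    basis of the span. *)
Fixpoint sieve s : seq V :=
  if s is x :: s' then
    if `[< lspan s' x >] then sieve s' else x :: sieve s'
  else [::].

Lemma sieve_basis s : lfree (sieve s) /\ lspan (sieve s) = lspan s.
Proof.
elim: s => [//|x s [fs ss]] /=; case: asboolP => xs.
  split=> //; rewrite ss; apply/seteqP; split; first exact: lspan_cons.
  move=> _ [c [z [sz ->]]]; exact: (lspan_subspace s).2.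
by split=> /=; rewrite ss.
Qed.

End LinearSpan.

Section RestrictScalars.
Variables (K : fieldType) (n : nat) (M : lmodType {mpoly K[n]}).

(** The module [M] seen as a [K]-vector space through the constant polynomials. *)
Definition resK : Type := M.
HB.instance Definition _ := GRing.Zmodule.on resK.

Fact resK_scaleA (c d : K) (x : resK) :
  c%:MP *: (d%:MP *: (x : M)) = (c * d)%:MP *: (x : M).
Proof. by rewrite scalerA -mpolyCM. Qed.
Fact resK_scale1 (x : resK) : (1 : K)%:MP *: (x : M) = x.
Proof. by rewrite mpolyC1 scale1r. Qed.
Fact resK_scaleDr (c : K) : {morph (fun x : resK => c%:MP *: (x : M) : resK) : x y / x + y}.
Proof. by move=> x y; rewrite scalerDr. Qed.
Fact resK_scaleDl (x : resK) :
  {morph (fun c : K => c%:MP *: (x : M) : resK) : c d / c + d}.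
Proof. by move=> c d; rewrite mpolyCD scalerDl. Qed.

HB.instance Definition _ := GRing.Zmodule_isLmodule.Build K resK
  resK_scaleA resK_scale1 resK_scaleDr resK_scaleDl.

Lemma resKE (c : K) (x : M) : (c *: (x : resK) : resK) = c%:MP *: x.
Proof. by []. Qed.

End RestrictScalars.

Section Kdim.
Variables (K : fieldType) (m mt : nat) (M : lmodType {mpoly K[m + mt]}).
Local Notation V := (resK M).
Implicit Types (A B : set V) (s t : seq V).

Lemma is_Kbasis_list A (d : nat) (b : 'I_d -> M) : is_Kbasis (A : set M) b ->
  exists s, [/\ lfree s, lspan s = A & size s = d].
Proof.
case=> AE bfree; exists [seq (b i : V) | i <- enum 'I_d].
have sz : size [seq (b i : V) | i <- enum 'I_d] = d by rewrite size_map size_enum_ord.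
have nthE (i : 'I_d) : [seq (b j : V) | j <- enum 'I_d]`_i = b i.
  by rewrite (nth_map i) ?size_enum_ord // nth_ord_enum.
split=> //.
  apply/lfreeP => c c0 i.
  have := bfree (fun j => c (cast_ord (esym sz) j)); move=> /(_ _ (cast_ord sz i)).
  rewrite cast_ordK; apply; rewrite -[RHS]c0 /lcomb.
  rewrite (reindex (cast_ord (esym sz))) /=; last first.
    by exists (cast_ord sz) => j _; rewrite ?cast_ordK ?cast_ordKV.
  by apply: eq_bigr => j _; rewrite resKE nthE.
rewrite AE; apply/seteqP; split=> y.
  move/lspanP => [c ->]; exists (fun j => c (cast_ord (esym sz) j)); rewrite /lcomb.
  rewrite (reindex (cast_ord (esym sz))) /=; last first.
    by exists (cast_ord sz) => j _; rewrite ?cast_ordK ?cast_ordKV.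
  by apply: eq_bigr => j _; rewrite resKE nthE.
move=> [c ->]; apply: (@subspace_sum _ V) => [|i _]; first exact: lspan_subspace.
apply: subspaceZ (lspan_subspace _) _; apply: lspan_mem.
by apply/mapP; exists i => //; rewrite mem_enum.
Qed.

Lemma Kbasis_of_list s : lfree s ->
  is_Kbasis (lspan s : set M) (fun i : 'I_(size s) => s`_i : M).
Proof.
move=> fs; split; last by apply/lfreeP.
by apply/seteqP; split=> y /lspanP.
Qed.

Lemma Kdim_list s A : lfree s -> lspan s = A -> Kdim (A : set M) = size s.
Proof.
move=> fs sA; rewrite /Kdim; apply: xget_unique.
  by exists (fun i : 'I_(size s) => s`_i : M); rewrite -sA; apply: Kbasis_of_list.
by move=> d [b /is_Kbasis_list[t [ft tA <-]]]; apply: lbasis_size; rewrite ?sA ?tA.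
Qed.

Lemma Kdim0 : Kdim ([set 0] : set M) = 0%N.
Proof. exact: (@Kdim_list [::]). Qed.

Definition fin_dim A : Prop := exists s, A `<=` lspan s.

Lemma fin_dim_sub A B : A `<=` B -> fin_dim B -> fin_dim A.
Proof. by move=> AB [s Bs]; exists s => x /AB/Bs. Qed.

Lemma Kdim_basis A : subspace A -> fin_dim A ->
  exists s, [/\ lfree s, lspan s = A & Kdim (A : set M) = size s].
Proof.
move=> sA [r Ar]; have [s [fs ss]] := subspace_basis sA Ar.
by exists s; split=> //; apply: Kdim_list.
Qed.

Lemma Kdim_extend A A' : subspace A -> subspace A' -> fin_dim A -> A' `<=` A ->
  exists s t, [/\ lfree (t ++ s), lspan (t ++ s) = A, lspan s = A',
    Kdim (A' : set M) = size s & Kdim (A : set M) = (size t + size s)%N].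
Proof.
move=> sA sA' fA A'A; have [r Ar] := fA.
have [s [fs ss ds]] := Kdim_basis sA' (fin_dim_sub A'A fA).
have sub x : x \in s -> A x by move=> xs; apply: A'A; rewrite -ss; apply: lspan_mem.
have bnd t : lfree t -> (forall x, x \in t -> A x) -> (size t <= size r)%N.
  by move=> ft tA; apply: lfree_size_le => // x /tA/Ar.
have [t [ft tt]] := lfree_extend sA fs sub bnd.
by exists s, t; split=> //; rewrite -size_cat; apply: Kdim_list.
Qed.

Lemma Kdim_sub A A' : subspace A -> subspace A' -> fin_dim A -> A' `<=` A ->
  (Kdim (A' : set M) <= Kdim (A : set M))%N.
Proof.
by move=> sA sA' fA /(Kdim_extend sA sA' fA)[s [t [_ _ _ -> ->]]]; exact: leq_addl.
Qed.

(** The map sends a basis of a complement of [A'] in [A] to vectors of [B] that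
    are independent modulo [B'].  In other words the map induced from [A / A'] to
    [B / B'] is injective, which compares the dimensions of these quotients
    without forming them. *)
Lemma Kdim_relative A A' B B' (phi : V -> V) :
    subspace A -> subspace A' -> subspace B -> subspace B' ->
    fin_dim A -> fin_dim B -> A' `<=` A -> B' `<=` B ->
    (forall c x y, phi (c *: x + y) = c *: phi x + phi y) ->
    (forall x, A x -> B (phi x)) -> (forall x, A x -> B' (phi x) -> A' x) ->
  (Kdim (A : set M) + Kdim (B' : set M) <= Kdim (B : set M) + Kdim (A' : set M))%N.
Proof.
move=> sA sA' sB sB' fA fB A'A B'B phiL phiAB phiB'.
have [s [t [ft tA ss -> ->]]] := Kdim_extend sA sA' fA A'A.
have [r [fr rB' ->]] := Kdim_basis sB' (fin_dim_sub B'B fB).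
have [q [fq qB ->]] := Kdim_basis sB fB.
have phi0 : phi 0 = 0.
  have := phiL (- 1) 0 0; rewrite scaler0 addr0 => h.
  by rewrite h scaleN1r addNr.
have phiD x y : phi (x + y) = phi x + phi y.
  by rewrite -[x]scale1r phiL !scale1r.
have sphi u y : lspan [seq phi x | x <- u] y -> exists2 x, lspan u x & y = phi x.
  elim: u y => [|x u IH] y /=; first by move=> ->; exists 0.
  move=> [c [z [/IH[w uw ->] ->]]]; exists (c *: x + w); last by rewrite phiL.
  by exists c, w.
have tsub x : lspan t x -> A x.
  by move=> tx; rewrite -tA; apply/lspan_cat; exists x, 0; split=> //;
    [exact: (lspan_subspace s).1|rewrite addr0].
suff free : lfree ([seq phi x | x <- t] ++ r).
  have := lfree_size_le free; rewrite size_cat size_map => /(_ q) h.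
  rewrite addnAC leq_add2r h // => x; rewrite mem_cat => /orP[/mapP[y yt ->]|xr].
    by rewrite qB; apply/phiAB/tsub/lspan_mem.
  by rewrite qB; apply: B'B; rewrite -rB'; apply: lspan_mem.
have tA' x : x \in t -> A x by move=> /lspan_mem/tsub.
elim: t ft tA' {tA tsub} => [//|x t IH] /= [xts fts] tA'; split; last first.
  by apply: IH => // y yt; apply: tA'; rewrite inE yt orbT.
move=> /lspan_cat[_ [w [/sphi[z tz ->] rw xE]]]; apply: xts.
have Ax : A x by apply: tA'; rewrite mem_head.
have Az : A z.
  by apply: (lspan_min sA) tz => y yt; apply: tA'; rewrite inE yt orbT.
apply/lspan_cat; exists z, (x - z); split=> //; last by rewrite addrC subrK.
rewrite ss; apply: phiB'; first exact: subspaceB.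
have -> : phi (x - z) = phi x - phi z by rewrite addrC -scaleN1r phiL scaleN1r addrC.
by rewrite xE addrAC subrr add0r -rB'.
Qed.

End Kdim.

(** * Counting the monomials of an order ideal *)

Fixpoint seq_le (u v : seq nat) : bool :=
  match u, v with
  | k :: u', l :: v' => (k <= l)%N && seq_le u' v'
  | [::], [::] => true
  | _, _ => false
  end.

Definition downset (n : nat) (D : set (seq nat)) : Prop :=
  forall u v, size v = n -> seq_le u v -> D v -> D u.

Lemma seq_le_refl u : seq_le u u.
Proof. by elim: u => //= k u ->; rewrite leqnn. Qed.

Lemma seq_le_size u v : seq_le u v -> size u = size v.
Proof. by elim: u v => [|k u IH] [|l v] //= /andP[_ /IH ->]. Qed.

(** Dickson's lemma in the form of a chain condition.  Cut the order ideals into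
    slices according to the first exponent [j]; the slice [j] of the [k]-th ideal
    decreases in both [k] and [j].  The diagonal slices stabilise by induction,
    which controls all slices with large [j], and the finitely many remaining
    values of [j] are treated one by one. *)
Lemma downset_chain_stable (n : nat) (D : nat -> set (seq nat)) :
    (forall k, downset n (D k)) ->
    (forall k l u, size u = n -> (k <= l)%N -> D l u -> D k u) ->
  exists k0, forall k u, (k0 <= k)%N -> size u = n -> D k0 u -> D k u.
Proof.
elim: n D => [|n IH] D dD D_decr.
  have [allD|] := pselect (forall k, D k [::]).
    by exists 0%N => k u _ /size0nil -> _; apply: allD.
  move=> /existsNP[k0 Dk0]; exists k0 => k u _ /size0nil -> //.
have slice k j : downset n [set u | D k (j :: u)].
  by move=> v w sw vw; apply: dD; rewrite /= ?sw ?leqnn.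
have E_decr k l j i u : size u = n -> (k <= l)%N -> (j <= i)%N ->
    D l (i :: u) -> D k (j :: u).
  move=> su kl ji Dl; apply: (D_decr k l) => //=; first by rewrite su.
  by apply: dD Dl; rewrite /= ?su // ji seq_le_refl.
have [k0 k0P] := IH (fun k => [set u | D k (k :: u)]) (fun k => slice k k)
  (fun k l u su kl => E_decr k l k l u su kl kl).
have rowP j : exists k1, forall k u, (k1 <= k)%N -> size u = n ->
    D k1 (j :: u) -> D k (j :: u).
  apply: (IH (fun k => [set u | D k (j :: u)]) (fun k => slice k j)).
  by move=> k l u su kl; apply: E_decr.
have [k1 k1P] := choice rowP.
pose K := (k0 + \max_(j < k0) k1 j)%N.
exists K => k [|j u] Kk //= [su] DK.
have [jk0|k0j] := ltnP j k0.
  apply: (E_decr k (maxn k K) j j) => //; first by rewrite leq_maxl.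
  have k1K : (k1 j <= K)%N.
    by rewrite /K (leq_trans _ (leq_addl _ _)) // (leq_bigmax (Ordinal jk0)).
  apply: k1P => //; first by rewrite (leq_trans k1K) // leq_maxr.
  by apply: E_decr DK.
apply: (E_decr k (k + j)%N j (k + j)%N) => //; rewrite ?leq_addr ?leq_addl //.
apply: (k0P (k + j)%N) => //=; first by lia.
by apply: E_decr DK => //; rewrite /K leq_addr.
Qed.

Fixpoint wdeg (ws : seq (int * int)) (u : seq nat) : int * int :=
  match ws, u with
  | w :: ws', k :: u' => w *+ k + wdeg ws' u'
  | _, _ => 0
  end.

Definition mbound (a : int * int) : nat := (`|a.1| + `|a.2| + 1)%N.

(** The enumeration is lexicographic, an order compatible with multiplication by
    monomials.  The bound on the first exponent is harmless for the weights
    [(1, 0)] and [(0, 1)], as larger exponents leave a negative degree. *)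
Fixpoint mons (ws : seq (int * int)) (a : int * int) : seq (seq nat) :=
  if ws is w :: ws' then
    [seq k :: u | k <- iota 0 (mbound a), u <- mons ws' (a - w *+ k)]
  else if a == 0 then [:: [::]] else [::].

Definition unit_weight (w : int * int) : bool := (w == (1, 0)) || (w == (0, 1)).

Lemma unit_weightP w : unit_weight w -> w = (1, 0) \/ w = (0, 1).
Proof. by case/orP => /eqP; [left|right]. Qed.

Lemma pair_mulrn (x y : int) k : ((x, y) *+ k : int * int) = (x *+ k, y *+ k).
Proof.
elim: k => [|k IH]; first by rewrite !mulr0n.
by rewrite !mulrS IH.
Qed.

Lemma wdeg_ge0 ws u : all unit_weight ws -> (0 <= (wdeg ws u).1) && (0 <= (wdeg ws u).2).
Proof.
elim: ws u => [|w ws IH] [|k u] //= /andP[/unit_weightP wE /(IH u)/andP[h1 h2]].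
by case: wE => ->; rewrite pair_mulrn /= ?mul0rn ?add0r; lia.
Qed.

Lemma mem_mons ws a u : all unit_weight ws ->
  (u \in mons ws a) = (size u == size ws) && (wdeg ws u == a).
Proof.
move=> wsU; elim: ws wsU a u => [|w ws IH] /=.
  move=> _ a [|k u]; case: eqP => [->|ne]; rewrite ?inE ?eqxx // ?andbF //=.
  by apply/esym/eqP => e; apply: ne; rewrite -e.
move=> /andP[wU wsU] a u; apply/allpairsPdep/idP.
  move=> [k [v [_]]]; rewrite IH // => /andP[/eqP sv /eqP dv] -> /=.
  by rewrite sv eqxx /= dv addrC subrK eqxx.
case: u => [|k u] //= /andP[su du]; exists k, u; split=> //.
  have /andP[] := wdeg_ge0 u wsU; rewrite mem_iota /= add0n -(eqP du).
  by rewrite /mbound; case: (unit_weightP wU) => ->; rewrite pair_mulrn /= => *; lia.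
by rewrite IH // -(eqP du) addrAC subrr add0r eqxx andbT.
Qed.

Definition count_mons (ws : seq (int * int)) (D : set (seq nat)) (a : int * int) : int :=
  (size [seq u <- mons ws a | `[< D u >]])%:Z.

Lemma count_mons_neg ws D (a : int * int) : all unit_weight ws -> (a.1 < 0) || (a.2 < 0) ->
  count_mons ws D a = 0.
Proof.
move=> wsU aneg; rewrite /count_mons.
suff -> : mons ws a = [::] by [].
case E : (mons ws a) => [//|u s].
have : u \in mons ws a by rewrite E mem_head.
rewrite mem_mons // => /andP[_ /eqP ua].
have /andP[] := wdeg_ge0 u wsU; rewrite ua => h1 h2; exfalso; lia.
Qed.

Lemma count_mons_laurent ws D : all unit_weight ws -> laurent_series (count_mons ws D).
Proof. by move=> wsU; exists 0 => a ab; apply: count_mons_neg => //=; move: ab => /=; lia. Qed.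

Lemma count_mons_cons w ws D (a : int * int) (B : nat) : all unit_weight (w :: ws) ->
    (mbound a <= B)%N ->
  count_mons (w :: ws) D a =
  \sum_(k < B) count_mons ws [set u | D ((k : nat) :: u)] (a - w *+ k).
Proof.
move=> /= /andP[wU wsU] aB; rewrite -(big_mkord xpredT
  (fun k => count_mons ws [set u | D (k :: u)] (a - w *+ k))).
rewrite (big_cat_nat (n := mbound a)) //= [X in _ + X]big1_seq; last first.
  move=> k /andP[_]; rewrite mem_index_iota => /andP[ak _].
  apply: count_mons_neg => //; move: ak; rewrite /mbound.
  by case: (unit_weightP wU) => -> ; rewrite pair_mulrn /=; lia.
rewrite addr0 /count_mons /=; rewrite /allpairs_dep.
rewrite /index_iota subn0; elim: (iota 0 _) => [|k s IH]; first by rewrite big_nil.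
rewrite big_cons /= filter_cat size_cat PoszD IH; congr (Posz _ + _).
by rewrite filter_map size_map.
Qed.

(** A Laurent series that is constant in the direction [w] vanishes, because it
    vanishes far away; so the factor [1 - t^w] can be cancelled. *)
Lemma laurent_eq (F G : int * int -> int) w : unit_weight w ->
    laurent_series F -> laurent_series G ->
    (forall a, F a - F (a - w) = G a - G (a - w)) -> F = G.
Proof.
move=> wU lF lG FG; apply/funext => -[x y].
have [b Hb] := laurentD lF (laurentN lG).
apply/eqP; rewrite -subr_eq0; apply/eqP.
case: (unit_weightP wU) => we; rewrite {}we in FG.
  apply: (@int_zero_diff (fun x => F (x, y) - G (x, y)) b.1) => {}x.
    by move=> xb; apply: Hb => /=; lia.
  have := FG (x, y); rewrite (_ : (x, y) - (1, 0) = (x - 1, y)); last first.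
    by congr pair; rewrite /= subr0.
  by move=> h /=; lra.
apply: (@int_zero_diff (fun y => F (x, y) - G (x, y)) b.2) => {}y.
  by move=> xb; apply: Hb => /=; lia.
have := FG (x, y); rewrite (_ : (x, y) - (0, 1) = (x, y - 1)); last first.
  by congr pair; rewrite /= subr0.
by move=> h /=; lra.
Qed.

Lemma box_sum_shift Q f (d : int * int) :
  box_sum Q f -> box_sum Q (fun a : int * int => f (a - d)).
Proof.
apply: (@nnsum_map _ _ _ _ (fun f (a : int * int) => f (a - d))) => //.
move=> _ [i [j [c1 [c2 [Qij ->]]]]]; apply: nnsum_gen.
exists i, j, (c1 + d.1), (c2 + d.2); split=> //; apply/funext => a /=.
by rewrite !opprD -!addrA ![- d.1 + _]addrC ![- d.2 + _]addrC.
Qed.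

Lemma box_sum_antidiff (m mt m' mt' : nat) (w : int * int) f : unit_weight w ->
    m' = ((w == (1%R, 0%R)) + m)%N -> mt' = ((w == (0%R, 1%R)) + mt)%N ->
    box_sum (box_le m mt) f ->
  exists F, [/\ box_sum (box_le m' mt') F & forall a, F a - F (a - w) = f a].
Proof.
move=> wU -> -> {m' mt'}; elim=> [|_ g [i [j [c1 [c2 [/andP[im jmt] ->]]]]] _ [F [bF Fg]]].
  by exists (fun=> 0); split=> [|a]; [exact: nnsum0 | rewrite subrr].
case: (unit_weightP wU) bF Fg => -> /= bF Fg.
  exists (fun a : int * int => mcount i.+1 (a.1 - c1) * mcount j (a.2 - c2) + F a).
  split=> [|a].
    by apply: nnsumS bF; exists i.+1, j, c1, c2; split=> //; apply/andP; split; lia.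
  rewrite -(Fg a) -(mcount_diff i) /= subr0 [a.1 - 1 - c1]addrAC; ring.
exists (fun a : int * int => mcount i (a.1 - c1) * mcount j.+1 (a.2 - c2) + F a).
split=> [|a].
  by apply: nnsumS bF; exists i, j.+1, c1, c2; split=> //; apply/andP; split; lia.
rewrite -(Fg a) -(mcount_diff j) /= subr0 [a.2 - 1 - c2]addrAC; ring.
Qed.

(** The slices of an order ideal by the first exponent are order ideals in one
    variable less, and they are eventually constant.  The slices before
    stabilisation contribute finitely many shifted series; from there on the
    same series is repeated in the direction of the weight [w], which amounts to
    division by [1 - t^w]. *)
Lemma count_mons_box ws D : all unit_weight ws -> downset (size ws) D ->
  box_sum (box_le (count_mem (1, 0) ws) (count_mem (0, 1) ws)) (count_mons ws D).
Proof.
elim: ws D => [|w ws IH] D.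
  move=> _ _; have [D0|nD0] := pselect (D [::]).
    rewrite (_ : count_mons _ _ = fun a : int * int =>
      mcount 0 (a.1 - 0) * mcount 0 (a.2 - 0)); first exact: box_gen.
    apply/funext => -[x y]; rewrite /count_mons !mcount0 !subr0 /= xpair_eqE.
    by case: eqP => //= _; case: eqP => //= _; rewrite asboolT.
  rewrite (_ : count_mons _ _ = fun=> 0); first exact: nnsum0.
  by apply/funext => a; rewrite /count_mons /=; case: eqP => //= _; rewrite asboolF.
move=> /[dup] wwsU /= /andP[wU wsU] dD.
pose E k := [set u | D (k :: u)].
have dE k : downset (size ws) (E k).
  by move=> u v sv uv; apply: dD; rewrite /= ?sv ?leqnn.
have [|k0 k0P] := downset_chain_stable dE.
  move=> k l u su kl; apply: dD => /=; first by rewrite su.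
  by rewrite kl seq_le_refl.
have EE k : (k0 <= k)%N -> count_mons ws (E k) = count_mons ws (E k0).
  move=> k0k; apply/funext => a; congr (Posz (size _)); apply: eq_in_filter => u.
  rewrite mem_mons // => /andP[/eqP su _]; apply: asbool_equiv_eq; split; last exact: k0P.
  by apply: dD; rewrite /= ?su // k0k seq_le_refl.
have cle (w' : int * int) : (count_mem w' ws <= (w == w') + count_mem w' ws)%N.
  exact: leq_addl.
have [F [bF Fc]] := box_sum_antidiff wU erefl erefl (IH _ wsU (dE k0)).
have lF := box_sum_laurent bF.
have cons a B : (mbound a <= k0 + B)%N -> count_mons (w :: ws) D a =
    \sum_(k < k0) count_mons ws (E k) (a - w *+ k) +
    \sum_(k < B) count_mons ws (E k0) (a - w *+ k0 - w *+ k).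
  move=> aB; rewrite (count_mons_cons _ wwsU aB) big_split_ord /=.
  congr (_ + _); apply: eq_bigr => k _.
  by rewrite -/(E _) EE ?leq_addr // mulrnDr opprD addrA.
(* the contribution of the slices from k0 on *)
pose T a := count_mons (w :: ws) D a -
  \sum_(k < k0) count_mons ws (E k) (a - w *+ k).
have TF : T = fun a => F (a - w *+ k0).
  apply: (laurent_eq wU).
  - apply: laurentD; first exact: count_mons_laurent.
    apply/laurentN/laurent_sum => k; exact/laurent_shift/count_mons_laurent.
  - exact: laurent_shift.
  move=> a; rewrite [a - w - _]addrAC Fc /T.
  pose B := (mbound a + mbound (a - w)%R)%N.
  rewrite (cons a B.+1) ?(cons (a - w) B); try by rewrite /B; lia.
  rewrite ![_ + \sum_(_ < _) _ - _]addrAC !subrr !add0r big_ord_recl /= mulr0n subr0.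
  rewrite addrCA -[RHS]addr0; congr (_ + _); apply/eqP; rewrite addrC subr_eq0; apply/eqP.
  apply: eq_bigr => k _; congr (count_mons _ _ _).
  by rewrite /bump /= add1n mulrS opprD addrA; congr (_ - _); rewrite addrAC.
rewrite (_ : count_mons _ _ = fun a => T a +
   \sum_(k < k0) count_mons ws (E k) (a - w *+ k)); last first.
  by apply/funext => a; rewrite /T subrK.
apply: nnsumD; first by rewrite TF; apply: box_sum_shift.
apply: nnsum_sum => k; apply: box_sum_shift; apply: box_sum_sub (IH _ wsU (dE k)).
by rewrite /box_le => i j /andP[im jm]; rewrite (leq_trans im) ?(leq_trans jm) ?cle.
Qed.

(** * Homogeneous components *)

Lemma big_supp (V : nmodType) (I : eqType) (s r : seq I) (f : I -> V) :
  uniq s -> uniq r -> {subset s <= r} -> (forall a, a \notin s -> f a = 0) ->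
  \sum_(a <- r) f a = \sum_(a <- s) f a.
Proof.
move=> us ur sr f0; rewrite (bigID (mem s)) /= [X in _ + X]big1 ?addr0 //.
rewrite -big_filter; apply: perm_big; apply: uniq_perm; rewrite ?filter_uniq //.
by move=> a; rewrite mem_filter; case: (boolP (a \in s)) => // /sr.
Qed.

Section Homogeneous.
Variables (K : fieldType) (m mt : nat) (M : lmodType {mpoly K[m + mt]}).
Variables (G : int * int -> set M) (gG : grading G).
Local Notation R := {mpoly K[m + mt]}.

Lemma gradingD a x y : G a x -> G a y -> G a (x + y).
Proof.
move=> Gx Gy; rewrite -[y]opprK; apply: (gradingB gG) => //.
by rewrite -sub0r; apply: (gradingB gG) => //; apply: (grading0 gG).
Qed.

Lemma grading_sumr a (I : Type) (r : seq I) (P : pred I) (F : I -> M) :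
  (forall i, P i -> G a (F i)) -> G a (\sum_(i <- r | P i) F i).
Proof.
move=> GF; elim/big_ind: _ => //; [exact: (grading0 gG)|by move=> x y; exact: gradingD].
Qed.

Lemma mon_deg0 : mon_deg (0%MM : 'X_{1.. m + mt}) = 0.
Proof. by rewrite /mon_deg !big1 // => i _; rewrite mnm0E. Qed.

Lemma poly_compC (c : K) : @poly_comp K m mt 0 c%:MP.
Proof.
by move=> u; rewrite msuppC; case: ifP => // _; rewrite inE => /eqP ->; rewrite mon_deg0.
Qed.

Lemma poly_compX (u : 'X_{1.. m + mt}) : @poly_comp K m mt (mon_deg u) 'X_[u].
Proof. by move=> v; rewrite msuppX inE => /eqP ->. Qed.

Lemma grading_subspace a : subspace (G a : set (resK M)).
Proof.
split=> [|c x y Gx Gy]; first exact: (grading0 gG).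
by apply: gradingD => //; rewrite -[a]add0r; apply: (gradingZ gG) => //; apply: poly_compC.
Qed.

Definition decomp (x : M) (s : seq (int * int)) (f : int * int -> M) : Prop :=
  [/\ uniq s, forall a, G a (f a), forall a, a \notin s -> f a = 0 &
      x = \sum_(a <- s) f a].

Lemma decomp_exists x : exists f s, decomp x s f.
Proof.
have [s [f [us Gf ->]]] := grading_sum gG x.
exists (fun a => if a \in s then f a else 0), s; split=> //.
- by move=> a; case: ifP => // _; apply: (grading0 gG).
- by move=> a /negbTE ->.
by apply: eq_big_seq => a ->.
Qed.

(** This is directness of the sum, extended to decompositions with different
    supports. *)
Lemma decomp_unique x s t f g : decomp x s f -> decomp x t g -> f = g.
Proof.
move=> [us Gf f0 xf] [ut Gg g0 xg]; apply/funext => a.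
have uu : uniq (undup (s ++ t)) by exact: undup_uniq.
have := grading_free gG uu (f := fun b => f b - g b).
have h : \sum_(b <- undup (s ++ t)) (f b - g b) = 0.
  rewrite sumrB (big_supp us (r := undup (s ++ t))) // -?xf.
      rewrite (big_supp ut (r := undup (s ++ t))) // -?xg ?subrr //.
    by move=> b bs; rewrite mem_undup mem_cat bs orbT.
  by move=> b bs; rewrite mem_undup mem_cat bs.
move=> /(_ (fun b => gradingB gG (Gf b) (Gg b)) h a) fga.
have [/fga/eqP|] := boolP (a \in undup (s ++ t)); first by rewrite subr_eq0 => /eqP.
by rewrite mem_undup mem_cat negb_or => /andP[/f0 -> /g0 ->].
Qed.

(** Well defined by [decomp_unique]; the degrees outside the support of a
    decomposition give [0]. *)
Definition hcomp (a : int * int) (x : M) : M := projT1 (cid (decomp_exists x)) a.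

Lemma hcompP x : exists s, decomp x s (hcomp^~ x).
Proof. by rewrite /hcomp; case: (cid _) => f [s h]; exists s. Qed.

Lemma hcompE x s f a : decomp x s f -> hcomp a x = f a.
Proof. by have [t ht] := hcompP x => /(decomp_unique ht) <-. Qed.

Lemma hcomp_in a x : G a (hcomp a x).
Proof. by have [s [_ h _ _]] := hcompP x. Qed.

Lemma hcompD a x y : hcomp a (x + y) = hcomp a x + hcomp a y.
Proof.
have [s [us Gs s0 xs]] := hcompP x; have [t [ut Gt t0 yt]] := hcompP y.
apply: (@hcompE _ (undup (s ++ t)) (fun a => hcomp a x + hcomp a y)).
have uu : uniq (undup (s ++ t)) by exact: undup_uniq.
split=> //.
- by move=> b; apply: gradingD; apply: hcomp_in.
- by move=> b; rewrite mem_undup mem_cat negb_or => /andP[/s0 -> /t0 ->]; rewrite addr0.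
rewrite big_split /= (big_supp us (r := undup (s ++ t))) // -?xs.
  rewrite (big_supp ut (r := undup (s ++ t))) // -?yt // => b bs.
  by rewrite mem_undup mem_cat bs orbT.
by move=> b bs; rewrite mem_undup mem_cat bs.
Qed.

Lemma hcomp_homog a b x : G b x -> hcomp a x = if a == b then x else 0.
Proof.
move=> Gx; apply: (@hcompE _ [:: b] (fun a => if a == b then x else 0)); split=> //.
- by move=> c; case: eqP => [->|_] //; apply: (grading0 gG).
- by move=> c; rewrite inE => /negbTE ->.
by rewrite big_seq1 eqxx.
Qed.

Lemma hcomp0 a : hcomp a 0 = 0.
Proof. by rewrite (@hcomp_homog a 0 0) ?if_same //; apply: (grading0 gG). Qed.

Lemma hcomp_sum a (I : Type) (r : seq I) (P : pred I) (F : I -> M) :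
  hcomp a (\sum_(i <- r | P i) F i) = \sum_(i <- r | P i) hcomp a (F i).
Proof. by apply: (big_morph (hcomp a)); [exact: hcompD|exact: hcomp0]. Qed.

Lemma hcompZ a b (p : R) x : poly_comp b p -> hcomp a (p *: x) = p *: hcomp (a - b) x.
Proof.
move=> pb; have [s [us Gs s0 xs]] := hcompP x.
have ub : injective (fun c : int * int => b + c) by exact: addrI.
apply: (@hcompE _ [seq b + c | c <- s] (fun a => p *: hcomp (a - b) x)); split.
- by rewrite map_inj_uniq.
- by move=> c; have := gradingZ gG pb (hcomp_in (c - b) x); rewrite addrC subrK.
- move=> c cs; rewrite s0 ?scaler0 //; apply: contra cs => cs.
  by apply/mapP; exists (c - b); rewrite // addrC subrK.
rewrite big_map [in LHS]xs scaler_sumr; apply: eq_bigr => c _.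
by rewrite addrAC subrr add0r.
Qed.

Lemma hcomp_eq0 x : (forall a, hcomp a x = 0) -> x = 0.
Proof. by move=> h; have [s [_ _ _ ->]] := hcompP x; rewrite big1. Qed.

Lemma homog_gens : fin_gen M -> exists es : seq ((int * int) * M),
  (forall l, (l < size es)%N -> G (nth (0, 0) es l).1 (nth (0, 0) es l).2) /\
  forall x, exists p : nat -> R, x = \sum_(l < size es) p l *: (nth (0, 0) es l).2.
Proof.
move=> [xs xsM].
pose gen (es : seq ((int * int) * M)) x :=
  exists p : nat -> R, x = \sum_(l < size es) p l *: (nth (0, 0) es l).2.
have [es [Ges esx]] : exists es : seq ((int * int) * M),
    (forall e, e \in es -> G e.1 e.2) /\ (forall x, x \in xs -> gen es x).
  elim: xs {xsM} => [|x xs [es [Ges esx]]]; first by exists [::].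
  have [s [us Gs _ xE]] := hcompP x.
  exists ([seq (a, hcomp a x) | a <- s] ++ es); split.
    by move=> e; rewrite mem_cat => /orP[/mapP[a _ ->]|/Ges //]; apply: hcomp_in.
  move=> y; rewrite inE => /orP[/eqP ->|/esx[p ->]].
    exists (fun l => (l < size s)%N%:R); rewrite {1}xE.
    rewrite size_cat size_map big_split_ord /= [X in _ + X]big1 ?addr0.
      rewrite (big_nth 0) big_mkord; apply: eq_bigr => i _.
      by rewrite ltn_ord scale1r nth_cat size_map ltn_ord (nth_map 0).
    by move=> i _; rewrite ltnNge leq_addr scale0r.
  exists (fun l => if (l < size s)%N then 0 else p (l - size s)%N).
  rewrite size_cat size_map big_split_ord /= [X in _ = X + _]big1 ?add0r.
    apply: eq_bigr => i _; rewrite ltnNge leq_addr /= addKn nth_cat size_map.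
    by rewrite ltnNge leq_addr /= addKn.
  by move=> i _; rewrite ltn_ord scale0r.
exists es; split=> [l les|x]; first by apply: Ges; apply: mem_nth.
have : submod_span xs x by rewrite xsM.
case=> c ->.
have genD y z : gen es y -> gen es z -> gen es (y + z).
  move=> [p ->] [q ->]; exists (fun l => p l + q l).
  by rewrite -big_split; apply: eq_bigr => i _; rewrite scalerDl.
have genZ p y : gen es y -> gen es (p *: y).
  move=> [q ->]; exists (fun l => p * q l).
  by rewrite scaler_sumr; apply: eq_bigr => i _; rewrite scalerA.
elim/big_ind: _ => //.
  by exists (fun=> 0); rewrite big1 // => i _; rewrite scale0r.
by move=> i _; apply/genZ/esx/mem_nth.
Qed.

End Homogeneous.

(** * Standard monomials and the shape of Hilbert series *)

Fixpoint seq_lt (u v : seq nat) : bool :=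
  match u, v with
  | k :: u', l :: v' => (k < l)%N || (k == l) && seq_lt u' v'
  | _, _ => false
  end.

Definition pair_lt (T : Type) (lt : rel T) (x y : nat * T) : bool :=
  (x.1 < y.1)%N || (x.1 == y.1) && lt x.2 y.2.

Lemma seq_lt_irr u : seq_lt u u = false.
Proof. by elim: u => //= k u ->; rewrite ltnn andbF. Qed.

Lemma seq_lt_trans : transitive seq_lt.
Proof.
move=> v u w; elim: u v w => [|k u IH] [|l v] [|j w] //=.
case/orP=> [kl|/andP[/eqP -> uv]] /orP[lj|/andP[/eqP <- vw]].
- by rewrite (ltn_trans kl lj).
- by rewrite kl.
- by rewrite lj.
- by rewrite eqxx (IH _ _ uv vw) orbT.
Qed.

Definition seq_add (u v : seq nat) : seq nat := [seq (p.1 + p.2)%N | p <- zip u v].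

Lemma size_seq_add u v : size u = size v -> size (seq_add u v) = size u.
Proof. by move=> uv; rewrite size_map size1_zip // uv. Qed.

Lemma seq_lt_add u v w : size u = size w -> size v = size w ->
  seq_lt u v -> seq_lt (seq_add u w) (seq_add v w).
Proof.
elim: w u v => [|j w IH] [|k u] [|l v] //= [su] [sv].
by rewrite ltn_add2r eqn_add2r => /orP[-> //|/andP[-> /(IH _ _ su sv) ->]]; rewrite orbT.
Qed.

Lemma seq_le_add u v : seq_le u v -> exists w, size w = size u /\ v = seq_add u w.
Proof.
elim: u v => [|k u IH] [|l v] //=; first by exists [::].
move=> /andP[kl /IH[w [sw ->]]]; exists ((l - k)%N :: w) => /=.
by rewrite sw /seq_add /= subnKC.
Qed.

Lemma wdeg_add ws u v : size u = size ws -> size v = size ws ->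
  wdeg ws (seq_add u v) = wdeg ws u + wdeg ws v.
Proof.
elim: ws u v => [|w ws IH] [|k u] [|l v] //=; rewrite ?addr0 //.
by move=> [su] [sv]; rewrite IH // mulrnDr addrACA.
Qed.

Lemma pairwise_mons ws a : pairwise seq_lt (mons ws a).
Proof.
elim: ws a => [|w ws IH] a; first by rewrite /=; case: eqP.
rewrite /=; elim: (mbound a) {1}0%N => [//|n IHn] k /=.
rewrite pairwise_cat IHn andbT pairwise_map; apply/andP; split; last first.
  by apply: sub_pairwise (IH (a - w *+ k)) => u v uv /=; rewrite eqxx uv orbT.
apply/allrelP => x y /mapP[u _ ->] /allpairsPdep[l [v [+ _ ->]]].
by rewrite mem_iota => /andP[kl _] /=; rewrite kl.
Qed.

Lemma wdegE ws u : size u = size ws -> wdeg ws u = \sum_(i < size ws) ws`_i *+ nth 0%N u i.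
Proof.
elim: ws u => [|w ws IH] [|k u] //=; first by rewrite big_ord0.
by move=> [su]; rewrite big_ord_recl IH.
Qed.

Section StandardMonomials.
Variables (K : fieldType) (m mt : nat) (M : lmodType {mpoly K[m + mt]}).
Variables (G : int * int -> set M) (gG : grading G).
Local Notation R := {mpoly K[m + mt]}.

Definition var_weights : seq (int * int) := nseq m (1, 0) ++ nseq mt (0, 1).

Lemma size_var_weights : size var_weights = (m + mt)%N.
Proof. by rewrite size_cat !size_nseq. Qed.

Lemma var_weights_unit : all unit_weight var_weights.
Proof. by rewrite all_cat !all_nseq !orbT. Qed.

Definition mnm_of (u : seq nat) : 'X_{1.. m + mt} := [multinom nth 0%N u i | i < m + mt].

Lemma mon_deg_mnm_of u : size u = (m + mt)%N -> mon_deg (mnm_of u) = wdeg var_weights u.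
Proof.
move=> su; rewrite wdegE ?size_var_weights // big_split_ord /=.
have -> : \sum_(i < m) var_weights`_i *+ nth 0%N u i = ((\sum_(i < m) nth 0%N u i)%N%:Z, 0).
  have mD : {morph (fun k : nat => (k%:Z, 0) : int * int) : x y / (x + y)%N >-> x + y}.
    by move=> x y; congr pair; rewrite ?addr0 // PoszD.
  rewrite [RHS](big_morph _ mD (erefl (0 : int * int))).
  apply: eq_bigr => i _; rewrite nth_cat size_nseq ltn_ord nth_nseq ltn_ord.
  by rewrite pair_mulrn mul0rn natz.
have -> : \sum_(i < mt) var_weights`_(m + i) *+ nth 0%N u (m + i) =
    (0, (\sum_(i < mt) nth 0%N u (m + i))%N%:Z).
  have mD : {morph (fun k : nat => (0, k%:Z) : int * int) : x y / (x + y)%N >-> x + y}.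
    by move=> x y; congr pair; rewrite ?addr0 // PoszD.
  rewrite [RHS](big_morph _ mD (erefl (0 : int * int))).
  apply: eq_bigr => i _; rewrite nth_cat size_nseq ltnNge leq_addr /= addKn nth_nseq ltn_ord.
  by rewrite pair_mulrn mul0rn natz.
rewrite /mon_deg; congr pair; rewrite /= ?addr0 ?add0r; congr (Posz _);
  by apply: eq_bigr => i _; rewrite mnmE.
Qed.

Lemma mnm_of_add u v : size u = (m + mt)%N -> size v = (m + mt)%N ->
  mnm_of (seq_add u v) = (mnm_of u + mnm_of v)%MM.
Proof.
move=> su sv; apply/mnmP => i; rewrite mnmDE !mnmE (nth_map (0, 0)%N).
  by rewrite nth_zip ?su ?sv.
by rewrite size1_zip ?su ?sv.
Qed.

Lemma mnm_of_val (u : 'X_{1.. m + mt}) : mnm_of [seq u i | i <- enum 'I_(m + mt)] = u.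
Proof.
apply/mnmP => i; rewrite mnmE (nth_map i) ?size_enum_ord // nth_ord_enum //.
Qed.

Variable es : seq ((int * int) * M).
Local Notation d l := (nth (0, 0) es l).1.
Local Notation e l := (nth (0, 0) es l).2.
Hypothesis Ges : forall l, (l < size es)%N -> G (d l) (e l).
Hypothesis es_gen : forall x, exists p : nat -> R, x = \sum_(l < size es) p l *: e l.

Definition mvec (x : nat * seq nat) : resK M := 'X_[mnm_of x.2] *: e x.1.

Definition mdeg_of (x : nat * seq nat) : int * int := d x.1 + wdeg var_weights x.2.

Definition mvalid (x : nat * seq nat) : bool :=
  (x.1 < size es)%N && (size x.2 == (m + mt)%N).

Definition mpairs (a : int * int) : seq (nat * seq nat) :=
  [seq (l, u) | l <- iota 0 (size es), u <- mons var_weights (a - d l)].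

Lemma mem_mpairs a x : (x \in mpairs a) = mvalid x && (mdeg_of x == a).
Proof.
case: x => l u; apply/allpairsPdep/idP => [[k [v [+ + [-> ->]]]]|].
  rewrite mem_iota mem_mons ?var_weights_unit // size_var_weights /mvalid /mdeg_of /=.
  by rewrite add0n => -> /andP[-> /eqP ->]; rewrite addrC subrK eqxx.
rewrite /mvalid /mdeg_of /= => /andP[/andP[les su] /eqP <-].
exists l, u; rewrite mem_iota mem_mons ?var_weights_unit // size_var_weights su.
by rewrite addrAC subrr add0r eqxx.
Qed.

Lemma pairwise_mpairs a : pairwise (pair_lt seq_lt) (mpairs a).
Proof.
rewrite /mpairs; elim: (size es) {1}0%N => [//|n IHn] k /=.
rewrite pairwise_cat IHn andbT pairwise_map; apply/andP; split; last first.
  apply: sub_pairwise (pairwise_mons var_weights (a - d k)) => u v uv.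
  by rewrite /pair_lt /= eqxx uv orbT.
apply/allrelP => x y /mapP[u _ ->] /allpairsPdep[l [v [+ _ ->]]].
by rewrite mem_iota /pair_lt => /andP[kl _] /=; rewrite kl.
Qed.

(** A monomial multiple of a generator is standard if it is not a combination of
    later ones of the same degree.  Multiplication by a monomial preserves the
    order, so the standard monomials form an order ideal for each generator, and
    in each degree they give a basis. *)
Definition standard (x : nat * seq nat) : Prop :=
  ~ exists T : seq (nat * seq nat),
      (forall y, y \in T -> [/\ mvalid y, mdeg_of y = mdeg_of x & pair_lt seq_lt x y]) /\
      lspan [seq mvec y | y <- T] (mvec x).

(** The list [L] contains everything of degree [a] that comes after one of its
    members, so the test made by the sieve inside [L] agrees with the test that
    defines [standard]. *)
Lemma sieve_standard (a : int * int) (L : seq (nat * seq nat)) :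
    pairwise (pair_lt seq_lt) L ->
    (forall x, x \in L -> mvalid x /\ mdeg_of x = a) ->
    (forall x y, x \in L -> mvalid y -> mdeg_of y = a -> pair_lt seq_lt x y -> y \in L) ->
  sieve [seq mvec x | x <- L] = [seq mvec x | x <- L & `[< standard x >]].
Proof.
elim: L => [//|x L IH] /= /andP[/allP xL pL] La Lc.
have irr (y : nat * seq nat) : pair_lt seq_lt y y = false.
  by rewrite /pair_lt ltnn eqxx seq_lt_irr.
have trans : transitive (pair_lt seq_lt).
  move=> [l v] [k u] [j w]; rewrite /pair_lt /=.
  case/orP=> [kl|/andP[/eqP -> uv]] /orP[lj|/andP[/eqP <- vw]].
  - by rewrite (ltn_trans kl lj).
  - by rewrite kl.
  - by rewrite lj.
  - by rewrite eqxx (seq_lt_trans uv vw) orbT.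
have [vx dx] := La x (mem_head _ _).
have -> : `[< lspan [seq mvec y | y <- L] (mvec x) >] = ~~ `[< standard x >].
  rewrite -asbool_neg; apply: asbool_equiv_eq; split.
    move=> sx; apply; exists L; split=> // y yL.
    have [vy dy] : mvalid y /\ mdeg_of y = a by apply: La; rewrite inE yL orbT.
    by rewrite dy dx xL.
  move/contrapT => [T [TP]]; apply: lspan_min; first exact: lspan_subspace.
  move=> z /mapP[y yT ->]; apply: lspan_mem; apply: map_f.
  have [vy dy xy] := TP y yT.
  have := Lc x y (mem_head _ _) vy (etrans dy dx) xy; rewrite inE => /orP[/eqP yx|//].
  by rewrite yx irr in xy.
have -> : sieve [seq mvec y | y <- L] = [seq mvec x0 | x0 <- L & `[< standard x0 >]].
  apply: IH => // [y yL|y z yL vz dz yz]; first by apply: La; rewrite inE yL orbT.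
  have : z \in x :: L by apply: (Lc y) => //; rewrite inE yL orbT.
  rewrite inE => /orP[/eqP zx|//].
  by have := trans _ _ _ (xL y yL) yz; rewrite zx irr.
by case: asboolP.
Qed.

Lemma mvec_in x : mvalid x -> G (mdeg_of x) (mvec x).
Proof.
case: x => l u; rewrite /mvalid => /andP[/= les /eqP su];
rewrite /mdeg_of /= addrC -mon_deg_mnm_of //.
by apply: (gradingZ gG); [exact: poly_compX|exact: Ges].
Qed.

Lemma lspan_mpairs a : lspan [seq mvec x | x <- mpairs a] = (G a : set (resK M)).
Proof.
apply/seteqP; split.
  apply: lspan_min; first exact: grading_subspace.
  move=> _ /mapP[x + ->]; rewrite mem_mpairs => /andP[vx /eqP <-]; exact: mvec_in.
move=> x Gx; have [p xE] := es_gen x.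
have -> : x = hcomp gG a x by rewrite (hcomp_homog _ _ Gx) eqxx.
rewrite xE hcomp_sum; have sub := lspan_subspace [seq mvec x | x <- mpairs a].
apply: (subspace_sum (V := resK M)) => // l _.
rewrite [p l]mpolyE scaler_suml hcomp_sum.
apply: (subspace_sum (V := resK M)) => // u _.
rewrite -mul_mpolyC -scalerA.
rewrite (hcompZ _ _ _ (@poly_compC K m mt _)) subr0 -[_ *: hcomp _ _ _]resKE.
apply: subspaceZ => //.
pose y := (val l, [seq u i | i <- enum 'I_(m + mt)]).
have vy : mvalid y by rewrite /mvalid /= ltn_ord size_map size_enum_ord eqxx.
have -> : 'X_[u] *: e l = mvec y by rewrite /mvec /= mnm_of_val.
rewrite (hcomp_homog _ _ (mvec_in vy)); case: eqP => [aE|_]; last by case: sub.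
by apply/lspan_mem/map_f; rewrite mem_mpairs vy aE eqxx.
Qed.

Lemma standard_downset l : (l < size es)%N ->
  downset (size var_weights) [set u | standard (l, u)].
Proof.
rewrite size_var_weights => les u v sv uv; apply: contra_not => -[T [TP sT]].
have [w [sw vE]] := seq_le_add uv; have su := seq_le_size uv.
rewrite sv in su; rewrite su in sw.
(* a relation showing that u is not standard, multiplied by the monomial of
   exponent w *)
pose sh (y : nat * seq nat) := (y.1, seq_add y.2 w).
have shE y : mvalid y -> mvec (sh y) = 'X_[mnm_of w] *: (mvec y : M).
  by rewrite /mvalid => /andP[_ /eqP sy]; rewrite /mvec /= mnm_of_add // addmC mpolyXD scalerA.
exists [seq sh y | y <- T]; split.
  move=> _ /mapP[y yT ->]; have [vy dy ly] := TP y yT.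
  have sy : size y.2 = (m + mt)%N by move: vy; rewrite /mvalid => /andP[_ /eqP].
  split.
  - move: vy; rewrite /mvalid => /andP[h _]; rewrite /= h size_seq_add ?sy ?sw //=.
  - rewrite vE /mdeg_of /= !wdeg_add ?size_var_weights ?sy ?su ?sw //.
    by rewrite !addrA; congr (_ + _); exact: dy.
  - move: ly; rewrite /pair_lt /= vE => /orP[->//|/andP[-> uy]].
    by rewrite seq_lt_add ?orbT ?su ?sy ?sw.
have -> : mvec (l, v) = 'X_[mnm_of w] *: (mvec (l, u) : M).
  by rewrite vE -[(l, seq_add u w)]/(sh (l, u)) shE // /mvalid /= les su eqxx.
have {}TP y : y \in T -> mvalid y by case/TP.
elim: T (mvec (l, u)) TP sT => [|y T IH] z TP /=; first by move=> ->; rewrite scaler0.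
move=> [c [t [tT ->]]]; exists c, ('X_[mnm_of w] *: (t : M)); split.
  by apply: IH tT => x xT; apply: TP; rewrite inE xT orbT.
rewrite shE ?TP ?mem_head //.
have comm (p q : R) (y1 y2 : M) : p *: (q *: y1 + y2) = q *: (p *: y1) + p *: y2.
  by rewrite scalerDr !scalerA mulrC.
exact: comm.
Qed.

Lemma Kdim_standard a : (Kdim (G a))%:Z =
  \sum_(l < size es) count_mons var_weights [set u | standard (val l, u)] (a - d l).
Proof.
have [fs ss] := sieve_basis [seq mvec x | x <- mpairs a].
rewrite (Kdim_list fs (etrans ss (lspan_mpairs a))).
rewrite (@sieve_standard a); last 3 first.
- exact: pairwise_mpairs.
- by move=> x; rewrite mem_mpairs => /andP[vx /eqP].
- by move=> x y _ vy dy _; rewrite mem_mpairs vy dy eqxx.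
rewrite size_map /mpairs -(big_mkord xpredT (fun l => count_mons var_weights
  [set u | standard (l, u)] (a - d l))) /index_iota subn0.
elim: (iota _ _) => [|l s IH]; first by rewrite big_nil.
by rewrite big_cons /= filter_cat size_cat PoszD IH filter_map size_map.
Qed.

Lemma hilbert_series_box : box_sum (box_le m mt) (hilbert_series G).
Proof.
have -> : hilbert_series G = fun a =>
    \sum_(l < size es) count_mons var_weights [set u | standard (val l, u)] (a - d l).
  by apply/funext => a; rewrite /hilbert_series Kdim_standard.
apply: nnsum_sum => l; apply: box_sum_shift.
have := count_mons_box var_weights_unit (standard_downset (ltn_ord l)).
by rewrite /var_weights !count_cat !count_nseq /= !mul1n !mul0n addn0.
Qed.

End StandardMonomials.

Section FinGen.
Variables (K : fieldType) (m mt : nat) (M : lmodType {mpoly K[m + mt]}).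
Variables (G : int * int -> set M) (gG : grading G) (fgM : fin_gen M).

(** In each degree the standard monomials are a basis, and for each generator
    they form an order ideal, whose counting series is known. *)
Lemma fin_gen_hilbert_box : box_sum (box_le m mt) (hilbert_series G).
Proof. by have [es [Ges gen]] := homog_gens gG fgM; exact: hilbert_series_box Ges gen. Qed.

Lemma fin_gen_fin_dim a : fin_dim (G a : set (resK M)).
Proof.
have [es [Ges gen]] := homog_gens gG fgM.
exists [seq mvec es x | x <- mpairs es a].
by rewrite (lspan_mpairs gG Ges gen).
Qed.

End FinGen.

(** * Filtration by torsion with respect to the variables *)

Section TorsionFiltration.
Variables (K : fieldType) (m mt : nat) (M : lmodType {mpoly K[m + mt]}).
Variables (G : int * int -> set M) (gG : grading G) (fgM : fin_gen M).
Local Notation R := {mpoly K[m + mt]}.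

Definition var_deg (i : 'I_(m + mt)) : int * int := mon_deg U_(i).

Lemma var_degE i : var_deg i = if (i < m)%N then (1, 0) else (0, 1).
Proof.
rewrite /var_deg /mon_deg; case: (splitP i) => j ij.
  have -> : i = lshift mt j by apply/val_inj.
  rewrite (bigD1 j) //= mnm1E eqxx !big1 // => [k _|k kj]; rewrite mnm1E.
    by rewrite eq_lrshift.
  by rewrite eq_lshift eq_sym (negbTE kj).
have -> : i = rshift m j by apply/val_inj.
rewrite big1 => [|k _]; last by rewrite mnm1E eq_rlshift.
rewrite (bigD1 j) //= mnm1E eqxx big1 // => k kj.
by rewrite mnm1E eq_rshift eq_sym (negbTE kj).
Qed.

Lemma poly_comp_var i : poly_comp (var_deg i) ('X_i : R).
Proof. exact: poly_compX. Qed.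

Definition var_tor (ks : seq 'I_(m + mt)) : set M :=
  [set z | forall i, i \in ks -> exists N, ('X_i : R) ^+ N *: z = 0].

Lemma var_tor_subspace ks : subspace (var_tor ks : set (resK M)).
Proof.
split=> [i _|c x y tx ty i ik]; first by exists 0%N; rewrite scaler0.
have [p px] := tx i ik; have [q qy] := ty i ik; exists (p + q)%N.
have tZ (r s : R) (u : M) : r *: u = 0 -> (r * s) *: u = 0.
  by move=> ru; rewrite mulrC -scalerA ru scaler0.
rewrite scalerDr resKE scalerA exprD -mulrA tZ // add0r.
by rewrite mulrC; apply: tZ.
Qed.

Definition tor_dim (ks : seq 'I_(m + mt)) (a : int * int) : int :=
  (Kdim (G a `&` var_tor ks))%:Z.

Let fdG ks a : fin_dim (G a `&` var_tor ks : set (resK M)).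
Proof. by apply: fin_dim_sub (fin_gen_fin_dim gG fgM a) => x []. Qed.

Let sG ks a : subspace (G a `&` var_tor ks : set (resK M)).
Proof. by apply: subspaceI; [exact: grading_subspace|exact: var_tor_subspace]. Qed.

Let torS i ks : var_tor (i :: ks) `<=` var_tor ks.
Proof. by move=> z tz j jk; apply: tz; rewrite inE jk orbT. Qed.

Lemma tor_dim_le i ks a : tor_dim (i :: ks) a <= tor_dim ks a.
Proof. by rewrite lez_nat; apply: (@Kdim_sub K m mt M) => // x [Gx /torS]. Qed.

(** Multiplication by the variable [i] is injective on the quotient of the
    elements killed by powers of the variables in [ks] by those which are also
    killed by a power of the variable [i]. *)
Lemma tor_dim_step i ks a :
  tor_dim ks a - tor_dim (i :: ks) a <=
  tor_dim ks (a + var_deg i) - tor_dim (i :: ks) (a + var_deg i).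
Proof.
have := @Kdim_relative K m mt M (G a `&` var_tor ks) (G a `&` var_tor (i :: ks))
  (G (a + var_deg i) `&` var_tor ks) (G (a + var_deg i) `&` var_tor (i :: ks))
  (fun x : M => ('X_i : R) *: x).
rewrite /tor_dim => h; rewrite lerBrDr addrAC lerBlDr -!PoszD lez_nat; apply: h => //.
- by move=> x [Gx /torS].
- by move=> x [Gx /torS].
- by move=> c x y; rewrite scalerDr !resKE !scalerA mulrC.
- move=> x [Gx tx]; split.
    by rewrite addrC; apply: (gradingZ gG) => //; apply: poly_comp_var.
  move=> j /tx[N Nx]; exists N.
  by rewrite scalerA mulrC -scalerA Nx scaler0.
move=> x [Gx tx] [_ tXx]; split=> // j; rewrite inE => /orP[/eqP ->|/tx //].
have [N] := tXx i (mem_head _ _); rewrite scalerA -exprSr => h'.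
by exists N.+1.
Qed.

Lemma tor_dim_split ks : exists H1 H2 : int * int -> int,
  forall a, [/\ tor_dim [::] a - tor_dim ks a = H1 a + H2 a,
    0 <= H1 a, 0 <= H2 a, H1 a <= H1 (a + (1, 0)) & H2 a <= H2 (a + (0, 1))].
Proof.
elim: ks => [|i ks [H1 [H2 IH]]].
  by exists (fun=> 0), (fun=> 0) => a; split; rewrite // subrr.
pose D a := tor_dim ks a - tor_dim (i :: ks) a.
have D0 a : 0 <= D a by rewrite subr_ge0 tor_dim_le.
have := tor_dim_step i ks; rewrite var_degE; case: ifP => _ step.
  exists (fun a => H1 a + D a), H2 => a; have [e h1 h2 s1 s2] := IH a; split=> //.
  - by rewrite addrAC -e /D addrA subrK.
  - by rewrite addr_ge0.
  - by rewrite lerD ?step.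
exists H1, (fun a => H2 a + D a) => a; have [e h1 h2 s1 s2] := IH a; split=> //.
- by rewrite addrA -e /D addrA subrK.
- by rewrite addr_ge0.
- by rewrite lerD ?step.
Qed.

(** From a nonzero element on which every variable is nilpotent, repeated
    multiplication by suitable powers of the variables leads to a nonzero element
    killed by all of them. *)
Lemma var_tor_socle : (forall z : M, (forall i, ('X_i : R) *: z = 0) -> z = 0) ->
  var_tor (enum 'I_(m + mt)) = [set 0].
Proof.
move=> soc; apply/seteqP; split=> [z tz|_ ->]; last first.
  by move=> i _; exists 0%N; rewrite scaler0.
have {}tz i : exists N, ('X_i : R) ^+ N *: z = 0 by apply: tz; rewrite mem_enum.
apply: contrapT => zn0.
have key (ks : seq 'I_(m + mt)) : exists w : M,
    [/\ w <> 0, forall i, exists N, ('X_i : R) ^+ N *: w = 0 &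
    forall i, i \in ks -> ('X_i : R) *: w = 0].
  elim: ks => [|i ks [w [wn0 wt wk]]]; first by exists z.
  have exN : exists N, `[< ('X_i : R) ^+ N *: w = 0 >].
    by have [N ?] := wt i; exists N; apply/asboolP.
  case: (ex_minnP exN) => -[|N] /asboolP XN minN.
    by case: wn0; rewrite -[w]scale1r -(expr0 ('X_i : R)).
  have comm (p q : R) (u : M) : p *: u = 0 -> p *: (q *: u) = 0.
    by move=> pu; rewrite scalerA mulrC -scalerA pu scaler0.
  exists (('X_i : R) ^+ N *: w); split.
  - by move=> XN0; have := minN N (asboolT XN0); rewrite ltnn.
  - by move=> j; have [n nw] := wt j; exists n; apply: comm.
  move=> j; rewrite inE => /orP[/eqP ->|/wk jw]; last exact: comm.
  by rewrite scalerA -exprS.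
have [w [wn0 _ wk]] := key (enum 'I_(m + mt)).
by apply: wn0; apply: soc => i; apply: wk; rewrite mem_enum.
Qed.

Lemma socle_free_split : (forall z : M, (forall i, ('X_i : R) *: z = 0) -> z = 0) ->
  exists H1 : int * int -> int, [/\ forall a, 0 <= H1 a <= hilbert_series G a,
    forall a, H1 a <= H1 (a + (1, 0)) &
    forall a, hilbert_series G a - H1 a <=
      hilbert_series G (a + (0, 1)) - H1 (a + (0, 1))].
Proof.
move=> /var_tor_socle tor0; have [H1 [H2 HH]] := tor_dim_split (enum 'I_(m + mt)).
have HE a : hilbert_series G a = H1 a + H2 a.
  have [<- _ _ _ _] := HH a; rewrite /tor_dim tor0.
  have -> : G a `&` [set 0] = [set 0].
    by apply/seteqP; split=> [x [] //|x ->]; split=> //; apply: (grading0 gG).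
  rewrite Kdim0 subr0; congr (Posz (Kdim _)).
  by apply/seteqP; split=> [x Gx|x []].
exists H1; split=> a; have [_ h1 h2 s1 s2] := HH a => //.
  by rewrite h1 HE lerDl.
by rewrite !HE ![H1 _ + _]addrC !addrK.
Qed.

End TorsionFiltration.

(** * Positive depth *)

Lemma supremum_gt0 (A : set (extended int)) :
  (EFin (0 : int) < supremum (EFin (0 : int)) A)%O -> exists2 d, A d & (EFin (0 : int) < d)%O.
Proof.
move=> sA; apply: contrapT => no.
suff : (supremum (EFin (0 : int)) A <= EFin (0 : int))%O by rewrite leNgt sA.
rewrite /supremum; case: eqP => // _; case: xgetP => [y _ [_ lb]|//].
apply: lb => d Ad; rewrite leNgt; apply/negP => d0; apply: no.
by exists d.
Qed.

(** Every set of extended integers has a supremum, so the default value of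
    [supremum] is only met for the empty set. *)
Lemma supremum_ge (A : set (extended int)) d : A d ->
  (d <= supremum (EFin (0 : int)) A)%O.
Proof.
move=> Ad; rewrite /supremum; case: eqP => [A0|_]; first by rewrite A0 in Ad.
have ub_sup y : supremums A y -> (d <= y)%O by case=> ub _; apply: ub.
suff [s sA] : exists s, supremums A s.
  by case: xgetP => [y _ /ub_sup //|no]; case: (no s).
have [bnd|unb] := pselect (exists n : int, forall e, A e -> (e <= EFin n)%O); last first.
  exists (@EPInf int); split=> [e _|y uby]; first exact: leey.
  case: y uby => [r|//|] uby; first by case: unb; exists r => e /uby.
  by case: unb; exists 0 => e /uby; rewrite leeNy_eq => /eqP ->; exact: leNye.
have [allN|] := pselect (forall e, A e -> e = @ENInf int).
  exists (@ENInf int); split=> [e /allN -> //|y _]; exact: leNye.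
move=> /existsNP[e1 /not_implyP[Ae1 e1N]].
have [n nb] := bnd.
have [r re1] : exists r : int, e1 = EFin r.
  by case: e1 Ae1 e1N => [r|/nb|] //; exists r.
(* A is bounded above and has a finite element, so its largest element is
   found by descending from the bound n *)
pose P k := `[< A (EFin (n - k%:Z)) >].
have exP : exists k, P k.
  have rn : r <= n by have := nb _ Ae1; rewrite re1.
  by exists `|(n - r)%R|%N; apply/asboolP; rewrite (_ : n - _ = r) -?re1 //; lia.
case: (ex_minnP exP) => k /asboolP Ak kmin; exists (EFin (n - k%:Z)); split; last first.
  by move=> y; apply.
move=> [s| |] As; [|by have := nb _ As|exact: leNye].
have sn : s <= n by have := nb _ As.
have := kmin `|(n - s)%R|%N; rewrite /P (_ : n - _ = s); last by lia.
move=> /(_ (asboolT As)) ks; rewrite lee_fin; lia.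
Qed.

Section Depth.
Variables (K : fieldType) (m mt : nat) (M : lmodType {mpoly K[m + mt]}).
Variables (G : int * int -> set M) (gG : grading G) (fgM : fin_gen M).
Local Notation R := {mpoly K[m + mt]}.

Lemma all_vars_nth (i : 'I_(size (all_vars K m mt))) : exists j, (all_vars K m mt)`_i = 'X_j.
Proof. by have /mapP[j _ ->] := mem_nth 0 (ltn_ord i); exists j. Qed.

(** The degrees of a finitely generated graded module are bounded below, so an
    element of least total degree cannot be a combination of variables with
    coefficients in the module. *)
Lemma graded_nakayama : @ideal_mul K m mt M (all_vars K m mt) = setT -> forall z : M, z = 0.
Proof.
move=> IM; have [b Gb] := box_sum_laurent (fin_gen_hilbert_box gG fgM).
have out (a : int * int) : ~~ ((b.1 <= a.1) && (b.2 <= a.2)) -> forall x, G a x -> x = 0.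
  move=> /Gb; rewrite /hilbert_series => -[d0] x Gx.
  have [s [_ sG d]] := Kdim_basis (grading_subspace gG a) (fin_gen_fin_dim gG fgM a).
  move: d; rewrite d0 => /esym/size0nil s0.
  by have : (G a : set (resK M)) x by []; rewrite -sG s0.
have van (n : nat) (a : int * int) : a.1 + a.2 <= b.1 + b.2 + n%:Z - 1 ->
    forall x, G a x -> x = 0.
  elim: n a => [|n IH] a an; first by apply: out; lia.
  move=> x Gx; have : ideal_mul (all_vars K m mt) x by rewrite IM.
  case=> f xE; have -> : x = hcomp gG a x by rewrite (hcomp_homog _ _ Gx) eqxx.
  rewrite xE hcomp_sum big1 // => i _; have [j ->] := all_vars_nth i.
  rewrite (hcompZ _ _ _ (@poly_comp_var K m mt j)).
  rewrite (IH (a - var_deg j) _ _ (hcomp_in gG _ _)) ?scaler0 //.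
  by move: an; rewrite var_degE; case: ifP => _ /=; lia.
move=> z; apply: (@hcomp_eq0 K m mt M G gG z) => a.
by apply: (van `|(a.1 + a.2 - b.1 - b.2 + 1)%R|%N a _ _ (hcomp_in gG a z)); lia.
Qed.

Lemma depth_gt0_socle : (EFin (0 : int) < depth M)%O ->
  forall z : M, (forall i, ('X_i : R) *: z = 0) -> z = 0.
Proof.
rewrite /depth; case: asboolP => [/graded_nakayama h _ z _|_]; first exact: h.
move=> /supremum_gt0[_ [xs [xsI [reg _]] <-]].
case: xs xsI reg => [|x xs] xsI reg; first by rewrite ltxx.
move=> _ z zX; have [f xE] := xsI x (mem_head _ _).
have [||f0 ->] := reg 0%N z => //; last by rewrite big_ord0.
exists (fun=> 0) => /=; rewrite big_ord0 [x]xE scaler_suml big1 // => i _.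
have [j ->] := all_vars_nth i.
have -> : 'X_j *: (f i) = f i * ('X_j : R) by exact: mulrC.
by rewrite -scalerA zX scaler0.
Qed.

Lemma depth_gt0 (x : R) : @irrelevant_ideal K m mt x ->
  (forall z : M, x *: z = 0 -> z = 0) -> (EFin (0 : int) < depth M)%O.
Proof.
move=> Ix reg; rewrite /depth; case: asboolP => // IM.
have h1 : [set EFin (size xs)%:Z | xs in
    [set xs : seq R | (forall x, x \in xs -> irrelevant_ideal x) /\ @regular_seq K m mt M xs]]
    (EFin (1 : int)).
  exists [:: x] => //; split; first by move=> y; rewrite inE => /eqP ->.
  split=> [[|//] y _ [f /=]|xM].
    rewrite big_ord0 => /reg ->; exists (fun=> 0); by rewrite big_ord0.
  apply: IM; apply/seteqP; split=> // y _.
  have : ideal_mul [:: x] y by rewrite xM.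
  case=> f ->; rewrite big_ord1 /=; have [g ->] := Ix.
  exists (fun i => g i *: f ord0); rewrite scaler_suml; apply: eq_bigr => i _.
  by rewrite -scalerA.
apply: lt_le_trans (supremum_ge h1) => //.
Qed.

End Depth.

(** * Modules with prescribed Hilbert series *)

Lemma count_mons_full (i j : nat) :
  count_mons (nseq i (1, 0) ++ nseq j (0, 1)) setT =
  fun a : int * int => mcount i a.1 * mcount j a.2.
Proof.
have unit i' j' : all unit_weight (nseq i' (1, 0) ++ nseq j' (0, 1)).
  by rewrite all_cat !all_nseq !orbT.
have lm i' j' : laurent_series (fun a : int * int => mcount i' a.1 * mcount j' a.2).
  exists 0 => -[x y] /= xy; have [x0|x0] := ltP x 0; first by rewrite mcount_neg ?mul0r.
  by rewrite [X in _ * X]mcount_neg ?mulr0 //; lia.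
have step w ws a : all unit_weight (w :: ws) ->
    count_mons (w :: ws) setT a - count_mons (w :: ws) setT (a - w) = count_mons ws setT a.
  move=> wwsU; pose B := (mbound a + mbound (a - w)%R)%N.
  rewrite (@count_mons_cons _ _ _ _ B.+1) // ?(@count_mons_cons _ _ _ (a - w) B) //;
    try by rewrite /B; lia.
  rewrite big_ord_recl /= mulr0n subr0 -[RHS]addr0 -addrA; congr (_ + _).
  apply/eqP; rewrite subr_eq0; apply/eqP; apply: eq_bigr => k _.
  by congr (count_mons _ _ _); rewrite /bump /= add1n mulrS opprD addrA.
elim: i => [|i IH]; last first.
  apply: (laurent_eq (w := (1, 0)) isT).
  - exact/count_mons_laurent/(unit i.+1 j).
  - exact: lm.
  move=> [x y]; rewrite (step (1, 0) _ _ (unit i.+1 j)) IH /=.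
  by rewrite subr0 -mulrBl mcount_diff.
elim: j => [|j IH].
  apply/funext => -[x y]; rewrite /count_mons /= !mcount0 xpair_eqE.
  by case: eqP => //= _; case: eqP => //= _; rewrite asboolT.
apply: (laurent_eq (w := (0, 1)) isT).
- exact/count_mons_laurent/(unit 0%N j.+1).
- exact: lm.
move=> [x y]; rewrite (step (0, 1) _ _ (unit 0%N j.+1)) IH /=.
by rewrite subr0 -mulrBr mcount_diff.
Qed.

Section PolynomialHilbert.
Variables (K : fieldType) (m mt : nat).
Local Notation R := {mpoly K[m + mt]}.

(** The linear form reading off the coefficient of a monomial vanishes on the
    span of the other monomials. *)
Lemma poly_comp_basis a :
  let s : seq (resK (R^o)) := [seq 'X_[mnm_of m mt u] | u <- mons (var_weights m mt) a] in
  lfree s /\ lspan s = (@poly_comp K m mt a : set (resK (R^o))).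
Proof.
set s := map _ _; split.
  rewrite /s {s}; have := pairwise_mons (var_weights m mt) a.
  have : forall u, u \in mons (var_weights m mt) a -> size u = (m + mt)%N.
    by move=> u; rewrite mem_mons ?var_weights_unit // size_var_weights => /andP[/eqP].
  elim: (mons _ _) => [//|u s IH] /= szs /andP[us ps]; split; last first.
    by apply: IH => // v vs; apply: szs; rewrite inE vs orbT.
  move=> sp; have : (('X_[mnm_of m mt u] : R)@_(mnm_of m mt u) = 0).
    apply: (lspan_min (A := [set p : resK (R^o) | (p : R)@_(mnm_of m mt u) = 0]) _ _ sp).
      split=> [|c p q /= p0 q0]; first exact: mcoeff0.
      change ((c%:MP * (p : R) + (q : R))@_(mnm_of m mt u) = 0).
      by rewrite mcoeffD mcoeffCM p0 q0 mulr0 addr0.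
    move=> _ /mapP[v vs ->] /=; rewrite mcoeffX; case: eqP => // e.
    have [su sv] : size u = (m + mt)%N /\ size v = (m + mt)%N.
      by split; apply: szs; rewrite inE ?eqxx ?vs ?orbT.
    have uv : u = v.
      apply: (@eq_from_nth _ 0%N) => [|k ku]; first by rewrite su sv.
      rewrite su in ku; have /mnmP/(_ (Ordinal ku)) := e.
      by rewrite !mnmE /=.
    by move/allP: us => /(_ v vs); rewrite uv seq_lt_irr.
  by rewrite mcoeffX eqxx => /eqP; rewrite oner_eq0.
apply/seteqP; split.
  apply: lspan_min; first exact: (grading_subspace (poly_grading K m mt)).
  move=> _ /mapP[u + ->]; rewrite mem_mons ?var_weights_unit // size_var_weights.
  by move=> /andP[/eqP su /eqP <-]; rewrite -mon_deg_mnm_of //; apply: poly_compX.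
move=> p pa; rewrite /s [p](mpolyE (p : R)).
rewrite big_seq; apply: (subspace_sum (V := resK (R^o))) => [|u up].
  exact: lspan_subspace.
rewrite -mul_mpolyC; apply: (@subspaceZ _ (resK (R^o))); first exact: lspan_subspace.
apply: lspan_mem; apply/mapP; exists [seq u i | i <- enum 'I_(m + mt)].
  have sz : size [seq u i | i <- enum 'I_(m + mt)] = (m + mt)%N.
    by rewrite size_map size_enum_ord.
  rewrite mem_mons ?var_weights_unit // size_var_weights sz eqxx /=.
  by rewrite -mon_deg_mnm_of // mnm_of_val (pa u up).
by rewrite mnm_of_val.
Qed.

Lemma hilbert_poly a : Hilb (poly_gmod K m mt) a = mcount m a.1 * mcount mt a.2.
Proof.
have [fs ss] := poly_comp_basis a.
have := count_mons_full m mt => /(congr1 (fun f => f a)) <-.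
rewrite /Hilb /hilbert_series (Kdim_list fs ss) size_map /count_mons.
by congr Posz; rewrite -[LHS]/(size _) -[in LHS](filter_predT (mons _ _)); congr size;
  apply: eq_filter => u; rewrite asboolT.
Qed.

End PolynomialHilbert.

Lemma hilbert_S (K : fieldType) : Hilb (poly_gmod K 1 1) = quadrant 0.
Proof.
apply/funext => -[x y]; rewrite hilbert_poly /quadrant /=.
have m1 (n : int) : mcount 1 n = (0 <= n)%R%:Z by case: n => k //=; rewrite bin0.
by rewrite !m1; case: (0 <= x); case: (0 <= y).
Qed.

Section BlockModule.
Variables (K : fieldType) (m mt i j : nat).
Local Notation R := {mpoly K[m + mt]}.
Local Notation B := {mpoly K[i + j]}.

(** The images of the variables under the surjection that keeps the first [i] of
    the [X] and the first [j] of the [Y], and sends the other variables to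
    [0]. *)
Definition trunc_var (k : 'I_(m + mt)) : B :=
  match split k with
  | inl k1 => oapp (fun l : 'I_i => 'X_(lshift j l)) 0 (insub (val k1))
  | inr k2 => oapp (fun l : 'I_j => 'X_(rshift i l)) 0 (insub (val k2))
  end.

Definition trunc_poly (p : R) : B := p \mPo [tuple trunc_var k | k < m + mt].

Lemma trunc_polyC c : trunc_poly c%:MP = c%:MP.
Proof. exact: comp_mpolyC. Qed.

Lemma trunc_polyM p q : trunc_poly (p * q) = trunc_poly p * trunc_poly q.
Proof. exact: rmorphM. Qed.

Lemma trunc_polyD p q : trunc_poly (p + q) = trunc_poly p + trunc_poly q.
Proof. exact: rmorphD. Qed.

Lemma trunc_polyX k : trunc_poly 'X_k = trunc_var k.
Proof. by rewrite /trunc_poly comp_mpolyXU -tnth_nth tnth_mktuple. Qed.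

Lemma poly_compM a b (p q : B) : poly_comp a p -> poly_comp b q -> poly_comp (a + b) (p * q).
Proof. exact: (gradingZ (poly_grading K i j)). Qed.

Lemma poly_comp1 : poly_comp 0 (1 : B).
Proof. by rewrite -mpolyC1; apply: poly_compC. Qed.

Lemma poly_comp_trunc_var k : poly_comp (var_deg k) (trunc_var k).
Proof.
have c0 a : poly_comp a (0 : B) by move=> u; rewrite msupp0.
rewrite /trunc_var var_degE; case: splitP => l kl.
  case: insubP => [l' _ _|_] /=; last exact: c0.
  by have := @poly_comp_var K i j (lshift j l'); rewrite var_degE /= ltn_ord.
case: insubP => [l' _ _|_] /=; last exact: c0.
by have := @poly_comp_var K i j (rshift i l'); rewrite var_degE /= ltnNge leq_addr.
Qed.

Lemma mon_deg_sum (u : 'X_{1.. m + mt}) : mon_deg u = \sum_k var_deg k *+ u k.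
Proof.
have sz : size [seq u k | k <- enum 'I_(m + mt)] = (m + mt)%N.
  by rewrite size_map size_enum_ord.
rewrite -{1}[u]mnm_of_val mon_deg_mnm_of // wdegE ?size_var_weights //.
apply: eq_bigr => k _.
rewrite (nth_map k) ?size_enum_ord // nth_ord_enum var_degE nth_cat size_nseq.
case: ltnP => km; rewrite nth_nseq ?km // (_ : (k - m < mt)%N) //.
by rewrite ltn_subLR // ltn_ord.
Qed.

Lemma poly_comp_trunc a (p : R) : poly_comp a p -> poly_comp a (trunc_poly p).
Proof.
move=> pa; rewrite [p]mpolyE /trunc_poly raddf_sum big_seq.
apply: (grading_sumr (poly_grading K i j)) => u up /=.
rewrite comp_mpolyZ comp_mpolyX -(pa u up) mon_deg_sum -mul_mpolyC.
rewrite -[\sum_k _]add0r; apply: poly_compM; first exact: poly_compC.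
elim/big_rec2: _ => [|k q b _ bq]; first exact: poly_comp1.
apply: poly_compM bq; rewrite tnth_mktuple.
elim: (u k) => [|n IH]; first by rewrite expr0 mulr0n; apply: poly_comp1.
by rewrite exprS mulrS; apply: poly_compM IH; apply: poly_comp_trunc_var.
Qed.

Lemma trunc_poly_surj (q : B) : (i <= m)%N -> (j <= mt)%N -> exists p, trunc_poly p = q.
Proof.
move=> im jmt; pose im_ (q : B) := exists p, trunc_poly p = q.
have imM (x y : B) : im_ x -> im_ y -> im_ (x * y).
  by move=> [p <-] [p' <-]; exists (p * p'); rewrite trunc_polyM.
have imC c : im_ c%:MP by exists c%:MP; apply: trunc_polyC.
have imX k : im_ 'X_k.
  case: (split_ordP k) => l ->.
    exists 'X_(lshift mt (widen_ord im l)); rewrite trunc_polyX /trunc_var.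
    rewrite -[lshift _ _]/(unsplit (inl _)) unsplitK /=.
    by rewrite insubT //= => lt; congr 'X_(lshift _ _); apply/val_inj.
  exists 'X_(rshift m (widen_ord jmt l)); rewrite trunc_polyX /trunc_var.
  rewrite -[rshift _ _]/(unsplit (inr _)) unsplitK /=.
  by rewrite insubT //= => lt; congr 'X_(rshift _ _); apply/val_inj.
rewrite [q]mpolyE; apply: (big_ind im_).
- by rewrite -mpolyC0; apply: imC.
- by move=> x y [p <-] [p' <-]; exists (p + p'); rewrite trunc_polyD.
move=> u _; rewrite -mul_mpolyC; apply: (imM); first exact: imC.
have im1 : im_ 1 by rewrite -mpolyC1; apply: imC.
rewrite mpolyXE_id; apply: (big_ind im_ im1 imM) => k _.
by elim: (u k) => [|n IH]; rewrite ?expr0 ?exprS //; apply: (imM).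
Qed.

(** The coefficient of a variable that is kept equals [1]. *)
Lemma trunc_sum_vars_neq0 : (i <= m)%N -> (j <= mt)%N -> (0 < i + j)%N ->
  trunc_poly (\sum_k 'X_k) != 0.
Proof.
move=> im jmt ij.
have cX (x y : 'I_(i + j)) : ('X_x : B)@_(U_(y)%MM) = (x == y)%:R.
  exact: mcoeffXU.
rewrite /trunc_poly raddf_sum big_split_ord /=.
have vl (k : 'I_m) : 'X_(lshift mt k) \mPo [tuple trunc_var k | k < m + mt] =
    oapp (fun l : 'I_i => 'X_(lshift j l)) 0 (insub (val k)) :> B.
  by rewrite [LHS]trunc_polyX /trunc_var -[lshift _ _]/(unsplit (inl _)) unsplitK.
have vr (k : 'I_mt) : 'X_(rshift m k) \mPo [tuple trunc_var k | k < m + mt] =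
    oapp (fun l : 'I_j => 'X_(rshift i l)) 0 (insub (val k)) :> B.
  by rewrite [LHS]trunc_polyX /trunc_var -[rshift _ _]/(unsplit (inr _)) unsplitK.
under eq_bigr do rewrite vl; under [X in _ + X]eq_bigr do rewrite vr.
apply/eqP => s0; have [i0|i0] := posnP i.
  have j0 : (0 < j)%N by rewrite i0 in ij.
  have := congr1 (mcoeff U_(rshift i (Ordinal j0))%MM) s0.
  rewrite mcoeffD !raddf_sum /= mcoeff0 big1 ?add0r => [|k _]; last first.
    by case: insubP => [l _ _|_] /=; rewrite ?mcoeff0 // cX eq_lrshift.
  rewrite (bigD1 (widen_ord jmt (Ordinal j0))) //= big1 ?addr0 => [|k k0].
    by rewrite insubT /= cX eq_rshift -val_eqE /= => /eqP; rewrite oner_eq0.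
  case: insubP => [l _ lk|_] /=; rewrite ?mcoeff0 // cX eq_rshift.
  by case: eqP => // l0; case/eqP: k0; apply/val_inj; rewrite /= -lk l0.
have := congr1 (mcoeff U_(lshift j (Ordinal i0))%MM) s0.
rewrite mcoeffD !raddf_sum /= mcoeff0 [X in _ + X]big1 ?addr0 => [|k _]; last first.
  by case: insubP => [l _ _|_] /=; rewrite ?mcoeff0 // cX eq_rlshift.
rewrite (bigD1 (widen_ord im (Ordinal i0))) //= big1 ?addr0 => [|k k0].
  by rewrite insubT /= cX eq_lshift -val_eqE /= => /eqP; rewrite oner_eq0.
case: insubP => [l _ lk|_] /=; rewrite ?mcoeff0 // cX eq_lshift.
by case: eqP => // l0; case/eqP: k0; apply/val_inj; rewrite /= -lk l0.
Qed.

(** The quotient of [R] by all but the first [i] and first [j] variables, taken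
    as the polynomial ring in the remaining ones with [R] acting through
    [trunc_poly]. *)
Definition block_mod : Type := B.
HB.instance Definition _ := GRing.Zmodule.on block_mod.
Definition block_scale (p : R) (x : block_mod) : block_mod := trunc_poly p * (x : B).

Fact block_scaleA p q x : block_scale p (block_scale q x) = block_scale (p * q) x.
Proof. by rewrite /block_scale trunc_polyM mulrA. Qed.
Fact block_scale1 : left_id 1 block_scale.
Proof. by move=> x; rewrite /block_scale -mpolyC1 trunc_polyC mpolyC1 mul1r. Qed.
Fact block_scaleDr : right_distributive block_scale +%R.
Proof. by move=> p x y; rewrite /block_scale mulrDr. Qed.
Fact block_scaleDl x : {morph block_scale^~ x : p q / p + q}.
Proof. by move=> p q; rewrite /block_scale trunc_polyD mulrDl. Qed.

HB.instance Definition _ := GRing.Zmodule_isLmodule.Build R block_mod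
  block_scaleA block_scale1 block_scaleDr block_scaleDl.

Variable c : int * int.

Definition block_comp (a : int * int) : set block_mod := poly_comp (a - c).

Lemma block_grading : @grading K m mt block_mod block_comp.
Proof.
have gB := poly_grading K i j; split.
- by move=> a; apply: (grading0 gB).
- by move=> a x y; apply: (gradingB gB).
- move=> a b p x pa xb; rewrite /block_comp -addrA; apply: poly_compM => //.
  exact: poly_comp_trunc.
- move=> x; have [s [f [us Gf xE]]] := grading_sum gB x.
  exists [seq a + c | a <- s], (fun a => f (a - c)); split.
  + by rewrite map_inj_uniq //; apply: addIr.
  + by move=> a; apply: Gf.
  + by rewrite big_map xE; apply: eq_bigr => a _; rewrite addrK.
move=> s f us Gf f0 a as_.
have us' : uniq [seq a - c | a <- s] by rewrite map_inj_uniq //; apply: addIr.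
have := grading_free gB us' (f := fun a => f (a + c)).
rewrite -[a](subrK c); apply.
- by move=> b; have := Gf (b + c); rewrite /block_comp addrK.
- by rewrite big_map -[RHS]f0; apply: eq_bigr => b _; rewrite subrK.
by apply/mapP; exists a.
Qed.

Definition block_gmod : gmod K m mt := GMod block_grading.

Lemma block_fin_gen : (i <= m)%N -> (j <= mt)%N -> fin_gen block_gmod.
Proof.
move=> im jmt; exists [:: (1 : B) : block_mod].
apply/seteqP; split=> // q _; have [p pq] := trunc_poly_surj q im jmt.
exists (fun=> p); rewrite big_ord1 /= -pq.
by rewrite -[LHS]mulr1.
Qed.

Lemma block_Hilb : Hilb block_gmod =
  fun a : int * int => mcount i (a.1 - c.1) * mcount j (a.2 - c.2).
Proof.
apply/funext => a; rewrite -[RHS]/(mcount i (a - c).1 * mcount j (a - c).2).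
rewrite -(hilbert_poly K) /Hilb /hilbert_series /=; congr Posz.
congr (xget _ _); apply/funext => d; apply/propext.
have e (b : 'I_d -> B) (x : 'I_d -> K) :
    \sum_(k < d) (x k)%:MP *: (b k : block_mod) = \sum_(k < d) (x k)%:MP *: (b k : B^o) :> B.
  by apply: eq_bigr => k _; rewrite -[LHS]/(trunc_poly _ * _) trunc_polyC.
split=> -[b [bV bf]]; exists b; split.
- by rewrite [LHS]bV; apply/seteqP; split=> x [y ->]; exists y; rewrite e.
- by move=> x x0; apply: bf; rewrite [LHS]e.
- by rewrite [LHS]bV; apply/seteqP; split=> x [y ->]; exists y; rewrite -e.
- by move=> x x0; apply: bf; rewrite -[LHS]e.
Qed.

Lemma block_regular : (i <= m)%N -> (j <= mt)%N -> (0 < i + j)%N ->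
  forall z : block_gmod, (\sum_k 'X_k : R) *: z = 0 -> z = 0.
Proof.
move=> im jmt ij z; rewrite -[LHS]/(trunc_poly _ * (z : B)) => /eqP.
by rewrite mulf_eq0 (negbTE (trunc_sum_vars_neq0 im jmt ij)) => /eqP.
Qed.

End BlockModule.

Section ProductModule.
Variables (K : fieldType) (m mt : nat) (N1 N2 : gmod K m mt).
Local Notation R := {mpoly K[m + mt]}.
Local Notation M := (N1 * N2)%type.

Definition prod_comp (a : int * int) : set M :=
  [set x | @gcomp _ _ _ N1 a x.1 /\ @gcomp _ _ _ N2 a x.2].

Let fst_sum (I : Type) (r : seq I) (F : I -> M) : (\sum_(i <- r) F i).1 = \sum_(i <- r) (F i).1.
Proof. exact: (big_morph fst). Qed.
Let snd_sum (I : Type) (r : seq I) (F : I -> M) : (\sum_(i <- r) F i).2 = \sum_(i <- r) (F i).2.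
Proof. exact: (big_morph snd). Qed.

Lemma prod_grading : @grading K m mt M prod_comp.
Proof.
have [g1 g2] := (gcompP N1, gcompP N2); split.
- by move=> a; split; [apply: (grading0 g1)|apply: (grading0 g2)].
- by move=> a x y [? ?] [? ?]; split; [apply: (gradingB g1)|apply: (gradingB g2)].
- by move=> a b p x pa [? ?]; split; [apply: (gradingZ g1)|apply: (gradingZ g2)].
- move=> [x y]; have [s [us _ s0 xE]] := hcompP g1 x.
  have [t [ut _ t0 yE]] := hcompP g2 y.
  exists (undup (s ++ t)), (fun a => (hcomp g1 a x, hcomp g2 a y)); split.
  + exact: undup_uniq.
  + by move=> a; split; apply: hcomp_in.
  have uu : uniq (undup (s ++ t)) by exact: undup_uniq.
  rewrite [RHS]surjective_pairing fst_sum snd_sum /=.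
  congr pair.
    rewrite (big_supp us (r := undup (s ++ t))) // => a as_.
    by rewrite mem_undup mem_cat as_.
  rewrite (big_supp ut (r := undup (s ++ t))) // => a at_.
  by rewrite mem_undup mem_cat at_ orbT.
move=> s f us Gf f0 a as_; rewrite [LHS]surjective_pairing.
have f1 : \sum_(b <- s) (f b).1 = 0 by rewrite -fst_sum f0.
have f2 : \sum_(b <- s) (f b).2 = 0 by rewrite -snd_sum f0.
rewrite (grading_free g1 us (fun b => (Gf b).1) f1 as_).
by rewrite (grading_free g2 us (fun b => (Gf b).2) f2 as_).
Qed.

Definition prod_gmod : gmod K m mt := GMod prod_grading.

Lemma prod_fin_gen : fin_gen N1 -> fin_gen N2 -> fin_gen prod_gmod.
Proof.
move=> [xs xsE] [ys ysE].
exists ([seq (x, 0) : M | x <- xs] ++ [seq (0, y) : M | y <- ys]).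
apply/seteqP; split=> // -[x y] _.
have [p xE] : submod_span xs x by rewrite xsE.
have [q yE] : submod_span ys y by rewrite ysE.
pose zs := [seq (x, 0) : M | x <- xs] ++ [seq (0, y) : M | y <- ys].
have sz : size zs = (size xs + size ys)%N by rewrite size_cat !size_map.
exists (fun i => match split (cast_ord sz i) with inl k => p k | inr k => q k end).
rewrite (reindex (cast_ord (esym sz))) /=; last first.
  by exists (cast_ord sz) => i _; rewrite ?cast_ordK ?cast_ordKV.
rewrite big_split_ord /= [RHS]surjective_pairing.
have e1 (i : 'I_(size xs)) : match split (cast_ord sz (cast_ord (esym sz) (lshift (size ys) i)))
    with inl k => p k | inr k => q k end *: zs`_i = (p i *: xs`_i, 0).
  rewrite cast_ordKV -[lshift _ _]/(unsplit (inl _)) unsplitK.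
  rewrite /zs nth_cat size_map ltn_ord (nth_map 0) //.
  by congr pair; rewrite /= ?scaler0.
have e2 (i : 'I_(size ys)) : match split (cast_ord sz (cast_ord (esym sz) (rshift (size xs) i)))
    with inl k => p k | inr k => q k end *: zs`_(size xs + i) = (0, q i *: ys`_i).
  rewrite cast_ordKV -[rshift _ _]/(unsplit (inr _)) unsplitK.
  rewrite /zs nth_cat size_map ltnNge leq_addr /= addKn (nth_map 0) //.
  by congr pair; rewrite /= ?scaler0.
rewrite (eq_bigr _ (fun i _ => e1 i)) [X in _ + X](eq_bigr _ (fun i _ => e2 i)).
rewrite -surjective_pairing xE yE [RHS]surjective_pairing /=.
rewrite !fst_sum !snd_sum /= !big1_eq addr0 add0r //.
Qed.

Lemma prod_Hilb : fin_gen N1 -> fin_gen N2 ->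
  Hilb prod_gmod = fun a => Hilb N1 a + Hilb N2 a.
Proof.
move=> fg1 fg2; apply/funext => a; rewrite /Hilb /hilbert_series -PoszD; congr Posz.
have [s [fs sG ->]] := Kdim_basis (grading_subspace (gcompP N1) a)
  (fin_gen_fin_dim (gcompP N1) fg1 a).
have [t [ft tG ->]] := Kdim_basis (grading_subspace (gcompP N2) a)
  (fin_gen_fin_dim (gcompP N2) fg2 a).
pose s' : seq (resK M) := [seq (x, 0) : M | x <- s].
pose t' : seq (resK M) := [seq (0, y) : M | y <- t].
have s'P (u : seq (resK N1)) z : lspan ([seq (x, 0) : M | x <- u] : seq (resK M)) z <->
    lspan u (z : M).1 /\ (z : M).2 = 0.
  elim: u z => [|x u IH] z /=.
    split=> [-> //|[e1 e2]]; rewrite [LHS](surjective_pairing (z : M)).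
    by congr pair.
  split=> [[c [w [/IH[w1 w2] ->]]]|[[c [w [uw z1]] z2]]].
    split; first by exists c, (w : M).1.
    by rewrite /= w2 scaler0 addr0.
  exists c, ((w, 0) : M); split; first exact/IH.
  rewrite [LHS](surjective_pairing (z : M)); congr pair; first exact: z1.
  by rewrite z2 /= scaler0 addr0.
have t'P (u : seq (resK N2)) z : lspan ([seq (0, x) : M | x <- u] : seq (resK M)) z <->
    (z : M).1 = 0 /\ lspan u (z : M).2.
  elim: u z => [|x u IH] z /=.
    split=> [-> //|[e1 e2]]; rewrite [LHS](surjective_pairing (z : M)).
    by congr pair.
  split=> [[c [w [/IH[w1 w2] ->]]]|[z1 [c [w [uw z2]]]]].
    split; last by exists c, (w : M).2.
    by rewrite /= w1 scaler0 addr0.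
  exists c, ((0, w) : M); split; first exact/IH.
  rewrite [LHS](surjective_pairing (z : M)); congr pair; last exact: z2.
  by rewrite z1 /= scaler0 addr0.
have st_size : size (s' ++ t') = (size s + size t)%N by rewrite size_cat !size_map.
rewrite -st_size; apply: Kdim_list.
  have {sG} : lfree s by [].
  rewrite /s'; elim: s {st_size s' fs} => [_|x s IH] /=.
    rewrite /t'; elim: t {t' tG} ft => //= y t IH [yt ft]; split; last exact: IH.
    by move/t'P => -[_ /=].
  move=> [xs fs]; split; last exact: IH.
  move/lspan_cat => [u [v [/s'P[u1 u2] /t'P[v1 v2] xE]]]; apply: xs.
  by have [-> _] : x = (u : M).1 /\ True by split=> //;
    rewrite -[LHS]/((x, 0) : M).1 xE /= v1 addr0.
apply/seteqP; split=> z.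
  move/lspan_cat => [u [v [/s'P[u1 u2] /t'P[v1 v2] ->]]].
  rewrite sG in u1; rewrite tG in v2; split => /=.
    by rewrite v1 addr0.
  by rewrite u2 add0r.
move=> [z1 z2]; apply/lspan_cat; exists (((z : M).1, 0) : M), ((0, (z : M).2) : M); split.
- by apply/s'P; rewrite sG.
- by apply/t'P; rewrite tG.
rewrite [LHS](surjective_pairing (z : M)); congr pair; by rewrite /= ?addr0 ?add0r.
Qed.

End ProductModule.

Section ZeroModule.
Variables (K : fieldType) (m mt : nat).
Local Notation M := 'rV[{mpoly K[m + mt]}]_0.

Lemma zero_grading : @grading K m mt M (fun _ => setT).
Proof.
have M0 (x y : M) : x = y by apply/rowP => -[].
by split=> // x; exists [::], (fun=> 0); split.
Qed.

Definition zero_gmod : gmod K m mt := GMod zero_grading.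

Lemma zero_fin_gen : fin_gen zero_gmod.
Proof.
exists [::]; apply/seteqP; split=> // x _; exists (fun=> 0).
by apply/rowP => -[].
Qed.

Lemma zero_Hilb : Hilb zero_gmod = fun=> 0.
Proof.
apply/funext => a; rewrite /Hilb /hilbert_series /=; congr Posz.
apply: (@Kdim_list K m mt M [::]) => //.
by apply/seteqP; split=> // x _; apply/rowP => -[].
Qed.

End ZeroModule.

(** The sum of all variables is used because it is regular on every summand at
    once, whichever variables that summand retains. *)
Lemma box_sum_realization (K : fieldType) (m mt : nat) (H : int * int -> int) :
    box_sum (box_pos m mt) H ->
  exists N : gmod K m mt, [/\ fin_gen N, Hilb N = H &
    forall z : N, (\sum_k 'X_k : {mpoly K[m + mt]}) *: z = 0 -> z = 0].
Proof.
elim=> [|f g [i [j [c1 [c2 [/andP[/andP[im jmt] ij] ->]]]]] _ [N [fgN HN rN]]].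
  exists (zero_gmod K m mt); split; [exact: zero_fin_gen|exact: zero_Hilb|].
  by move=> z _; apply/rowP => -[].
pose B := block_gmod K m mt i j (c1, c2).
have fgB : fin_gen B by exact: block_fin_gen.
exists (prod_gmod B N); split; first exact: prod_fin_gen.
  by rewrite prod_Hilb // block_Hilb HN.
move=> [x y] xy0; congr pair; last exact: rN (congr1 snd xy0).
exact: (block_regular im jmt ij (congr1 fst xy0)).
Qed.

Lemma depth_of_box_sum (K : fieldType) (m mt : nat) (H : int * int -> int) :
  box_sum (box_pos m mt) H -> (EFin (0 : int) < hilbert_depth K m mt H)%O.
Proof.
move=> /(box_sum_realization K)[N [fgN HN rN]].
have d0 : (EFin (0 : int) < depth N)%O.
  apply: (@depth_gt0 K m mt N (\sum_k 'X_k)) => //.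
  have sz : size (all_vars K m mt) = (m + mt)%N by rewrite size_map size_enum_ord.
  exists (fun=> 1); rewrite (reindex (cast_ord (esym sz))) /=; last first.
    by exists (cast_ord sz) => k _; rewrite ?cast_ordK ?cast_ordKV.
  apply: eq_bigr => k _; rewrite /all_vars (nth_map k) ?size_enum_ord // nth_ord_enum.
  by rewrite -[LHS]mulr1.
apply: lt_le_trans d0 (supremum_ge _); by exists N.
Qed.

(** * Fractional monomial ideals as graded modules *)

Section LaurentMonomials.
Variable K : fieldType.
Local Notation S := {mpoly K[1 + 1]}.
Local Notation lm := (laurent_monomial K).

Lemma tofrac_var_neq0 i : tofrac ('X_i : S) != 0.
Proof.
rewrite tofrac_eq0; apply/eqP => /(congr1 (mcoeff U_(i))).
by rewrite mcoeffXU eqxx mcoeff0 => /eqP; rewrite oner_eq0.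
Qed.

Lemma laurent_monomialD a b : lm (a + b) = lm a * lm b.
Proof.
by rewrite /laurent_monomial !expfzDr ?tofrac_var_neq0 // mulrACA.
Qed.

Lemma laurent_monomial_neq0 a : lm a != 0.
Proof. by rewrite mulf_neq0 // expfz_neq0 // tofrac_var_neq0. Qed.

Lemma mon_deg11 (u : 'X_{1.. 1 + 1}) : mon_deg u = ((u (lshift 1 ord0))%:Z, (u (rshift 1 ord0))%:Z).
Proof. by rewrite /mon_deg !big_ord1. Qed.

Lemma laurent_monomialE (u : 'X_{1.. 1 + 1}) : lm (mon_deg u) = tofrac ('X_[u] : S).
Proof.
rewrite mpolyXE_id big_split_ord !big_ord1 mon_deg11 /laurent_monomial /=.
by rewrite rmorphM !rmorphXn.
Qed.

Lemma fracSZ (p : S) (x : fracS K) : p *: x = tofrac p * x.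
Proof. by []. Qed.

Lemma mon_deg11_surj (a : int * int) : 0 <= a.1 -> 0 <= a.2 ->
  exists u : 'X_{1.. 1 + 1}, mon_deg u = a.
Proof.
case: a => [x y] /= x0 y0; exists (mnm_of 1 1 [:: `|x|%N; `|y|%N]).
by rewrite mon_deg11 !mnmE /= !gez0_abs.
Qed.

(** After multiplication by a high power of [XY] all the monomials in the
    relation become polynomials, where coefficients can be compared. *)
Lemma laurent_free (s : seq (int * int)) (f : int * int -> fracS K) : uniq s ->
  (forall a, laurent_comp a (f a)) -> \sum_(a <- s) f a = 0 ->
  forall a, a \in s -> f a = 0.
Proof.
move=> us Cf f0; have [c fc] := choice Cf.
(* an exponent large enough to clear all negative powers *)
pose N := (\sum_(a <- s) (`|a.1| + `|a.2|))%N.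
have le_N a : a \in s -> (`|a.1| + `|a.2| <= N)%N.
  by move=> as_; rewrite /N (big_rem a) //= leq_addr.
have /choice[u uP] (a : int * int) : exists u : 'X_{1.. 1 + 1},
    a \in s -> mon_deg u = a + (N%:Z, N%:Z).
  case: (boolP (a \in s)) => [as_|_]; last by exists 0%MM.
  have [||u ue] := mon_deg11_surj (a := a + (N%:Z, N%:Z)); last by exists u.
    by have := le_N a as_; move=> /=; lia.
  by have := le_N a as_; move=> /=; lia.
have : \sum_(a <- s) c a *: 'X_[u a] = 0 :> S.
  apply/eqP; rewrite -tofrac_eq0 raddf_sum /=; apply/eqP.
  transitivity ((\sum_(a <- s) f a) * lm (N%:Z, N%:Z)); last by rewrite f0 mul0r.
  rewrite mulr_suml; apply: eq_big_seq => a as_; rewrite fc fracSZ -mulrA -laurent_monomialD -uP //.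
  by rewrite laurent_monomialE -rmorphM mul_mpolyC.
move=> p0 a as_; have := congr1 (mcoeff (u a)) p0.
rewrite mcoeff0 raddf_sum (bigD1_seq a) //= mcoeffZ mcoeffX eqxx mulr1.
rewrite big1_seq ?addr0 => [ca|b /andP[ba bs]].
  by rewrite fc ca mpolyC0 scale0r.
rewrite mcoeffZ mcoeffX; case: eqP => [ub|_]; last by rewrite mulr0.
have := congr1 (@mon_deg 1 1) ub; rewrite !uP // => /addIr ab.
by rewrite ab eqxx in ba.
Qed.

Lemma laurent_compD a (x y : fracS K) :
  laurent_comp a x -> laurent_comp a y -> laurent_comp a (x + y).
Proof. by move=> [c ->] [d ->]; exists (c + d); rewrite mpolyCD scalerDl. Qed.

Lemma laurent_comp0 a : laurent_comp a (0 : fracS K).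
Proof. by exists 0; rewrite mpolyC0 scale0r. Qed.

Lemma laurent_compN a (x : fracS K) : laurent_comp a x -> laurent_comp a (- x).
Proof. by move=> [c ->]; exists (- c); rewrite mpolyCN scaleNr. Qed.

Lemma laurent_compX u a (c : K) (x : fracS K) :
  laurent_comp a x -> laurent_comp (mon_deg u + a) ((c *: 'X_[u] : S) *: x).
Proof.
move=> [d ->]; exists (c * d); rewrite !fracSZ laurent_monomialD laurent_monomialE.
by rewrite -mul_mpolyC mpolyCM !rmorphM /= mulrACA.
Qed.

Lemma laurent_compZ a b (p : S) (x : fracS K) :
  poly_comp a p -> laurent_comp b x -> laurent_comp (a + b) (p *: x).
Proof.
move=> pa xb; rewrite [p]mpolyE scaler_suml big_seq.
elim/big_ind: _ => [|y z|u up]; [exact: laurent_comp0|exact: laurent_compD|].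
by rewrite -(pa u up); apply: laurent_compX.
Qed.

End LaurentMonomials.

Lemma submod_span_closed (K : fieldType) (n nt : nat)
    (M : lmodType {mpoly K[n + nt]}) (xs : seq M) (p : {mpoly K[n + nt]}) (x y : M) :
  submod_span xs x -> submod_span xs y -> submod_span xs (p *: x + y).
Proof.
move=> [c ->] [d ->]; exists (fun i => p * c i + d i).
by rewrite scaler_sumr -big_split; apply: eq_bigr => i _; rewrite scalerDl scalerA.
Qed.

Lemma submod_span0 (K : fieldType) (n nt : nat) (M : lmodType {mpoly K[n + nt]})
    (xs : seq M) :
  submod_span xs 0.
Proof. by exists (fun=> 0); rewrite big1 // => i _; rewrite scale0r. Qed.

Lemma submod_span_mem (K : fieldType) (n nt : nat) (M : lmodType {mpoly K[n + nt]})
    (xs : seq M) x :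
  x \in xs -> submod_span xs x.
Proof.
move=> xxs; have ix : (index x xs < size xs)%N by rewrite index_mem.
exists (fun i => (i == Ordinal ix)%:R); rewrite (bigD1 (Ordinal ix)) //= eqxx scale1r.
by rewrite nth_index // big1 ?addr0 // => i /negbTE ->; rewrite scale0r.
Qed.

Section IdealModule.
Variables (K : fieldType) (I : set (fracS K)) (hI : fractional_monomial_ideal I).
Local Notation S := {mpoly K[1 + 1]}.

Definition in_ideal of fractional_monomial_ideal I : {pred fracS K} :=
  fun x => `[< I x >].

Fact in_ideal_closed : GRing.submod_closed (in_ideal hI).
Proof.
have [[xs IE] _ _] := hI; split; first by apply/asboolP; rewrite IE; apply: submod_span0.
move=> p x y /asboolP Ix /asboolP Iy; apply/asboolP; move: Ix Iy.
by rewrite IE; apply: submod_span_closed.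
Qed.

HB.instance Definition _ :=
  GRing.isSubmodClosed.Build S (fracS K) (in_ideal hI) in_ideal_closed.

(** A record mentioning the proof [hI], so that the module structure can be found
    from the type alone. *)
Record ideal_mod := IdealMod { ideal_val : fracS K; _ : ideal_val \in in_ideal hI }.
HB.instance Definition _ := [isSub for ideal_val].
HB.instance Definition _ := [Choice of ideal_mod by <:].
HB.instance Definition _ := [SubChoice_isSubLmodule of ideal_mod by <:].


Lemma ideal_valP (x : ideal_mod) : I (ideal_val x).
Proof. by apply/asboolP; case: x. Qed.

Definition to_ideal (x : fracS K) (Ix : I x) : ideal_mod :=
  @IdealMod x (asboolT Ix : x \in in_ideal hI).

Lemma ideal_val_inj : injective ideal_val.
Proof. exact: val_inj. Qed.

Lemma ideal_valZ (p : S) (x : ideal_mod) : ideal_val (p *: x) = p *: ideal_val x.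
Proof. by []. Qed.

Lemma ideal_val_sum (T : Type) (r : seq T) (F : T -> ideal_mod) :
  ideal_val (\sum_(i <- r) F i) = \sum_(i <- r) ideal_val (F i).
Proof. exact: (raddf_sum (val : ideal_mod -> fracS K)). Qed.

Lemma ideal_val0 : ideal_val 0 = 0.
Proof. exact: (raddf0 (val : ideal_mod -> fracS K)). Qed.

Lemma ideal_valD (x y : ideal_mod) : ideal_val (x + y) = ideal_val x + ideal_val y.
Proof. exact: (raddfD (val : ideal_mod -> fracS K)). Qed.

Definition ideal_comp (a : int * int) : set ideal_mod :=
  [set x | laurent_comp a (ideal_val x)].

Lemma ideal_grading : @grading K 1 1 ideal_mod ideal_comp.
Proof.
have [_ _ hom] := hI; split.
- by move=> a; apply: laurent_comp0.
- by move=> a x y ax ay; apply: (laurent_compD ax (laurent_compN ay)).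
- by move=> a b p x pa xb; apply: (laurent_compZ pa xb).
- move=> x; have [s [f [us If xE]]] := hom _ (ideal_valP x).
  exists s, (fun a => to_ideal (If a).1); split=> // [a|]; first exact: (If a).2.
  by apply: ideal_val_inj; rewrite ideal_val_sum.
move=> s f us Cf f0 a as_; apply: ideal_val_inj; rewrite ideal_val0.
apply: (laurent_free us (f := fun a => ideal_val (f a))) => //.
by rewrite -ideal_val_sum f0 ideal_val0.
Qed.

Definition ideal_gmod : gmod K 1 1 := GMod ideal_grading.

Lemma ideal_fin_gen : fin_gen ideal_gmod.
Proof.
have [[xs IE] _ _] := hI.
have xsI x : x \in xs -> I x by move=> xxs; rewrite IE; apply: submod_span_mem.
have [ys ysE] : exists ys : seq ideal_mod, map ideal_val ys = xs.
  elim: xs {IE} xsI => [|x xs IH] xsI; first by exists [::].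
  have [|ys <-] := IH; first by move=> y yxs; apply: xsI; rewrite inE yxs orbT.
  by exists (to_ideal (xsI x (mem_head _ _)) :: ys).
exists ys; apply/seteqP; split=> // x _.
have := ideal_valP x; rewrite {1}IE -ysE => -[c xE].
have sz : size (map ideal_val ys) = size ys by rewrite size_map.
exists (fun i => c (cast_ord (esym sz) i)); apply: ideal_val_inj.
rewrite xE ideal_val_sum (reindex (cast_ord (esym sz))) /=; last first.
  by exists (cast_ord sz) => i _; rewrite ?cast_ordK ?cast_ordKV.
by apply: eq_bigr => i _; rewrite ?ideal_valZ (nth_map 0).
Qed.

Lemma ideal_torsionfree : torsionfree ideal_gmod.
Proof.
move=> p x /(congr1 ideal_val); rewrite ideal_valZ ideal_val0 fracSZ => /eqP.
rewrite mulf_eq0 tofrac_eq0 => /orP[/eqP ->|/eqP x0]; [by left|right].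
by apply: ideal_val_inj; rewrite x0 ideal_val0.
Qed.

Lemma ideal_Hilb : Hilb ideal_gmod = Hilb_ideal I.
Proof.
apply/funext => a; rewrite /Hilb /Hilb_ideal /hilbert_series; congr Posz.
congr (xget _ _); apply/funext => d; apply/propext; split.
  move=> [b [bV bf]]; exists (fun i => ideal_val (b i)).
  have e c : \sum_(i < d) (c i)%:MP *: ideal_val (b i) =
      ideal_val (\sum_(i < d) (c i)%:MP *: b i).
    by rewrite ideal_val_sum; apply: eq_bigr => i _; rewrite ideal_valZ.
  split=> [|c]; last by rewrite e -ideal_val0 => /ideal_val_inj/bf.
  apply/seteqP; split=> [x [Ix ax]|x [c ->]].
    have : @gcomp _ _ _ ideal_gmod a (to_ideal Ix) by [].
    by rewrite bV => -[c xE]; exists c; rewrite e -xE.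
  rewrite e; split; first exact: ideal_valP.
  have : @gcomp _ _ _ ideal_gmod a (\sum_(i < d) (c i)%:MP *: b i) by rewrite bV; exists c.
  exact.
move=> [b [bV bf]].
have Ib i : (I `&` laurent_comp a) (b i).
  rewrite bV; exists (fun j => (j == i)%:R); rewrite (bigD1 i) //= eqxx mpolyC1 scale1r.
  by rewrite big1 ?addr0 // => j /negbTE ->; rewrite mpolyC0 scale0r.
exists (fun i => to_ideal (Ib i).1).
have e c : ideal_val (\sum_(i < d) (c i)%:MP *: to_ideal (Ib i).1) =
    \sum_(i < d) (c i)%:MP *: b i.
  by rewrite ideal_val_sum; apply: eq_bigr => i _; rewrite ideal_valZ.
split=> [|c /(congr1 ideal_val)]; last by rewrite e ideal_val0 => /bf.
apply/seteqP; split=> [x ax|x [c ->]].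
  have : (I `&` laurent_comp a) (ideal_val x) by split; [exact: ideal_valP|exact: ax].
  by rewrite bV => -[c xE]; exists c; apply: ideal_val_inj; rewrite e.
rewrite /= /ideal_comp /= e.
have : (I `&` laurent_comp a) (\sum_(i < d) (c i)%:MP *: b i) by rewrite bV; exists c.
by case.
Qed.

Lemma laurent_poly_denominator (x : fracS K) : laurent_poly x ->
  exists (u : 'X_{1.. 1 + 1}) (p : S), 'X_[u] *: x = tofrac p.
Proof.
case=> s [f [_ Cf ->]]; elim: s => [|a s [u [p up]]].
  by exists 0%MM, 0; rewrite big_nil scaler0 tofrac0.
have [c ca] := Cf a.
pose b : int * int := (`|a.1|, `|a.2|).
have [||v va] := @mon_deg11_surj b => /=; try by lia.
have [||w wa] := @mon_deg11_surj (a + b) => /=; try by lia.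
exists (u + v)%MM, ('X_[v] * p + 'X_[u] * (c%:MP * 'X_[w])).
rewrite big_cons scalerDr mpolyXD rmorphD [X in _ = X]addrC; congr (_ + _).
  have e : tofrac ('X_[v] : S) * laurent_monomial K a = tofrac ('X_[w] : S).
    by rewrite -!laurent_monomialE -laurent_monomialD wa addrC va.
  by rewrite ca !fracSZ !rmorphM /= -e -mulrA; congr (_ * _); rewrite mulrCA.
by rewrite mulrC -scalerA up fracSZ -rmorphM.
Qed.

(** Two elements [x], [y] of the ideal satisfy [(q X^u) x = (p X^v) y], where
    [X^u x = p] and [X^v y = q] are polynomials. *)
Lemma ideal_rank1 : (exists2 x, I x & x != 0) -> has_rank ideal_gmod 1.
Proof.
move=> [x0 Ix0 x0n0]; split.
  exists [:: to_ideal Ix0] => // c; rewrite big_ord1 /= => /ideal_torsionfree[c0 i|e].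
    by rewrite (ord1 i).
  by move/(congr1 ideal_val): e; rewrite ideal_val0 /= => /eqP; rewrite (negbTE x0n0).
move=> [|x [|y xs]] // indep; exfalso.
have [_ lp _] := hI.
have [u [p up]] := laurent_poly_denominator (lp _ (ideal_valP x)).
have [v [q vq]] := laurent_poly_denominator (lp _ (ideal_valP y)).
pose c (i : 'I_(size [:: x, y & xs])) : S :=
  if val i == 0%N then q * 'X_[u] else if val i == 1%N then - (p * 'X_[v]) else 0.
have c0 : \sum_(i < size [:: x, y & xs]) c i *: [:: x, y & xs]`_i = 0.
  rewrite !big_ord_recl big1 ?addr0 => [|i _]; last by rewrite /c /= scale0r.
  rewrite /c /=; apply: ideal_val_inj; rewrite ideal_valD !ideal_valZ ideal_val0.
  by rewrite scaleNr -!scalerA up vq !fracSZ mulrC subrr.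
have q0 : q = 0.
  have := indep c c0 (Ordinal (isT : (0 < (size xs).+2)%N)); rewrite /c /= => /eqP.
  rewrite mulf_eq0 => /orP[/eqP //|/eqP /(congr1 (mcoeff u))].
  by rewrite mcoeffX eqxx mcoeff0 => /eqP; rewrite oner_eq0.
have y0 : y = 0.
  have [e|//] : ('X_[v] : S) = 0 \/ y = 0.
    by apply: ideal_torsionfree; apply: ideal_val_inj;
      rewrite ideal_valZ vq q0 tofrac0 ideal_val0.
  by have := congr1 (mcoeff v) e; rewrite mcoeffX eqxx mcoeff0 => /eqP; rewrite oner_eq0.
(* y = 0 leaves the relation 1 y = 0 *)
pose d (i : 'I_(size [:: x, y & xs])) : S := if val i == 1%N then 1 else 0.
have d0 : \sum_(i < size [:: x, y & xs]) d i *: [:: x, y & xs]`_i = 0.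
  rewrite !big_ord_recl big1 ?addr0 => [|i _]; last by rewrite /d /= scale0r.
  by rewrite /d /= scale0r y0 scaler0 addr0.
have := indep d d0 (Ordinal (isT : (1 < (size xs).+2)%N)); rewrite /d /= => /eqP.
by rewrite oner_eq0.
Qed.

End IdealModule.

(** * Ideals of staircases *)

Section MonomialIdeal.
Variables (K : fieldType) (gs : seq (int * int)).
Local Notation S := {mpoly K[1 + 1]}.
Local Notation lm := (laurent_monomial K).

Definition above (a : int * int) : bool := has (fun g => (g.1 <= a.1) && (g.2 <= a.2)) gs.

Definition monomial_ideal : set (fracS K) := submod_span [seq lm g | g <- gs].

Lemma monomial_ideal_comp a x : above a -> laurent_comp a x -> monomial_ideal x.
Proof.
move=> /hasP[g ggs /andP[g1 g2]] [c ->].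
have [||u ua] := @mon_deg11_surj (a - g); rewrite /= ?subr_ge0 //.
have -> : c%:MP *: lm a = (c%:MP * 'X_[u] : S) *: lm g + 0.
  by rewrite addr0 !fracSZ rmorphM /= -mulrA -laurent_monomialE ua -laurent_monomialD subrK.
apply: submod_span_closed; last exact: submod_span0.
by apply: submod_span_mem; apply: map_f.
Qed.

(** Every term of a multiple of a generator lies above that generator, and this
    is preserved when terms of equal degree are collected. *)
Lemma monomial_ideal_decomp x : monomial_ideal x ->
  exists (s : seq (int * int)) (f : int * int -> fracS K),
    [/\ uniq s, all above s, forall a, laurent_comp a (f a),
        forall a, a \notin s -> f a = 0 & x = \sum_(a <- s) f a].
Proof.
pose dec x := exists (s : seq (int * int)) (f : int * int -> fracS K),
    [/\ uniq s, all above s, forall a, laurent_comp a (f a),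
        forall a, a \notin s -> f a = 0 & x = \sum_(a <- s) f a].
have dec0 : dec 0.
  exists [::], (fun=> 0); split=> //; last by rewrite big_nil.
  by move=> a; apply: laurent_comp0.
have decD y z : dec y -> dec z -> dec (y + z).
  move=> [s [f [us ups Cf f0 ->]]] [t [g [ut upt Cg g0 ->]]].
  have uu : uniq (undup (s ++ t)) by exact: undup_uniq.
  exists (undup (s ++ t)), (fun a => f a + g a); split=> //.
  - apply/allP => a; rewrite mem_undup mem_cat => /orP[].
      by move/allP: ups; apply.
    by move/allP: upt; apply.
  - by move=> a; apply: laurent_compD.
  - by move=> a; rewrite mem_undup mem_cat negb_or => /andP[/f0 -> /g0 ->]; rewrite addr0.
  rewrite big_split /= (big_supp us (r := undup (s ++ t))) //; last first.
    by move=> a as_; rewrite mem_undup mem_cat as_.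
  by rewrite (big_supp ut (r := undup (s ++ t))) // => a as_; rewrite mem_undup mem_cat as_ orbT.
case=> c ->; elim/big_ind: _ => [||i _]; [exact: dec0|exact: decD|].
have /mapP[g ggs ->] := mem_nth 0 (ltn_ord i).
rewrite [c i]mpolyE scaler_suml; elim/big_ind: _ => [||u _]; [exact: dec0|exact: decD|].
set y := _ *: lm g; set b := mon_deg u + g.
have yb : laurent_comp b y.
  by apply: laurent_compX; exists 1; rewrite mpolyC1 scale1r.
exists [:: b], (fun a => if a == b then y else 0); split=> //.
- rewrite /= andbT; apply/hasP; exists g => //.
  by rewrite /b mon_deg11 /= !lerDr.
- by move=> a; case: eqP => [->|_] //; apply: laurent_comp0.
- by move=> a; rewrite inE => /negbTE ->.
by rewrite big_seq1 eqxx.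
Qed.

Lemma monomial_ideal_fractional : fractional_monomial_ideal monomial_ideal.
Proof.
split; first by exists [seq lm g | g <- gs].
  by move=> x /monomial_ideal_decomp[s [f [us _ Cf _ ->]]]; exists s, f.
move=> x /monomial_ideal_decomp[s [f [us ups Cf f0 ->]]].
exists s, f; split=> // a; split=> //.
have [as_|/f0 ->] := boolP (a \in s); last exact: submod_span0.
by apply: monomial_ideal_comp (Cf a); move/allP: ups; apply.
Qed.

Lemma monomial_ideal_Hilb a : Hilb_ideal monomial_ideal a = (above a)%:Z.
Proof.
rewrite /Hilb_ideal /hilbert_series; congr Posz; have [ab|nab] := boolP (above a).
  apply: (@Kdim_list K 1 1 (fracS K) [:: lm a]) => /=.
    by split=> //; apply/eqP/laurent_monomial_neq0.
  apply/seteqP; split=> x.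
    move=> [c [z [-> ->]]].
    have xa : laurent_comp a (c%:MP *: lm a : fracS K) by exists c.
    by rewrite addr0; split => //; apply: monomial_ideal_comp xa.
  by move=> [_ [c ->]]; exists c, 0; rewrite addr0.
apply: (@Kdim_list K 1 1 (fracS K) [::]) => //=; apply/seteqP; split=> x.
  by move=> ->; split; [exact: submod_span0|exact: laurent_comp0].
move=> [/monomial_ideal_decomp[s [f [us ups Cf f0 xE]]] xa].
have as_ : a \notin s by apply: contra nab; move/allP: ups; apply.
have := @laurent_free K (a :: s) (fun b => if b == a then - x else f b).
rewrite /= as_ us => /(_ isT) h; apply/eqP; rewrite -oppr_eq0; apply/eqP.
have := h _ _ a (mem_head _ _); rewrite eqxx; apply.
  by move=> b; case: eqP => [->|_] //; apply: laurent_compN.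
rewrite big_cons eqxx [in LHS]xE addrC; apply/eqP; rewrite subr_eq0; apply/eqP.
by apply: eq_big_seq => b bs; case: eqP => // ba; rewrite -ba bs in as_.
Qed.

End MonomialIdeal.

(** The members of a declining sequence that dominate [v] form an interval of
    it.  Consecutive members dominate [v] exactly when their meet does, and an
    interval has one more member than it has consecutive pairs, unless it is
    empty. *)
Lemma declining_count (U : seq (int * int)) (v : int * int) : declining U ->
  \sum_(u <- U) ((v.1 <= u.1) && (v.2 <= u.2))%:Z -
  \sum_(w <- meet_seq U) ((v.1 <= w.1) && (v.2 <= w.2))%:Z =
  (has (fun u => (v.1 <= u.1) && (v.2 <= u.2)) U)%:Z.
Proof.
case: U => [|u U]; first by rewrite !big_nil.
elim: U u => [|u' U IH] u; first by rewrite /= big_seq1 big_nil subr0 orbF.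
move=> dU; have /andP[u'P pU] : all (fun w => (u.1 < w.1) && (w.2 < u.2)) (u' :: U).
  apply: (@order_path_min _ (fun u w : int * int => (u.1 < w.1) && (w.2 < u.2))) dU.
  by move=> y x z /andP[h1 h2] /andP[h3 h4]; rewrite (lt_trans h1) ?(lt_trans h4).
have {}dU : declining (u' :: U) by case/andP: dU.
have pU' : all (fun w => w.2 < u'.2) U.
  apply: sub_all (@order_path_min _ (fun u w : int * int => (u.1 < w.1) && (w.2 < u.2)) _ _ _ dU).
    by move=> w /andP[].
  by move=> y x z /andP[h1 h2] /andP[h3 h4]; rewrite (lt_trans h1) ?(lt_trans h4).
have := IH u' dU; rewrite /= !big_cons /cmeet /=.
set A := \sum_(j <- U) _; set B := \sum_(w <- _) _.
rewrite !le_min; set p1 := v.1 <= u.1; set p2 := v.2 <= u.2.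
set q1 := v.1 <= u'.1; set q2 := v.2 <= u'.2.
have pq1 : p1 -> q1 by move=> h; apply: le_trans h _; case/andP: u'P => /ltW.
have qp2 : q2 -> p2 by move=> h; apply: le_trans h _; case/andP: u'P => _ /ltW.
have hq : has (fun u => (v.1 <= u.1) && (v.2 <= u.2)) U -> q2.
  case/hasP => w wU /andP[_ h]; apply: le_trans h (ltW _).
  by move/allP: pU' => /(_ w wU).
move: pq1 qp2 hq; case: (has _ _); case: p1; case: p2; case: q1; case: q2 => /=;
  try by [move=> /(_ isT)|move=> _ /(_ isT)|move=> _ _ /(_ isT)]; lia.
Qed.

(** The degree [a] part of the ideal generated by the monomials of exponents
    [- u] is nonzero exactly when some [u] dominates [- a], so its series is
    counted by [declining_count]. *)
Lemma staircase_ideal_criterion (K : fieldType) (H : int * int -> int) :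
    laurent_series H ->
    (forall I : set (fracS K), fractional_monomial_ideal I ->
      series_ge0 (series_div (series_mul H (Hilb_ideal I)) (quadrant 0))) ->
  forall U, declining U -> \sum_(a <- meet_seq U) H a <= \sum_(a <- U) H a.
Proof.
move=> lH HI U dU; pose gs := [seq - u | u <- U].
have := HI _ (monomial_ideal_fractional K gs) 0.
have -> : Hilb_ideal (monomial_ideal (K := K) gs) = fun a =>
    \sum_(u <- U) quadrant (- u) a - \sum_(u <- meet_seq U) quadrant (- u) a.
  apply/funext => a; rewrite monomial_ideal_Hilb /above has_map.
  have qE u : quadrant (- u) a = (((- a).1 <= u.1) && ((- a).2 <= u.2))%:Z.
    by rewrite /quadrant /= lerNl [- u.2 <= _]lerNl.
  under eq_bigr do rewrite qE; under [X in _ - X]eq_bigr do rewrite qE.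
  rewrite (declining_count _ dU); congr (Posz (nat_of_bool _)).
  by apply: eq_has => u /=; rewrite lerNl [- u.2 <= _]lerNl.
have lQ (s : seq (int * int)) : laurent_series (fun a => \sum_(u <- s) quadrant (- u) a).
  by apply: laurent_sum => u; apply: laurent_quadrant.
rewrite series_div_quadrant; last by apply: laurent_mul => //; apply/laurentD/laurentN.
have -> : series_mul H (fun a => \sum_(u <- U) quadrant (- u) a -
    \sum_(u <- meet_seq U) quadrant (- u) a) = fun a =>
    \sum_(u <- U) series_mul H (quadrant (- u)) a -
    \sum_(u <- meet_seq U) series_mul H (quadrant (- u)) a.
  apply/funext => a; rewrite series_mulBr // !series_mul_sumr // => u; exact: laurent_quadrant.
have diffS (s t : seq (int * int)) (F : int * int -> int * int -> int) a :
    diff (1, 0) (diff (0, 1) (fun a => \sum_(u <- s) F u a - \sum_(u <- t) F u a)) a =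
    \sum_(u <- s) diff (1, 0) (diff (0, 1) (F u)) a -
    \sum_(u <- t) diff (1, 0) (diff (0, 1) (F u)) a.
  by rewrite /diff !sumrB; ring.
rewrite diffS; under eq_bigr do rewrite series_mul_quadrant // sub0r opprK.
under [X in _ - X]eq_bigr do rewrite series_mul_quadrant // sub0r opprK.
by rewrite subr_ge0.
Qed.

(** * The equivalence *)

Lemma fin_gen_torsionfree_mono (K : fieldType) (N : gmod K 1 1) :
    fin_gen N -> torsionfree N ->
  (forall a, Hilb N a <= Hilb N (a + (1, 0))) /\ (forall a, Hilb N a <= Hilb N (a + (0, 1))).
Proof.
move=> fgN tfN; have gG := gcompP N.
have step (i : 'I_(1 + 1)) a : Hilb N a <= Hilb N (a + var_deg i).
  rewrite /Hilb /hilbert_series lez_nat.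
  have fd := fin_gen_fin_dim gG fgN; have sG := grading_subspace gG.
  have s0 : subspace ([set 0] : set (resK N)) by exact: (lspan_subspace (V := resK N) [::]).
  have := @Kdim_relative K 1 1 N (@gcomp _ _ _ N a) [set 0] (@gcomp _ _ _ N (a + var_deg i))
    [set 0] (fun x : N => ('X_i : {mpoly K[1 + 1]}) *: x).
  rewrite Kdim0 !addn0; apply => //.
  - by move=> x ->; apply: (grading0 gG).
  - by move=> x ->; apply: (grading0 gG).
  - by move=> c x y; rewrite scalerDr !resKE !scalerA mulrC.
  - by move=> x Gx; rewrite addrC; apply: (gradingZ gG) => //; apply: poly_comp_var.
  move=> x _ /tfN[/eqP X0|//]; have := tofrac_var_neq0 K i.
  by rewrite (eqP X0) tofrac0 eqxx.
split=> a; first by have := step (lshift 1 ord0) a; rewrite var_degE.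
by have := step (rshift 1 ord0) a; rewrite var_degE.
Qed.

Lemma positive_depth_ge0 (K : fieldType) (m mt : nat) (H : int * int -> int)
    (N : gmod K 1 1) : laurent_series H -> (EFin (0 : int) < hilbert_depth K m mt H)%O ->
    fin_gen N -> torsionfree N ->
  series_ge0 (series_div (series_mul H (Hilb N)) (quadrant 0)).
Proof.
move=> lH /supremum_gt0[_ [M [fgM HM ->]] dM] fgN tfN.
have [H1 [H1b H1S H2S]] := socle_free_split (gcompP M) fgM (depth_gt0_socle (gcompP M) fgM dM).
have lN := box_sum_laurent (fin_gen_hilbert_box (gcompP N) fgN).
have [N1 N2] := fin_gen_torsionfree_mono fgN tfN.
rewrite -HM in lH *; exact: (series_ge0_split lH lN H1b H1S H2S N1 N2).
Qed.

Lemma fractional_ideal_ge0 (K : fieldType) (H : int * int -> int) :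
    laurent_series H ->
    (forall N : gmod K 1 1, fin_gen N -> torsionfree N -> has_rank N 1 ->
      series_ge0 (series_div (series_mul H (Hilb N)) (quadrant 0))) ->
  forall I : set (fracS K), fractional_monomial_ideal I ->
    series_ge0 (series_div (series_mul H (Hilb_ideal I)) (quadrant 0)).
Proof.
move=> lH HN I hI; rewrite -(ideal_Hilb hI).
(* the zero ideal has rank 0 and is treated apart *)
have [nz|z] := pselect (exists2 x, I x & x != 0).
  by apply: HN; [exact: ideal_fin_gen|exact: ideal_torsionfree|exact: ideal_rank1].
have -> : Hilb (ideal_gmod hI) = fun=> 0.
  apply/funext => a; rewrite /Hilb /hilbert_series; congr Posz.
  apply: (@Kdim_list K 1 1 (ideal_gmod hI) [::]) => //; apply/seteqP; split=> x.
    by move=> ->; apply: (grading0 (gcompP (ideal_gmod hI))).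
  move=> _; apply: (@ideal_val_inj K I hI); apply: contrapT => /eqP x0; apply: z.
  by exists (ideal_val x) => //; exact: ideal_valP.
have -> : series_mul H (fun=> 0) = fun=> 0.
  by apply/funext => a; apply: fsbig1 => b _; rewrite mulr0.
rewrite series_div_quadrant; last by exists 0.
by move=> a; rewrite /diff !subrr.
Qed.

Theorem theorem5p3 (K : fieldType) (m mt : nat) (H : int * int -> int)
    (H_laurent : laurent_series H) (H_Hilb : is_Hilb K m mt H) :
  let H_S := Hilb (poly_gmod K 1 1) in
  [<-> (EFin (0 : int) < hilbert_depth K m mt H)%O;
       forall N : gmod K 1 1, fin_gen N -> torsionfree N ->
         series_ge0 (series_div (series_mul H (Hilb N)) H_S);
       forall N : gmod K 1 1, fin_gen N -> torsionfree N -> has_rank N 1 ->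
         series_ge0 (series_div (series_mul H (Hilb N)) H_S);
       forall I : set (fracS K), fractional_monomial_ideal I ->
         series_ge0 (series_div (series_mul H (Hilb_ideal I)) H_S);
       forall U : seq (int * int), declining U ->
         \sum_(a <- meet_seq U) H a <= \sum_(a <- U) H a].
Proof.
move=> H_S; rewrite /H_S hilbert_S; tfae.
- by move=> depth_pos N; apply: positive_depth_ge0 depth_pos.
- by move=> HN N fgN tfN _; apply: HN.
- exact: fractional_ideal_ge0.
- exact: staircase_ideal_criterion.
move=> HU; have [N fgN HN] := H_Hilb.
apply/depth_of_box_sum/staircase_box_pos => //.
by rewrite -HN; apply: fin_gen_hilbert_box (gcompP N) fgN.
Qed.
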